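(* Let $\Omega\subset\mathbb{R}^n$ be a bounded open set, let $s\in(0,1)$, and let $G$ be a Young function such that $1<p^-\le \frac{t g(t)}{G(t)}\le p^+<\infty$ for all $t>0$. Then for every $\mu>0$ there exists a positive eigenvalue $\lambda_{1,\mu}$ of $$(-\Delta_g)^su=\lambda g(|u|)\frac{u}{|u|}\ \text{ in }\Omega,\qquad u=0\ \text{ in }\mathbb{R}^n\setminus\Omega,$$ with a non-negative eigenfunction $u_{1,\mu}\in W^{s,G}_0(\Omega)$ such that $\int_\Omega G(|u_{1,\mu}|)\,dx=\mu$. Moreover, $\lambda_{1,\mu}$ is bounded from below by a positive constant independent of $\mu$.
   Context: A Young function is a function $G:[0,\infty)\to[0,\infty)$ of the form $G(t)=\int_0^t g(\tau)\,d\tau$, where $g:[0,\infty)\to[0,\infty)$ is right continuous and nondecreasing, $g(0)=0$, $g(t)>0$ for $t>0$, and $\lim_{t\to\infty}g(t)=\infty$. Put $D_su(x,y)=\frac{u(x)-u(y)}{|x-y|^s}$. For an open set $U\subseteq\mathbb{R}^n$, $W^{s,G}(U)$ is the set of measurable $u:\mathbb{R}^n\to\mathbb{R}$ with $\int_U G(|u|)\,dx<\infty$ and $\iint_{\mathbb{R}^n\times\mathbb{R}^n}G(|D_su|)\frac{dx\,dy}{|x-y|^n}<\infty$, and $W^{s,G}_0(\Omega)=\{u\in W^{s,G}(\mathbb{R}^n):u=0\text{ a.e. in }\mathbb{R}^n\setminus\Omega\}$. A number $\lambda\in\mathbb{R}$ is an eigenvalue with eigenfunction $u\in W^{s,G}_0(\Omega)\setminus\{0\}$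 if $$\langle(-\Delta_g)^su,v\rangle:=\iint_{\mathbb{R}^n\times\mathbb{R}^n}g(|D_su|)\frac{D_su}{|D_su|}D_sv\,\frac{dx\,dy}{|x-y|^n}=\lambda\int_\Omega g(|u|)\frac{u}{|u|}v\,dx\quad\text{for all }v\in W^{s,G}_0(\Omega).$$ Expressions $g(|a|)\frac{a}{|a|}$ are understood as $0$ when $a=0$. *)

(* Defs.v *)
From HB Require Import structures.
From mathcomp Require Import all_boot all_order all_algebra.
From mathcomp Require Import all_classical all_reals all_analysis.
Set Implicit Arguments.
Unset Strict Implicit.
Unset Printing Implicit Defensive.
Import Order.TTheory GRing.Theory Num.Theory.
Import numFieldNormedType.Exports.
Local Open Scope classical_set_scope.
Local Open Scope ring_scope.

(* R^n is ['rV[R]_n], with the library's topology.  Its Borel sigma-algebra is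
   presented as the product one, as the library does for tuples. *)
Definition rV_display : measure_display.
Proof. exact. Qed.

Section rV_measurable.
Context {R : realType} (n : nat).

Let coord_rV : 'I_n -> 'rV[R]_n -> R := fun i x => x 0 i.

Let rV_set0 : g_sigma_preimage coord_rV set0.
Proof. exact: sigma_algebra0. Qed.

Let rV_setC A : g_sigma_preimage coord_rV A -> g_sigma_preimage coord_rV (~` A).
Proof. exact: sigma_algebraC. Qed.

Let rV_bigcup (F : (set 'rV[R]_n)^nat) :
  (forall i, g_sigma_preimage coord_rV (F i)) ->
  g_sigma_preimage coord_rV (\bigcup_i F i).
Proof. exact: sigma_algebra_bigcup. Qed.

HB.instance Definition _ := @isMeasurable.Build rV_display
  'rV[R]_n (g_sigma_preimage coord_rV) rV_set0 rV_setC rV_bigcup.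

Lemma measurable_coord_rV (i : 'I_n) :
  measurable_fun [set: 'rV[R]_n] (fun x : 'rV[R]_n => x 0 i).
Proof.
move=> _ Y mY; rewrite setTI; apply: sub_sigma_algebra => /=.
rewrite -bigcup_seq/=; exists i => /=; first by rewrite mem_index_enum.
by exists Y => //; rewrite setTI.
Qed.

Lemma measurable_fun_rVP d (T : measurableType d) (f : T -> 'rV[R]_n) :
  (forall i, measurable_fun [set: T] (fun t => f t 0 i)) ->
  measurable_fun [set: T] f.
Proof.
move=> mf; apply: (@measurability _ _ _ _ _ f (\big[setU/set0]_(i < n)
  preimage_set_system setT (coord_rV i) (@measurable _ R))) => //.
move=> _ [B + <-]; rewrite -bigcup_seq => -[i _ [A mA <-]].
rewrite setTI; exact: mf.
Qed.

End rV_measurable.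

Definition cons_rV {R : realType} n (p : R * 'rV[R]_n) : 'rV[R]_n.+1 :=
  \row_i if unlift ord0 i is Some j then p.2 0 j else p.1.

Section cons_rV.
Context {R : realType} (n : nat).

Lemma measurable_cons_rV :
  measurable_fun [set: R * 'rV[R]_n] (@cons_rV R n).
Proof.
apply: measurable_fun_rVP => i; under eq_fun do rewrite mxE.
case: unliftP => [j|] _; last exact: measurable_fst.
exact: (measurableT_comp (measurable_coord_rV j) measurable_snd).
Qed.


Let uncons_rV (x : 'rV[R]_n.+1) : R * 'rV[R]_n :=
  (x 0 0, \row_j x 0 (lift ord0 j)).

Let uncons_rVK : cancel (@cons_rV R n) uncons_rV.
Proof.
move=> [a v]; congr pair; first by rewrite mxE unlift_none.
by apply/rowP => j; rewrite !mxE liftK.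
Qed.

Let measurable_uncons_rV : measurable_fun [set: 'rV[R]_n.+1] uncons_rV.
Proof.
apply: measurable_fun_pair; first exact: measurable_coord_rV.
apply: measurable_fun_rVP => i; under eq_fun do rewrite mxE.
exact: measurable_coord_rV.
Qed.

Variable mu : {sigma_finite_measure set 'rV[R]_n -> \bar R}.

Definition cons_measure : set 'rV[R]_n.+1 -> \bar R :=
  pushforward ((@lebesgue_measure R) \x mu)%E (@cons_rV R n).

Let cons0 : cons_measure set0 = 0%E.
Proof. by rewrite /cons_measure /pushforward preimage_set0 measure0. Qed.

Let cons_ge0 A : (0 <= cons_measure A)%E.
Proof. by rewrite /cons_measure /pushforward; exact: measure_ge0. Qed.

Let cons_sigma_additive : semi_sigma_additive cons_measure.
Proof.
move=> F mF tF mUF; rewrite /cons_measure /pushforward preimage_bigcup.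
apply: measure_semi_sigma_additive.
- by move=> k; rewrite -[X in measurable X]setTI; exact: measurable_cons_rV.
- apply/trivIsetP => /= i j _ _ ij; rewrite -preimage_setI.
  by move/trivIsetP : tF => /(_ _ _ _ _ ij) ->//; rewrite preimage_set0.
- rewrite -preimage_bigcup -[X in measurable X]setTI.
  exact: measurable_cons_rV.
Qed.

HB.instance Definition _ := isMeasure.Build _ _ _ cons_measure
  cons0 cons_ge0 cons_sigma_additive.

Let cons_sigma_finite : sigma_finite setT cons_measure.
Proof.
have /sigma_finiteP[F [TF ndF Foo]] :=
  sigma_finiteT (@lebesgue_measure R : {sigma_finite_measure set _ -> \bar R}).
have /sigma_finiteP[G [TG ndG Goo]] := sigma_finiteT mu.
exists (fun k => uncons_rV @^-1` (F k `*` G k)).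
  apply/esym; rewrite -subTset => x _.
  have [i _ Fi] : (\bigcup_k F k) (uncons_rV x).1 by rewrite -TF.
  have [j _ Gj] : (\bigcup_k G k) (uncons_rV x).2 by rewrite -TG.
  exists (maxn i j) => //; split.
    by apply: (subsetPset _ _ (ndF _ _ (leq_maxl i j))).
  by apply: (subsetPset _ _ (ndG _ _ (leq_maxr i j))).
move=> k; have [mF Fk] := Foo k; have [mG Gk] := Goo k; split.
  by rewrite -[X in measurable X]setTI; apply: measurable_uncons_rV => //;
    exact: measurableX.
rewrite /cons_measure /pushforward -comp_preimage.
rewrite (_ : _ \o _ = id); last by apply/funext => p /=; rewrite uncons_rVK.
by rewrite preimage_id product_measure1E// lte_mul_pinfty// ge0_fin_numE.
Qed.

HB.instance Definition _ := Measure_isSigmaFinite.Build _ _ _ cons_measure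
  cons_sigma_finite.

End cons_rV.

(* Lebesgue measure on R^n, as the n-fold product of the one on R. *)
Fixpoint lebesgue_rV (R : realType) (n : nat) :
    {sigma_finite_measure set 'rV[R]_n -> \bar R} :=
  if n is n'.+1 then cons_measure (lebesgue_rV R n')
  else \d_(0 : 'rV[R]_0).

Definition enorm (R : realType) (n : nat) (x : 'rV[R]_n) : R :=
  Num.sqrt (\sum_(i < n) x 0 i ^+ 2).

(* [g] and [G] are total; only their values on [0, +oo[ matter.  Nonnegativity
   of [g] there follows from the first two fields. *)
Record is_young (R : realType) (g G : R -> R) : Prop := IsYoung {
  young_g0 : g 0 = 0;
  young_gt0 : forall t : R, 0 < t -> 0 < g t;
  young_nondecreasing : forall t t' : R, 0 <= t -> t <= t' -> g t <= g t';
  young_right_continuous : forall t : R, 0 <= t -> g x @[x --> t^'+] --> g t;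
  young_unbounded : g x @[x --> +oo] --> +oo;
  young_integral : forall t : R, 0 <= t ->
    ((G t)%:E = \int[lebesgue_measure]_(x in `[0%R, t]) (g x)%:E)%E }.

Section fractional_orlicz_sobolev.
Context (R : realType) (n : nat).
Implicit Types (u v : 'rV[R]_n -> R) (x y : 'rV[R]_n) (U Omega : set 'rV[R]_n).

Local Notation mu := (lebesgue_rV R n).

(* Division by 0 is 0, so D_s u and the kernel |x - y|^-n vanish on the
   diagonal, a null set for n > 0. *)
Definition Dquot (s : R) u x y : R := (u x - u y) / (enorm (x - y) `^ s).

Definition W_sG (s : R) (G : R -> R) U u : Prop :=
  [/\ measurable_fun setT u,
      (\int[mu]_(x in U) (G `|u x|)%:E < +oo)%E &
      (\int[mu \x mu]_z
        (G `|Dquot s u z.1 z.2| / enorm (z.1 - z.2) ^+ n)%:E < +oo)%E].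

Definition W0_sG (s : R) (G : R -> R) Omega u : Prop :=
  W_sG s G setT u /\ {ae mu, forall x, ~ Omega x -> u x = 0}.

(* g(|a|) a/|a|, which is 0 at a = 0 *)
Definition sg (g : R -> R) (a : R) : R := g `|a| * (a / `|a|).

Definition frac_glap (s : R) (g : R -> R) u v : \bar R :=
  (\int[mu \x mu]_z (sg g (Dquot s u z.1 z.2) * Dquot s v z.1 z.2
                    / enorm (z.1 - z.2) ^+ n)%:E)%E.

Definition is_eigenpair (s : R) (g G : R -> R) Omega (lambda : R) u : Prop :=
  [/\ W0_sG s G Omega u,
      ~ {ae mu, forall x, u x = 0} &
      forall v, W0_sG s G Omega v ->
        frac_glap s g u v
          = (lambda%:E * \int[mu]_(x in Omega) (sg g (u x) * v x)%:E)%E].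

End fractional_orlicz_sobolev.

(* Main.v *)
Require Import Defs.
From HB Require Import structures.
From mathcomp Require Import all_boot all_order all_algebra.
From mathcomp Require Import all_classical all_reals all_analysis.
From mathcomp Require Import measurable_realfun ring lra.
Set Implicit Arguments.
Unset Strict Implicit.
Unset Printing Implicit Defensive.
Import Order.TTheory GRing.Theory Num.Theory.
Import numFieldNormedType.Exports.
Local Open Scope classical_set_scope.
Local Open Scope ring_scope.

(** Write [mass u] for the integral of [G |u|] over [Omega] and [energy u] for that of
    [G |D_s u| / |x - y|^n] over the pairs [(x, y)]. The eigenfunction is a minimiser
    of the energy among the functions of [W0_sG] of given mass, and the eigenvalue is
    its Lagrange multiplier.

    Existence of the minimiser rests on compactness ([modular_compactness]). On a small
    cube, [u] is close in modular to one of its own values: on average over [y] in the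
    cube, the integral of [G |u x - u y|] is controlled by the energy, with a factor that
    tends to 0 with the side ([cube_mean], [cube_energy]). So functions of bounded energy
    are uniformly close to step functions on a fixed grid, whose coefficients converge
    along an ultrafilter; a Borel-Cantelli argument extracts a subsequence that converges
    almost everywhere and in modular. Fatou's lemma handles the energy, and the doubling
    property of [G], which follows from [t g t <= p^+ G t], preserves the mass. A tent
    function ([test_function]), suitably dilated, shows that the constraint can be met,
    and replacing [u] by [|u|] makes the minimiser nonnegative.

    The multiplier needs care because [g] may jump, so that neither functional need be
    differentiable. For the energy the jumps are harmless: they are countably many, and
    the level sets of [D_s u] at nonzero heights are null for the product measure
    ([Dquot_level_null]). Indeed, two slices of such a level set, at two points [x] that
    differ in one coordinate, have a null intersection, since [r |-> (c + r^2)^(s/2)] has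
    no two equal increments on an interval without inflection point; and an uncountable
    family of almost disjoint slices is almost everywhere null. For the mass, [u] may
    well sit on a jump on a set of positive measure; but a constrained minimiser of the
    energy is also a maximiser of the mass among the functions of no larger energy
    ([minimizer_maximizes]), and at a maximum of a convex function every subgradient obeys
    the first order condition. So if [w] decreases the energy to first order, then
    [\int g(|u|) (u / |u|) w <= 0] ([energy_descent]), and two linear forms related in
    this way are proportional ([proportional_forms]).

    Testing the equation with [u] itself, the multiplier is at least
    [energy u / (p^+ * mass u)], which the Poincare inequality ([poincare]) bounds from
    below by a constant that does not depend on the mass. *)

(** * Young functions *)

Section young_function.
Context (R : realType) (g G : R -> R) (Yg : is_young g G).

Lemma young_ge0 (t : R) : 0 <= t -> 0 <= g t.
Proof.
by move=> t0; rewrite -(young_g0 Yg); exact: (young_nondecreasing Yg).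
Qed.

Let gp (x : R) : R := g (Num.max 0 x).

Let gp_nd : nondecreasing_fun gp.
Proof.
move=> x y xy; apply: (young_nondecreasing Yg); first by rewrite le_max lexx.
by rewrite ge_max le_max lexx /= le_max xy orbT.
Qed.

Let mgp (D : set R) : measurable D -> measurable_fun D gp.
Proof. by move=> mD; exact: nondecreasing_measurable. Qed.

Let gpE (x : R) : 0 <= x -> gp x = g x.
Proof. by move=> x0; rewrite /gp; congr g; apply/max_idPr. Qed.

Let gp_ge0 (x : R) : 0 <= gp x.
Proof. by apply: young_ge0; rewrite le_max lexx. Qed.

Let GE (t : R) : 0 <= t ->
  (G t)%:E = (\int[lebesgue_measure]_(x in `[0%R, t]) (gp x)%:E)%E.
Proof.
move=> t0; rewrite (young_integral Yg)//; apply: eq_integral => x.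
by rewrite inE /= in_itv /= => /andP[x0 _]; rewrite gpE.
Qed.

Let GB (a b : R) : 0 <= a -> a <= b ->
  (G b)%:E = ((G a)%:E + \int[lebesgue_measure]_(x in `]a, b]) (gp x)%:E)%E.
Proof.
move=> a0 ab; rewrite !GE//; last exact: le_trans ab.
rewrite -ge0_integral_setU//=.
- by congr integral; rewrite -itv_bndbnd_setU// bnd_simp.
- by apply/measurable_EFinP; apply: mgp; exact: measurableU.
- by move=> x _; rewrite lee_fin.
- apply/disj_setPS => x [] /=; rewrite !in_itv/= => /andP[_ xa] /andP[ax _].
  by have := le_lt_trans xa ax; rewrite ltxx.
Qed.

(** Monotonicity of [g] under the integral. What is used of [G] from here on follows
    from this two-sided estimate and from [G 0 = 0]. *)
Lemma young_bounds (a b : R) : 0 <= a -> a <= b ->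
  (b - a) * g a <= G b - G a <= (b - a) * g b.
Proof.
move=> a0 ab; have b0 : 0 <= b by exact: le_trans ab.
have mab : measurable (`]a, b]%classic : set R) by [].
have cst (c : R) : (\int[lebesgue_measure]_(x in `]a, b]) c%:E = ((b - a) * c)%:E)%E.
  rewrite integral_cst//= lebesgue_measure_itv /= lte_fin.
  case: ltP => [ab'|ba]; first by rewrite -EFinB -EFinM mulrC.
  have -> : b = a by apply/eqP; rewrite eq_le ab ba.
  by rewrite mule0 subrr mul0r.
have I : (((b - a) * g a)%:E <= \int[lebesgue_measure]_(x in `]a, b]) (gp x)%:E
   <= ((b - a) * g b)%:E)%E.
  rewrite -!cst; apply/andP; split; apply: ge0_le_integral => //=.
  - by move=> x _; rewrite lee_fin young_ge0.
  - by apply/measurable_EFinP; exact: mgp.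
  - move=> x; rewrite /= in_itv /= => /andP[ax xb]; rewrite lee_fin -gpE//.
    by apply: gp_nd; exact: ltW.
  - by move=> x _; rewrite lee_fin.
  - by apply/measurable_EFinP; exact: mgp.
  - move=> x; rewrite /= in_itv /= => /andP[ax xb]; rewrite lee_fin -[leRHS]gpE//.
    exact: gp_nd.
move: I.
have -> : (\int[lebesgue_measure]_(x in `]a, b]) (gp x)%:E)%E = (G b - G a)%:E.
  have := GB a0 ab; case: (integral _ _ _) => [r| |] // [->].
  by congr (_%:E); rewrite addrAC subrr add0r.
by rewrite !lee_fin.
Qed.

Lemma young_G0 : G 0 = 0.
Proof.
by have := young_integral Yg (lexx 0); rewrite set_itv1 integral_set1 => -[].
Qed.

Lemma young_mono (a b : R) : 0 <= a -> a <= b -> G a <= G b.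
Proof.
move=> a0 ab; have /andP[+ _] := young_bounds a0 ab.
by have := young_ge0 a0; nra.
Qed.

Lemma youngG_ge0 (t : R) : 0 <= t -> 0 <= G t.
Proof. by move=> t0; rewrite -young_G0; exact: young_mono. Qed.

Lemma youngG_gt0 (t : R) : 0 < t -> 0 < G t.
Proof.
move=> t0.
have t2 : 0 < t / 2 by lra.
have t2t : t / 2 <= t by lra.
have /andP[+ _] := young_bounds (ltW t2) t2t; have := young_gt0 Yg t2; have := youngG_ge0 (ltW t2).
have -> : t - t / 2 = t / 2 by field.
by nra.
Qed.

(** Every use of convexity goes back to this support line; its slope [g a] is
    admissible even where [g] jumps. *)
Lemma young_subgradient (a b : R) : 0 <= a -> 0 <= b ->
  G a + g a * (b - a) <= G b.
Proof.
move=> a0 b0; have [ab|/ltW ba] := leP a b.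
  by have /andP[+ _] := young_bounds a0 ab; lra.
by have /andP[_ +] := young_bounds b0 ba; lra.
Qed.

(** The even extension of the support line: [(a / |a|) (b - a) <= |b| - |a|]
    reduces it to [young_subgradient] at [|a|] and [|b|]. *)
Lemma sg_subgradient (a b : R) : G `|a| + sg g a * (b - a) <= G `|b|.
Proof.
have [->|a0] := eqVneq a 0.
  rewrite /sg mul0r mulr0 mul0r addr0 normr0; apply: young_mono => //.
apply: le_trans (young_subgradient (normr_ge0 a) (normr_ge0 b)).
rewrite lerD2l /sg -mulrA; apply: ler_wpM2l; first exact: young_ge0.
have na : 0 < `|a| by rewrite normr_gt0.
rewrite mulrBr lerD//.
  apply: le_trans (ler_norm _) _; rewrite normrM normf_div normr_id.
  by rewrite divff ?mul1r// gt_eqF.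
rewrite lerN2 mulrAC -expr2 -real_normK ?num_real// expr2 mulfK//.
by rewrite gt_eqF.
Qed.

Lemma young_convex (t a b : R) : 0 <= t <= 1 -> 0 <= a -> 0 <= b ->
  G (t * a + (1 - t) * b) <= t * G a + (1 - t) * G b.
Proof.
move=> /andP[t0 t1] a0 b0; set m := t * a + _.
have m0 : 0 <= m by rewrite /m; nra.
have Ha := young_subgradient m0 a0; have Hb := young_subgradient m0 b0.
have u0 : 0 <= 1 - t by lra.
have := lerD (ler_wpM2l t0 Ha) (ler_wpM2l u0 Hb).
have -> : t * (G m + g m * (a - m)) + (1 - t) * (G m + g m * (b - m)) = G m.
  by rewrite /m; ring.
by [].
Qed.

Lemma young_scale (t a : R) : 0 <= t <= 1 -> 0 <= a -> G (t * a) <= t * G a.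
Proof.
move=> t01 a0; have := young_convex t01 a0 (lexx 0).
by rewrite mulr0 addr0 young_G0 mulr0 addr0.
Qed.

Lemma young_scale_ge (t a : R) : 1 <= t -> 0 <= a -> t * G a <= G (t * a).
Proof.
move=> t1 a0; have t0 : 0 < t by lra.
have := @young_scale t^-1 (t * a) _ _.
rewrite invr_ge0 (ltW t0) invf_le1// t1 => /(_ isT).
rewrite mulr_ge0 ?(ltW t0)// => /(_ isT).
by rewrite mulKf ?gt_eqF// ler_pdivlMl.
Qed.

Lemma young_le_linear (t : R) : 0 <= t -> t <= 1 + G t / G 1.
Proof.
move=> t0; have G1 : 0 < G 1 by exact: youngG_gt0.
have [t1|/ltW t1] := leP t 1.
  by apply: (le_trans t1); rewrite lerDl divr_ge0 ?youngG_ge0.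
have := @young_scale_ge t 1 t1 ler01; rewrite mulr1 -ler_pdivlMr// => ?.
lra.
Qed.

Lemma measurable_youngN : measurable_fun [set: R] (fun x => G `|x|).
Proof.
pose Gp (x : R) := G (Num.max 0 x).
have Gpnd : nondecreasing_fun Gp.
  move=> x y xy; apply: young_mono; first by rewrite le_max lexx.
  by rewrite ge_max le_max lexx /= le_max xy orbT.
have -> : (fun x => G `|x|) = Gp \o (fun x : R => `|x|).
  by apply/funext => x /=; rewrite /Gp; congr G; apply/esym/max_idPr.
apply: measurableT_comp; first exact: nondecreasing_measurable.
exact: normr_measurable.
Qed.

Lemma sg_nondecreasing : nondecreasing_fun (sg g).
Proof.
move=> x y xy; rewrite /sg.
have sgE (z : R) : z / `|z| = Num.sg z.
  have [->|z0] := eqVneq z 0; first by rewrite mul0r sgr0.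
  by rewrite {1}[z]numEsg mulfK// normr_eq0.
rewrite !sgE.
have [x0|x0|x0] := ltgtP x 0; last 2 first.
- have y0 : 0 < y by exact: lt_le_trans xy.
  rewrite !gtr0_sg// !mulr1 !gtr0_norm//; by apply: (young_nondecreasing Yg) => //; exact: ltW.
- rewrite x0 sgr0 mulr0; move: xy; rewrite x0 => y0.
  by rewrite mulr_ge0 ?young_ge0// sgr_ge0.
rewrite ltr0_sg// mulrN1.
have [y0|y0] := ltP y 0.
  rewrite ltr0_sg// mulrN1 lerN2 !ltr0_norm//.
  by apply: (young_nondecreasing Yg); lra.
apply: (@le_trans _ _ 0); first by rewrite oppr_le0 young_ge0.
by rewrite mulr_ge0 ?young_ge0// sgr_ge0.
Qed.

Lemma measurable_sg : measurable_fun [set: R] (sg g).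
Proof. exact: nondecreasing_measurable sg_nondecreasing. Qed.

Section delta2.
Variable p : R.
Hypothesis gGp : forall t : R, 0 < t -> t * g t / G t <= p.

Lemma young_tg_le (t : R) : 0 <= t -> t * g t <= p * G t.
Proof.
rewrite le_eqVlt => /predU1P[<-|t0]; first by rewrite mul0r young_G0 mulr0.
by have := gGp t0; rewrite ler_pdivrMr// youngG_gt0.
Qed.

Lemma young_tg_ge (t : R) : 0 <= t -> G t <= t * g t.
Proof. by move=> t0; have := young_subgradient t0 (lexx 0); rewrite young_G0; lra. Qed.

(** Since [T g T <= p (G T)], multiplying [t] by [1 + 1 / (2 p)] increases [G] by a
    factor at most 2, and finitely many such steps reach [2 t]. *)
Lemma young_delta2 : exists2 K : R, (1 : R) <= K & forall t : R, 0 <= t -> G (2 * t) <= K * G t.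
Proof.
have p0 : 0 < p.
  have := young_tg_ge ler01; have := young_tg_le ler01; rewrite mul1r.
  by have := youngG_gt0 ltr01; nra.
(* with this [d], [(T - t) g T = d t (g T) <= d p (G T) = G T / 2] *)
pose d := (2 * p)^-1; have d0 : 0 < d by rewrite invr_gt0; lra.
have step (t : R) : 0 <= t -> G ((1 + d) * t) <= 2 * G t.
  move=> t0; have t0' : 0 <= (1 + d) * t by nra.
  have tT : t <= (1 + d) * t by nra.
  have /andP[_ H1] := young_bounds t0 tT.
  have := young_tg_le t0'; set T := (1 + d) * t in H1 t0' *.
  have gT := young_ge0 t0' => H2.
  have : (T - t) * g T <= G T / 2.
    have -> : T - t = d * t by rewrite /T; ring.
    apply: (@le_trans _ _ (d * (T * g T))).
      by rewrite -mulrA ler_pM2l// ler_wpM2r// /T; nra.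
    apply: (@le_trans _ _ (d * (p * G T))); first by rewrite ler_pM2l.
    have -> : d * (p * G T) = G T / 2 by rewrite /d; field; exact: lt0r_neq0.
    by [].
  by lra.
have step_n (m : nat) (t : R) : 0 <= t -> G ((1 + d) ^+ m * t) <= 2 ^+ m * G t.
  elim: m t => [|m IH] t t0; first by rewrite !expr0 !mul1r.
  rewrite !exprS -!mulrA.
  apply: (le_trans (step _ _)).
    by rewrite mulr_ge0// exprn_ge0//; lra.
  by rewrite ler_pM2l// IH.
have [m Hm] : exists m : nat, 2 <= (1 + d) ^+ m.
  exists (Num.bound (d^-1)).
  apply: (@le_trans _ _ (1 + d * (Num.bound d^-1)%:R)).
    have := archi_boundP (ltW (_ : 0 < d^-1)); rewrite invr_gt0 d0 => /(_ isT).
    by rewrite -(ltr_pM2l d0) mulfV ?gt_eqF// => ?; lra.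
  elim: (Num.bound _) => [|k IH]; first by rewrite mulr0 addr0 expr0.
  rewrite exprS; apply: (@le_trans _ _ ((1 + d) * (1 + d * k%:R))).
    by rewrite -natr1; have : 0 <= k%:R :> R by []; nra.
  by rewrite ler_pM2l//; lra.
exists (2 ^+ m) => [|t t0]; first by rewrite exprn_ege1// ler1n.
apply: le_trans (step_n m t t0); apply: young_mono; first by lra.
by rewrite ler_wpM2r.
Qed.

End delta2.

Section delta2_consequences.
Variable K : R.
Hypothesis K1 : (1 : R) <= K.
Hypothesis GK : forall t : R, 0 <= t -> G (2 * t) <= K * G t.

Let K0 : 0 <= K.
Proof. exact: le_trans ler01 K1. Qed.

Lemma young_add (a b : R) : 0 <= a -> 0 <= b -> G (a + b) <= K * (G a + G b).
Proof.
move=> a0 b0.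
have h : 0 <= (1 / 2 : R) <= 1 by apply/andP; split; lra.
have := young_convex h (mulr_ge0 (ler0n R 2) a0) (mulr_ge0 (ler0n R 2) b0).
have -> : 1 / 2 * (2 * a) + (1 - 1 / 2) * (2 * b) = a + b by field.
have := GK a0; have := GK b0; have Ga := youngG_ge0 a0; have Gb := youngG_ge0 b0.
have : 0 <= K * (G a + G b) by rewrite mulr_ge0// addr_ge0.
by rewrite mulrDr; lra.
Qed.

Lemma young_addN (a b : R) : G `|a + b| <= K * (G `|a| + G `|b|).
Proof.
apply: le_trans (young_add (normr_ge0 _) (normr_ge0 _)).
exact/young_mono/ler_normD.
Qed.

(** [(1 + d) t = d (2 t) + (1 - d) t] is a convex combination, so that doubling
    controls a small dilation by a factor close to 1. *)
Lemma young_dilate (d t : R) : 0 <= d <= 1 -> 0 <= t ->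
  G ((1 + d) * t) <= (1 + d * K) * G t.
Proof.
move=> /andP[d0 d1] t0.
have := @young_convex d (2 * t) t; rewrite d0 d1 mulr_ge0// t0.
move=> /(_ isT isT isT).
have -> : d * (2 * t) + (1 - d) * t = (1 + d) * t by ring.
have := GK t0; have := youngG_ge0 t0 => ? ? /le_trans; apply.
nra.
Qed.

Lemma young_pow2 (m : nat) (t : R) : 0 <= t -> G (2 ^+ m * t) <= K ^+ m * G t.
Proof.
elim: m t => [|m IH] t t0; first by rewrite !expr0 !mul1r.
rewrite !exprS -!mulrA; apply: le_trans (GK _) _.
  by rewrite mulr_ge0// exprn_ge0.
by rewrite ler_wpM2l// IH.
Qed.

(** With [S = |a| + |b|], the left-hand side is at most [S g S <= p (G S)], which
    doubling splits. Hence two functions of finite modular have a finite pairing. *)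
Lemma sg_mul_le (p a b : R) :
  (forall t : R, 0 < t -> t * g t / G t <= p) -> 0 <= p ->
  `|sg g a * b| <= p * K * (G `|a| + G `|b|).
Proof.
move=> gGp p0.
have S0 : 0 <= `|a| + `|b| by rewrite addr_ge0.
apply: (@le_trans _ _ ((`|a| + `|b|) * g (`|a| + `|b|))).
  rewrite normrM mulrC; apply: ler_pM => //; first by rewrite lerDr.
  rewrite /sg normrM ger0_norm ?young_ge0//.
  apply: (@le_trans _ _ (g `|a|)); last by apply: (young_nondecreasing Yg) => //; rewrite lerDl.
  rewrite -[leRHS]mulr1 ler_wpM2l ?young_ge0// normf_div normr_id.
  have [->|a0] := eqVneq a 0; first by rewrite normr0 mul0r.
  by rewrite divff// normr_eq0.
apply: le_trans (young_tg_le gGp S0) _.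
by rewrite -mulrA ler_wpM2l// young_add.
Qed.

Lemma young_continuousN : continuous (fun x : R => G `|x|).
Proof.
move=> x; pose M := g (`|x| + 1).
have M0 : 0 <= M by apply: young_ge0; rewrite addr_ge0.
apply/cvgrPdist_le => e e0; near=> y.
have yx : `|x - y| <= 1 by near: y; apply: cvgr_dist_le => //; exact: ltr01.
have ye : `|x - y| <= e / (M + 1).
  by near: y; apply: cvgr_dist_le => //; apply: divr_gt0 => //; lra.
have yN : `|y| <= `|x| + 1.
  have -> : y = x - (x - y) by ring.
  by apply: le_trans (ler_normB _ _) _; rewrite lerD2l.
have main (a b : R) : 0 <= a -> a <= b -> b <= `|x| + 1 ->
    `|G b - G a| <= (b - a) * M.
  move=> a0 ab bx; rewrite ger0_norm ?subr_ge0 ?young_mono//.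
  have /andP[_ /le_trans] := young_bounds a0 ab; apply.
  rewrite ler_wpM2l ?subr_ge0//; apply: (young_nondecreasing Yg) => //.
  exact: le_trans ab.
have : `|G `|x| - G `|y| | <= `|x - y| * M.
  have [xy|/ltW yx'] := leP `|x| `|y|.
    rewrite distrC; apply: (le_trans (main _ _ _ xy yN)) => //.
    by rewrite ler_wpM2r// distrC; exact: lerB_dist.
  apply: (le_trans (main _ _ _ yx' _)) => //; first by rewrite lerDl.
  by rewrite ler_wpM2r//; exact: lerB_dist.
move=> /le_trans; apply.
have M1 : 0 < M + 1 by lra.
move: ye; rewrite ler_pdivlMr// => ye; have := normr_ge0 (x - y).
nra.
Unshelve. all: by end_near. Qed.

End delta2_consequences.
End young_function.

(** * Lebesgue measure and the Euclidean norm on R^n *)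

Section rn_measure.
Context (R : realType) (n : nat).
Local Notation mu := (lebesgue_rV R n).

Lemma measurable_rV_box (A : 'I_n -> set R) : (forall i, measurable (A i)) ->
  measurable [set x : 'rV[R]_n | forall i, A i (x 0 i)].
Proof.
move=> mA.
have -> : [set x : 'rV[R]_n | forall i, A i (x 0 i)] =
    \bigcap_(i in [set: 'I_n]) ((fun x : 'rV[R]_n => x 0 i) @^-1` A i).
  by apply/seteqP; split => [x Ax i _|x Ax i]; [exact: Ax|exact: Ax].
apply: fin_bigcap_measurable => //.
by move=> i _; rewrite -[X in measurable X]setTI; exact: measurable_coord_rV.
Qed.

(** The sigma-algebra is the product one: an open set is the countable union of the
    boxes with rational centre and radius [1 / N] that it contains. *)
Lemma open_measurable_rV (U : set 'rV[R]_n) : open U -> measurable U.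
Proof.
move=> oU.
pose B (q : 'rV[rat]_n * nat) : set 'rV[R]_n :=
  [set x | forall i, `]ratr (q.1 0 i) - q.2.+1%:R^-1, ratr (q.1 0 i) + q.2.+1%:R^-1[%classic (x 0 i)].
have -> : U = \bigcup_(q in [set q | B q `<=` U]) B q.
  apply/seteqP; split; last by move=> x [q qU /qU].
  move=> x Ux; have : nbhs x U by exact: open_nbhs_nbhs.
  rewrite -nbhs_ballE => -[e /= e0 eU].
  have [N Ne] : exists N : nat, N.+1%:R^-1 < e / 2.
    exists (Num.bound ((e / 2)^-1)); have e2 : 0 < e / 2 by lra.
    rewrite invf_plt ?posrE//; apply: lt_trans (_ : (Num.bound (e / 2)^-1)%:R < _).
      by apply: archi_boundP; rewrite invr_ge0 ltW.
    by rewrite ltr_nat.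
  have Np : 0 < N.+1%:R^-1 :> R by rewrite invr_gt0.
  set d : R := N.+1%:R^-1 in Ne Np.
  have Q (i : 'I_n) : exists q : rat, x 0 i - d < ratr q < x 0 i + d.
    have : x 0 i - d < x 0 i + d by rewrite ltrD2l gtrN.
    by move=> /rat_in_itvoo[q]; rewrite in_itv /= => ?; exists q.
  have [q qP] := choice Q.
  have BxB : B (\row_i q i, N) x.
    by move=> i /=; rewrite mxE in_itv /= -/d; have /andP[] := qP i; move=> ? ?; apply/andP; split; lra.
  exists (\row_i q i, N) => //= y yB; apply: eU; split => // j i.
  rewrite (ord1 j) /ball /= ltr_norml.
  have := yB i; rewrite /= mxE in_itv /= -/d => /andP[? ?].
  by have /andP[? ?] := qP i; apply/andP; split; lra.
rewrite bigcup_mkcond; apply: countable_bigcupT_measurable => [|q].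
  exact: countableP.
case: ifP => // _; apply: (@measurable_rV_box
  (fun i => `]ratr (q.1 0 i) - q.2.+1%:R^-1, ratr (q.1 0 i) + q.2.+1%:R^-1[%classic)).
by move=> i; exact: measurable_itv.
Qed.

Lemma measurable_enorm : measurable_fun [set: 'rV[R]_n] (@enorm R n).
Proof.
apply: (measurableT_comp (continuous_measurable_fun (@sqrt_continuous R))).
apply: measurable_sum => i; apply: measurable_funX; exact: measurable_coord_rV.
Qed.

Lemma enorm_ge0 (x : 'rV[R]_n) : 0 <= enorm x.
Proof. exact: sqrtr_ge0. Qed.

Lemma enorm_coord (x : 'rV[R]_n) (i : 'I_n) : `|x 0 i| <= enorm x.
Proof.
rewrite -sqrtr_sqr /enorm ler_wsqrtr// (bigD1 i)//= lerDl.
by apply: sumr_ge0 => j _; exact: sqr_ge0.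
Qed.

Lemma enorm_le_sum (x : 'rV[R]_n) : enorm x <= \sum_(i < n) `|x 0 i|.
Proof.
have S0 : 0 <= \sum_(i < n) `|x 0 i| by exact: sumr_ge0.
rewrite -(ger0_norm S0) -sqrtr_sqr ler_wsqrtr//.
have : forall m (f : nat -> R), (forall i, 0 <= f i) ->
    \sum_(i < m) f i ^+ 2 <= (\sum_(i < m) f i) ^+ 2.
  move=> m f f0; elim: m => [|m IH]; first by rewrite !big_ord0 expr0n.
  rewrite !big_ord_recr /=; apply: le_trans (lerD IH (lexx _)) _.
  have : 0 <= \sum_(i < m) f i by apply: sumr_ge0.
  by have := f0 m; nra.
pose f (i : nat) : R := if insub i is Some j then `|x 0 j| else 0.
have fE (i : 'I_n) : f i = `|x 0 i| by rewrite /f valK.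
move=> /(_ n f); under eq_bigr do rewrite fE real_normK ?num_real//.
under [X in _ <= X ^+ 2]eq_bigr do rewrite fE.
by apply=> i; rewrite /f; case: insub.
Qed.

Lemma enorm_le_nmul (x : 'rV[R]_n) (r : R) : (forall i, `|x 0 i| <= r) ->
  enorm x <= n%:R * r.
Proof.
move=> xr; apply: le_trans (enorm_le_sum x) _.
apply: le_trans (ler_sum _ (fun i _ => xr i)) _.
by rewrite sumr_const card_ord mulr_natl.
Qed.

Lemma enorm_eq0 (x : 'rV[R]_n) : (enorm x == 0) = (x == 0).
Proof.
apply/eqP/eqP => [e0|->]; last first.
  by rewrite /enorm big1 ?sqrtr0// => i _; rewrite mxE expr0n.
apply/rowP => i; rewrite mxE; apply/eqP; rewrite -normr_le0 -e0.
exact: enorm_coord.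
Qed.

Lemma enorm_gt0 (x y : 'rV[R]_n) : x != y -> 0 < enorm (x - y).
Proof. by move=> xy; rewrite lt_def enorm_ge0 enorm_eq0 subr_eq0 xy. Qed.

End rn_measure.

Lemma lebesgue_rV_box (R : realType) (n : nat) (A : 'I_n -> set R) (l : R) :
  (forall i, measurable (A i)) ->
  (forall i, lebesgue_measure (A i) = l%:E) ->
  lebesgue_rV R n [set x : 'rV[R]_n | forall i, A i (x 0 i)] = (l ^+ n)%:E.
Proof.
elim: n A => [|n IH] A mA lA /=.
  rewrite diracE mem_set ?expr0//= => -[]//.
rewrite /cons_measure /pushforward.
pose A' (i : 'I_n) := A (lift ord0 i).
have -> : @cons_rV R n @^-1` [set x : 'rV[R]_n.+1 | forall i, A i (x 0 i)] =
    A ord0 `*` [set x : 'rV[R]_n | forall i, A' i (x 0 i)].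
  apply/seteqP; split => [[a v] /= Av|[a v] /= [Aa Av] i].
    split; first by have := Av ord0; rewrite mxE unlift_none.
    by move=> i; have := Av (lift ord0 i); rewrite mxE liftK.
  rewrite mxE; case: unliftP => [j ->|->] //; exact: Av.
have mA' i : measurable (A' i) by exact: mA.
rewrite product_measure1E; last 2 first.
- exact: mA.
- exact: (@measurable_rV_box R n A').
by rewrite /= (IH A')// ?lA -?EFinM ?exprS// => i; exact: lA.
Qed.

Section rn_product.
Context (R : realType) (n : nat).
Local Notation T := 'rV[R]_n.

Lemma measurable_enormB : measurable_fun [set: T * T] (fun z => enorm (z.1 - z.2)).
Proof.
apply: (measurableT_comp (@measurable_enorm R n)).
apply: measurable_fun_rVP => i.
rewrite (_ : (fun t => _) = (fun z : T * T => z.1 0 i - z.2 0 i)); last first.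
  by apply/funext => z; rewrite !mxE.
apply: measurable_funB.
  exact: (measurableT_comp (measurable_coord_rV i) measurable_fst).
exact: (measurableT_comp (measurable_coord_rV i) measurable_snd).
Qed.

Lemma measurable_inv (f : T * T -> R) : (forall z, 0 <= f z) ->
  measurable_fun [set: T * T] f -> measurable_fun [set: T * T] (fun z => (f z)^-1).
Proof.
move=> f0 mf; rewrite (_ : (fun z => _) = (fun z => (f z) `^ (-1))).
  exact: (measurableT_comp (measurable_powR (-1)) mf).
by apply/funext => z; rewrite powR_inv1.
Qed.

Lemma measurable_kernel :
  measurable_fun [set: T * T] (fun z => (enorm (z.1 - z.2) ^+ n)^-1).
Proof.
apply: measurable_inv; first by move=> z; rewrite exprn_ge0// enorm_ge0.
by apply: measurable_funX; exact: measurable_enormB.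
Qed.

Lemma measurable_Dquot (s : R) (u : T -> R) : measurable_fun setT u ->
  measurable_fun [set: T * T] (fun z => Dquot s u z.1 z.2).
Proof.
move=> mu; apply: measurable_funM.
  apply: measurable_funB; first exact: (measurableT_comp mu measurable_fst).
  exact: (measurableT_comp mu measurable_snd).
apply: measurable_inv; first by move=> z; rewrite powR_ge0.
exact: (measurableT_comp (measurable_powR s) measurable_enormB).
Qed.

End rn_product.

(** * Modulars and their first variation *)

Section modular.
Context (R : realType) (g G : R -> R) (Yg : is_young g G).
Context d (T : measurableType d) (nu : {measure set T -> \bar R}).
Variables (D : set T) (k : T -> R).

(** The energy and the mass of a function are both of this form, with different
    measures, domains and weights; their common theory is developed once. *)
Definition modular (f : T -> R) : \bar R :=
  (\int[nu]_(x in D) (G `|f x| * k x)%:E)%E.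

(** The expected derivative of [modular] at [f] in the direction [h]. It is a
    subgradient in all cases ([modular_subgradient]) and governs the first variation
    when [f] avoids the jumps of [g] ([modular_decrease]). *)
Definition pairing (f h : T -> R) : \bar R :=
  (\int[nu]_(x in D) (sg g (f x) * h x * k x)%:E)%E.

Hypotheses (mD : measurable D) (mk : measurable_fun setT k).
Hypothesis k0 : forall x, 0 <= k x.

Lemma measurable_modular (f : T -> R) : measurable_fun setT f ->
  measurable_fun D (fun x => (G `|f x| * k x)%:E).
Proof.
move=> mf; apply/measurable_EFinP; apply: (@measurable_funS _ _ _ _ setT) => //.
by apply: measurable_funM => //; exact: (measurableT_comp (measurable_youngN Yg) mf).
Qed.

Lemma modular_integrand_ge0 (a : R) x : (0 <= (G `|a| * k x)%:E)%E.
Proof. by rewrite lee_fin mulr_ge0// (youngG_ge0 Yg). Qed.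

Lemma modular_ge0 (f : T -> R) : (0 <= modular f)%E.
Proof. by apply: integral_ge0 => x _; exact: modular_integrand_ge0. Qed.

Lemma modular_mono (f h : T -> R) :
  measurable_fun setT f -> measurable_fun setT h ->
  (forall x, D x -> `|f x| <= `|h x|) -> (modular f <= modular h)%E.
Proof.
move=> mf mh fh; apply: ge0_le_integral => //.
- by move=> x _; exact: modular_integrand_ge0.
- exact: measurable_modular.
- exact: measurable_modular.
- by move=> x Dx; rewrite lee_fin ler_wpM2r//; apply: (young_mono Yg) => //; exact: fh.
Qed.

Lemma modular_scale (t : R) (f : T -> R) : 0 <= t <= 1 ->
  measurable_fun setT f ->
  (modular (fun x => t * f x)%R <= t%:E * modular f)%E.
Proof.
move=> /andP[t0 t1] mf; rewrite -ge0_integralZl//; last 2 first.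
- exact: measurable_modular.
- by move=> x _; exact: modular_integrand_ge0.
apply: ge0_le_integral => //.
- by move=> x _; exact: modular_integrand_ge0.
- by apply: measurable_modular; exact: measurable_funM.
- by apply: measurable_funeM; exact: measurable_modular.
move=> x _; rewrite -EFinM lee_fin mulrA ler_wpM2r// normrM (ger0_norm t0).
by apply: (young_scale Yg) => //; apply/andP.
Qed.

Lemma modular_scale_ge (t : R) (f : T -> R) : 1 <= t ->
  measurable_fun setT f ->
  (t%:E * modular f <= modular (fun x => t * f x)%R)%E.
Proof.
move=> t1 mf; have t0 : 0 <= t by exact: le_trans ler01 t1.
rewrite -ge0_integralZl//; last 2 first.
- exact: measurable_modular.
- by move=> x _; exact: modular_integrand_ge0.
apply: ge0_le_integral => //.
- by move=> x _; rewrite mule_ge0//; exact: modular_integrand_ge0.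
- by apply: measurable_funeM; exact: measurable_modular.
- by apply: measurable_modular; exact: measurable_funM.
move=> x _; rewrite -EFinM lee_fin mulrA ler_wpM2r// normrM (ger0_norm t0).
exact: (young_scale_ge Yg).
Qed.

Section delta2.
Variable K : R.
Hypothesis K1 : (1 : R) <= K.
Hypothesis GK : forall t : R, 0 <= t -> G (2 * t) <= K * G t.
Let K0 : 0 <= K. Proof. exact: le_trans ler01 K1. Qed.

Lemma modular_add (f h : T -> R) :
  measurable_fun setT f -> measurable_fun setT h ->
  (modular (fun x => f x + h x)%R <= K%:E * (modular f + modular h))%E.
Proof.
move=> mf mh; rewrite -ge0_integralD//; last 4 first.
- by move=> x _; exact: modular_integrand_ge0.
- exact: measurable_modular.
- by move=> x _; exact: modular_integrand_ge0.
- exact: measurable_modular.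
rewrite -ge0_integralZl//; last 2 first.
- by apply: emeasurable_funD; exact: measurable_modular.
- by move=> x _; apply: adde_ge0; exact: modular_integrand_ge0.
apply: ge0_le_integral => //.
- by move=> x _; exact: modular_integrand_ge0.
- by apply: measurable_modular; exact: measurable_funD.
- by apply: measurable_funeM; apply: emeasurable_funD; exact: measurable_modular.
move=> x _; rewrite -EFinD -EFinM lee_fin -mulrDl mulrA ler_wpM2r//.
exact: (young_addN Yg).
Qed.

Lemma modular_dilate (e : R) (f : T -> R) : 0 <= e <= 1 ->
  measurable_fun setT f ->
  (modular (fun x => (1 + e) * f x)%R <= (1 + e * K)%:E * modular f)%E.
Proof.
move=> e01 mf; have e0 : 0 <= e by case/andP: e01.
have eK : 0 <= e * K by exact: mulr_ge0.
rewrite -ge0_integralZl//; last 3 first.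
- exact: measurable_modular.
- by move=> x _; exact: modular_integrand_ge0.
- by rewrite lee_fin addr_ge0.
apply: ge0_le_integral => //.
- by move=> x _; exact: modular_integrand_ge0.
- by apply: measurable_modular; exact: measurable_funM.
- by apply: measurable_funeM; exact: measurable_modular.
move=> x _; rewrite -EFinM lee_fin mulrA ler_wpM2r// normrM ger0_norm ?addr_ge0//.
exact: (young_dilate Yg).
Qed.

Lemma modular_pow2 (m : nat) (f : T -> R) : measurable_fun setT f ->
  (modular (fun x => 2 ^+ m * f x)%R <= (K ^+ m)%:E * modular f)%E.
Proof.
move=> mf; rewrite -ge0_integralZl//; last 3 first.
- exact: measurable_modular.
- by move=> x _; exact: modular_integrand_ge0.
- by rewrite lee_fin exprn_ge0.
apply: ge0_le_integral => //.
- by move=> x _; exact: modular_integrand_ge0.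
- by apply: measurable_modular; exact: measurable_funM.
- by apply: measurable_funeM; exact: measurable_modular.
move=> x _; rewrite -EFinM lee_fin mulrA ler_wpM2r// normrM ger0_norm//.
exact: (young_pow2 K1 GK).
Qed.

Lemma modularZ_lty (c : R) (f : T -> R) : measurable_fun setT f ->
  (modular f < +oo)%E -> (modular (fun x => c * f x)%R < +oo)%E.
Proof.
move=> mf Mf.
have [m cm] : exists m : nat, `|c| <= 2 ^+ m.
  exists (Num.bound c); apply: le_trans (ltW (archi_boundP (normr_ge0 c))) _.
  rewrite -(_ : Num.bound c = Num.bound `|c|); last by rewrite /Num.bound normr_id.
  by rewrite -natrX ler_nat ltnW// ltn_expl.
apply: le_lt_trans (_ : ((K ^+ m)%:E * modular f < +oo)%E).
  apply: le_trans (modular_pow2 m mf); apply: modular_mono.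
  - exact: measurable_funM.
  - exact: measurable_funM.
  - by move=> x _; rewrite !normrM ler_wpM2r// (ger0_norm (exprn_ge0 _ _)).
by rewrite lte_mul_pinfty// lee_fin exprn_ge0.
Qed.

Lemma modularD_lty (f h : T -> R) :
  measurable_fun setT f -> measurable_fun setT h ->
  (modular f < +oo)%E -> (modular h < +oo)%E ->
  (modular (fun x => f x + h x)%R < +oo)%E.
Proof.
move=> mf mh Mf Mh; apply: le_lt_trans (modular_add mf mh) _.
by apply: lte_mul_pinfty => //; exact: lte_add_pinfty.
Qed.

Variable p : R.
Hypothesis gGp : forall t : R, 0 < t -> t * g t / G t <= p.
Hypothesis p0 : 0 <= p.

Lemma modular_integrable (f : T -> R) : measurable_fun setT f ->
  (modular f < +oo)%E -> nu.-integrable D (fun x => (G `|f x| * k x)%:E).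
Proof.
move=> mf Mf; apply/integrableP; split; first exact: measurable_modular.
rewrite (eq_integral (fun x => (G `|f x| * k x)%:E))// => x _.
by rewrite gee0_abs//; exact: modular_integrand_ge0.
Qed.

Lemma measurable_pairing (f h : T -> R) :
  measurable_fun setT f -> measurable_fun setT h ->
  measurable_fun D (fun x => (sg g (f x) * h x * k x)%:E).
Proof.
move=> mf mh; apply/measurable_EFinP; apply: (@measurable_funS _ _ _ _ setT) => //.
apply: measurable_funM => //; apply: measurable_funM => //.
exact: (measurableT_comp (measurable_sg Yg) mf).
Qed.

Lemma pairing_integrable (f h : T -> R) :
  measurable_fun setT f -> measurable_fun setT h ->
  (modular f < +oo)%E -> (modular h < +oo)%E ->
  nu.-integrable D (fun x => (sg g (f x) * h x * k x)%:E).
Proof.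
move=> mf mh Mf Mh.
have := integrableD mD (modular_integrable mf Mf) (modular_integrable mh Mh).
move=> /(integrableZl mD (p * K)).
apply: le_integrable => //; first exact: measurable_pairing.
move=> x Dx; rewrite -EFinD -EFinM !abse_EFin lee_fin -mulrDl mulrA.
have S0 : 0 <= p * K * (G `|f x| + G `|h x|).
  by rewrite mulr_ge0 ?mulr_ge0// addr_ge0// (youngG_ge0 Yg).
rewrite [leRHS]ger0_norm; last exact: mulr_ge0.
rewrite [leLHS]normrM (ger0_norm (k0 x)) ler_wpM2r//.
exact: (sg_mul_le Yg).
Qed.

Lemma modular_subgradient (f h : T -> R) :
  measurable_fun setT f -> measurable_fun setT h ->
  (modular f < +oo)%E -> (modular h < +oo)%E ->
  (modular f + pairing f (fun x => h x - f x)%R <= modular h)%E.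
Proof.
move=> mf mh Mf Mh.
have mhf : measurable_fun setT (fun x => h x - f x)%R by exact: measurable_funB.
have Mhf : (modular (fun x => h x - f x)%R < +oo)%E.
  apply: le_lt_trans (_ : modular (fun x => h x + -1 * f x)%R < +oo)%E.
    apply: modular_mono => //; last by move=> x _; rewrite mulN1r.
    by apply: measurable_funD => //; exact: measurable_funM.
  apply: modularD_lty => //; first exact: measurable_funM.
  exact: modularZ_lty.
rewrite -integralD//; last 2 first.
- exact: modular_integrable.
- exact: pairing_integrable.
apply: le_integral => //.
- apply: integrableD => //; first exact: modular_integrable.
  exact: pairing_integrable.
- exact: modular_integrable.
move=> x _; rewrite -EFinD lee_fin -mulrDl ler_wpM2r//.
exact: (sg_subgradient Yg).
Qed.

(** Where [f] avoids the jumps of [g], [sg g (f + e h)] tends to [sg g f] as [e]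
    decreases to 0, so by dominated convergence [pairing (f + e h) h] is negative
    for some [e]; the subgradient inequality based at [f + e h] then compares the
    modulars. *)
Lemma modular_decrease (f h : T -> R) :
  measurable_fun setT f -> measurable_fun setT h ->
  (modular f < +oo)%E -> (modular h < +oo)%E ->
  {ae nu, forall x, D x -> {for f x, continuous (sg g)}} ->
  (pairing f h < 0)%E ->
  exists2 e : R, 0 < e & (modular (fun x => f x + e * h x)%R <= modular f)%E.
Proof.
move=> mf mh Mf Mh sgf L0.
pose e_ (j : nat) : R := j.+1%:R^-1.
have e_gt0 j : 0 < e_ j by rewrite invr_gt0.
have e_le1 j : e_ j <= 1 by rewrite invf_le1// ler1n.
pose f_ j x : R := f x + e_ j * h x.
have mf_ j : measurable_fun setT (f_ j).
  by apply: measurable_funD => //; exact: measurable_funM.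
have mN (u : T -> R) : measurable_fun setT u -> measurable_fun setT (fun x => `|u x|).
  by move=> mu; exact: (measurableT_comp (@normr_measurable R setT) mu).
pose S x : R := `|f x| + `|h x|.
have mS : measurable_fun setT S by apply: measurable_funD; exact: mN.
have Mnorm (u : T -> R) : measurable_fun setT u -> (modular u < +oo)%E ->
    (modular (fun x => `|u x|%R) < +oo)%E.
  move=> mu; apply: le_lt_trans; apply: modular_mono => //; first exact: mN.
  by move=> x _; rewrite normr_id.
have MS : (modular S < +oo)%E.
  by apply: modularD_lty; (try exact: mN); exact: Mnorm.
have dom := pairing_integrable mS (mN _ mh) MS (Mnorm _ mh Mh).
have sgN (a : R) : `|sg g a| = sg g `|a|.
  rewrite /sg normrM (ger0_norm (young_ge0 Yg (normr_ge0 a))) normr_id.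
  by rewrite normf_div normr_id.
pose u_ j := pairing (f_ j) h.
have cvgL : u_ @ \oo --> pairing f h.
  have [] := @dominated_convergence _ _ _ nu D mD
    (fun j x => (sg g (f_ j x) * h x * k x)%:E)
    (fun x => (sg g (f x) * h x * k x)%:E)
    (fun x => (sg g (S x) * `|h x| * k x)%:E) => //.
  - by move=> j; exact: measurable_pairing.
  - exact: measurable_pairing.
  - apply: filterS sgf => x sgx Dx; apply: cvg_EFin; first exact: nearW.
    apply: cvgMl; apply: cvgMl.
    have cf : f_ j x @[j --> \oo] --> f x.
      rewrite -[X in _ --> X]addr0; apply: cvgD; first exact: cvg_cst.
      by rewrite -[X in _ --> X](mul0r (h x)); apply: cvgMl; exact: cvg_harmonic.
    exact: (cvg_comp _ _ cf (sgx Dx)).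
  - apply: nearW => x j Dx; rewrite abse_EFin lee_fin normrM (ger0_norm (k0 x)).
    rewrite ler_wpM2r// normrM ler_wpM2r// sgN; apply: (sg_nondecreasing Yg).
    apply: le_trans (ler_normD _ _) _; rewrite lerD2l normrM.
    by rewrite ler_piMl// (ger0_norm (ltW (e_gt0 j))).
have [j uj] : exists j, (u_ j < 0)%E.
  apply: contrapT => /forallNP nu0; move: L0; apply/negP; rewrite -leNgt.
  by apply: (cvge_ge _ cvgL) => //; apply: nearW => j; rewrite leNgt; apply/negP.
exists (e_ j); first exact: e_gt0.
have Mfj : (modular (f_ j) < +oo)%E.
  apply: modularD_lty => //; first exact: measurable_funM.
  exact: modularZ_lty.
apply: le_trans (modular_subgradient (mf_ j) mf Mfj Mf).
rewrite leeDl//.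
have -> : pairing (f_ j) (fun x => f x - f_ j x) = ((- e_ j)%:E * u_ j)%E.
  rewrite -integralZl//; last exact: pairing_integrable.
  by apply: eq_integral => x _; rewrite -EFinM /f_; congr (_%:E); ring.
by apply: mule_le0; [rewrite lee_fin oppr_le0 ltW// e_gt0|exact: ltW].
Qed.

End delta2.

(** Fatou's lemma for the continuous integrand [G |_|]. It serves as lower
    semicontinuity of the energy and of the mass, and to pass to the limit in Cauchy
    estimates. *)
Lemma modular_fatou (f_ : nat -> T -> R) (f : T -> R) (C : \bar R) :
  (forall j, measurable_fun setT (f_ j)) -> measurable_fun setT f ->
  {ae nu, forall x, D x -> f_ ^~ x @ \oo --> f x} ->
  (\forall j \near \oo, (modular (f_ j) <= C)%E) -> (modular f <= C)%E.
Proof.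
move=> mf_ mf cv MC.
have -> : modular f =
    (\int[nu]_(x in D) limn_einf (fun j => (G `|f_ j x| * k x)%:E))%E.
  apply: ae_eq_integral => //.
  - exact: measurable_modular.
  - rewrite (_ : (fun x => _) = (fun x =>
        - limn_esup (fun j => - (G `|f_ j x| * k x)%:E)))%E//.
    apply: (measurableT_comp (@oppe_measurable R setT)).
    apply: measurable_fun_limn_esup => j.
    by apply: (measurableT_comp (@oppe_measurable R setT)); exact: measurable_modular.
  apply: filterS cv => x cvx Dx.
  have cvG : (G `|f_ j x| * k x)%:E @[j --> \oo] --> (G `|f x| * k x)%:E.
    apply: cvg_EFin; first exact: nearW.
    apply: cvgMl.
    exact: (cvg_comp _ _ (cvx Dx) (@young_continuousN _ _ _ Yg (f x))).
  rewrite is_cvg_limn_einfE; first exact/esym/cvg_lim.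
  by apply/cvg_ex; eexists; exact: cvG.
apply: le_trans (fatou _ mD _ _) _.
- by move=> j; exact: measurable_modular.
- by move=> j x _; exact: modular_integrand_ge0.
case: MC => N _ MC.
rewrite limn_einf_lim; apply: lime_le; first exact: is_cvg_einfs.
apply: nearW => j; apply: le_trans (MC (maxn j N) _); last exact: leq_maxr.
by apply: ereal_inf_lbound; exists (maxn j N) => //=; exact: leq_maxl.
Qed.

End modular.

(** * Quantitative subadditivity and the pairing with [sg g] *)

Section modular_estimates.
Context (R : realType) (g G : R -> R) (Yg : is_young g G).
Context d (T : measurableType d) (nu : {measure set T -> \bar R}).
Variables (D : set T) (k : T -> R).
Hypotheses (mD : measurable D) (mk : measurable_fun setT k).
Hypothesis k0 : forall x, 0 <= k x.
Variable K : R.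
Hypothesis K1 : (1 : R) <= K.
Hypothesis GK : forall t : R, 0 <= t -> G (2 * t) <= K * G t.
Local Notation M f := (modular G nu D k f).
Let K0 : 0 <= K. Proof. exact: le_trans ler01 K1. Qed.

(** Write [a + b] as the convex combination, with weights [1 / (1 + e)] and
    [e / (1 + e)], of [(1 + e) a] and [((1 + e) / e) b]. Keeping the coefficient of
    [G |a|] close to 1 is what prevents a loss of mass in the limit. *)
Lemma young_add_small (e : R) : 0 < e -> e <= 1 ->
  exists2 A : R, 0 < A & forall a b : R,
    G `|a + b| <= (1 + e * K) * G `|a| + A * G `|b|.
Proof.
move=> e0 e1.
have [m em] : exists m : nat, (1 + e) / e <= 2 ^+ m.
  exists (Num.bound ((1 + e) / e)).
  apply: le_trans (ltW (archi_boundP _)) _; first by rewrite divr_ge0// ltW// addr_gt0.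
  by rewrite -natrX ler_nat ltnW// ltn_expl.
exists (K ^+ m) => [|a b]; first by rewrite exprn_gt0// (lt_le_trans ltr01).
pose t := (1 + e)^-1.
have e10 : 0 < 1 + e by rewrite addr_gt0.
have t0 : 0 < t by rewrite invr_gt0.
have t1 : t <= 1 by rewrite invf_le1// lerDl ltW.
have t01 : 0 <= t <= 1 by rewrite ltW.
apply: (@le_trans _ _ (G (t * ((1 + e) * `|a|) + (1 - t) * ((1 + e) / e * `|b|)))).
  apply: (young_mono Yg) => //; rewrite mulrA mulVf ?gt_eqF// mul1r.
  have -> : (1 - t) * ((1 + e) / e * `|b|) = `|b|.
    rewrite /t; field; apply/andP; split; first by rewrite gt_eqF.
    by rewrite gt_eqF.
  exact: ler_normD.
have p1 : 0 <= (1 + e) * `|a| by rewrite mulr_ge0// ltW.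
have p2 : 0 <= (1 + e) / e * `|b| by rewrite mulr_ge0// divr_ge0 ?(ltW e0) ?(ltW e10).
apply: le_trans (young_convex Yg t01 p1 p2) _.
apply: lerD.
  apply: le_trans (_ : G ((1 + e) * `|a|) <= _); last first.
    by apply: (young_dilate Yg) => //; rewrite e1 ltW.
  by rewrite ler_piMl// (youngG_ge0 Yg).
apply: le_trans (_ : G ((1 + e) / e * `|b|) <= _).
  by rewrite ler_piMl ?(youngG_ge0 Yg)// gerBl ltW.
apply: le_trans (young_pow2 K1 GK m (normr_ge0 b)).
by apply: (young_mono Yg) => //; rewrite ler_wpM2r.
Qed.

Lemma modular_add_small (e : R) : 0 < e -> e <= 1 ->
  exists2 A : R, 0 < A & forall f h : T -> R,
    measurable_fun setT f -> measurable_fun setT h ->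
    (M (fun x => f x + h x)%R <= (1 + e * K)%:E * M f + A%:E * M h)%E.
Proof.
move=> e0 e1; have [A A0 HA] := young_add_small e0 e1; exists A => // f h mf mh.
have p1 : (0 <= (1 + e * K)%:E)%E by rewrite lee_fin addr_ge0// mulr_ge0// ltW.
have p2 : (0 <= A%:E)%E by rewrite lee_fin ltW.
have mM (u : T -> R) : measurable_fun setT u ->
    measurable_fun D (fun x => (G `|u x| * k x)%:E).
  by move=> mu; exact: (measurable_modular Yg).
have M0 (a : R) x : (0 <= (G `|a| * k x)%:E)%E by exact: (modular_integrand_ge0 Yg).
rewrite -ge0_integralZl//; last exact: mM.
rewrite -ge0_integralZl//; last exact: mM.
rewrite -ge0_integralD//; last 4 first.
- by move=> x _; exact: mule_ge0.
- by apply: measurable_funeM; exact: mM.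
- by move=> x _; exact: mule_ge0.
- by apply: measurable_funeM; exact: mM.
apply: ge0_le_integral => //.
- by apply: mM; exact: measurable_funD.
- by apply: emeasurable_funD; apply: measurable_funeM; exact: mM.
move=> x _; rewrite -!EFinM -EFinD lee_fin !mulrA -mulrDl ler_wpM2r//; exact: HA.
Qed.

Variable p : R.
Hypothesis gGp : forall t : R, 0 < t -> t * g t / G t <= p.
Hypothesis p0 : 0 <= p.

Lemma sg_mulE (a : R) : sg g a * a = `|a| * g `|a|.
Proof.
have [->|a0] := eqVneq a 0; first by rewrite mulr0 normr0 mul0r.
rewrite /sg -mulrA mulrC; congr (_ * _).
by rewrite mulrAC -expr2 -real_normK ?num_real// expr2 mulfK ?normr_eq0.
Qed.

(** Pointwise, [sg g a * a = |a| g |a|] lies between [G |a|] and [p (G |a|)]. *)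
Lemma pairing_bounds (f : T -> R) : measurable_fun setT f -> (M f < +oo)%E ->
  (M f <= pairing g nu D k f f <= p%:E * M f)%E.
Proof.
move=> mf Mf.
have ip := pairing_integrable Yg mD mk k0 K1 GK gGp p0 mf mf Mf Mf.
have im := modular_integrable Yg mk k0 mf Mf.
apply/andP; split.
  apply: le_integral => // x _; rewrite lee_fin ler_wpM2r// sg_mulE.
  exact: (young_tg_ge Yg).
rewrite -integralZl//; apply: le_integral => //; first exact: integrableZl.
move=> x _; rewrite -EFinM lee_fin mulrA ler_wpM2r// sg_mulE.
exact: (young_tg_le Yg).
Qed.

Lemma pairing_fin_num (f h : T -> R) :
  measurable_fun setT f -> measurable_fun setT h ->
  (M f < +oo)%E -> (M h < +oo)%E -> pairing g nu D k f h \is a fin_num.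
Proof.
move=> mf mh Mf Mh; apply: integrable_fin_num => //.
exact: (pairing_integrable Yg mD mk k0 K1 GK gGp p0).
Qed.

Lemma pairing_linear (f h1 h2 : T -> R) (c : R) :
  measurable_fun setT f -> measurable_fun setT h1 -> measurable_fun setT h2 ->
  (M f < +oo)%E -> (M h1 < +oo)%E -> (M h2 < +oo)%E ->
  (pairing g nu D k f (fun x => h1 x + c * h2 x)%R =
   pairing g nu D k f h1 + c%:E * pairing g nu D k f h2)%E.
Proof.
move=> mf m1 m2 Mf M1 M2.
have i1 := pairing_integrable Yg mD mk k0 K1 GK gGp p0 mf m1 Mf M1.
have i2 := pairing_integrable Yg mD mk k0 K1 GK gGp p0 mf m2 Mf M2.
rewrite -integralZl// -integralD//; last exact: integrableZl.
by apply: eq_integral => x _; rewrite -EFinM -EFinD; congr (_%:E); ring.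
Qed.

End modular_estimates.

(** * Level sets of the difference quotient are null *)

Section mixed_increments.
Context (R : realType) (s c : R).
Hypothesis s01 : (0 : R) < s < 1.
Hypothesis c0 : (0 : R) <= c.

Let k (r : R) : R := (c + r ^+ 2) `^ (s / 2).
Let k' (r : R) : R := s / 2 * (c + r ^+ 2) `^ (s / 2 - 1) * (2 * r).
Let k'' (r : R) : R := s * (c + r ^+ 2) `^ (s / 2 - 2) * (c - (1 - s) * r ^+ 2).

Let dw (r : R) : is_derive r 1 (fun r => c + r ^+ 2) (2 * r).
Proof.
apply: is_derive_eq.
have rA : r%:A = r by exact: mulr1.
by rewrite rA add0r [LHS]mul1r mulr_natl.
Qed.

Let dk (r : R) : 0 < c + r ^+ 2 -> is_derive r 1 k (k' r).
Proof.
move=> w0.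
have := @is_derive1_comp _ (fun x => x `^ (s / 2)) (fun r => c + r ^+ 2) r _ _
  (is_derive1_powR (s / 2) w0) (dw r).
by [].
Qed.

Let dk' (r : R) : 0 < c + r ^+ 2 -> is_derive r 1 k' (k'' r).
Proof.
move=> w0.
have d1 := @is_derive1_comp _ (fun x => x `^ (s / 2 - 1)) (fun r => c + r ^+ 2) r _ _
  (is_derive1_powR (s / 2 - 1) w0) (dw r).
have d2 : is_derive r 1 (fun r : R => s / 2 * (2 * r)) s.
  by apply: is_derive_eq; rewrite /GRing.scale /=; field.
have := is_deriveM d1 d2.
have -> : ((fun x => x `^ (s / 2 - 1)) \o (fun r => c + r ^+ 2)) *
   (fun r : R => s / 2 * (2 * r)) = k'.
  by apply/funext => x; rewrite /k' /=; rewrite -mulrA mulrCA.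
move=> H; apply: is_derive_eq.
rewrite /k'' /GRing.scale /=.
have -> : (c + r ^+ 2) `^ (s / 2 - 1) = (c + r ^+ 2) * (c + r ^+ 2) `^ (s / 2 - 2).
  rewrite -{2}(powRr1 (ltW w0)) -powRD; first by congr (_ `^ _); ring.
  by rewrite (gt_eqF w0) implybT.
have -> : s / 2 - 1 - 1 = s / 2 - 2 by ring.
by field.
Qed.

(** [k r] is [|x - y|^s] for [x], [y] that differ by [r] in one coordinate and by a
    vector of squared norm [c] in the others. Two equal increments of [k] give, by
    Rolle's theorem, two equal values of [k'], and then a zero of [k'']; but [k'']
    vanishes only where [c = (1 - s) r^2]. *)
Lemma mixed_increment_neq (r1 r2 d : R) : r1 < r2 -> 0 < d ->
  (forall r, r1 <= r <= r2 + d -> 0 < c + r ^+ 2) ->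
  (forall r, r1 < r < r2 + d -> c != (1 - s) * r ^+ 2) ->
  k (r1 + d) - k r1 != k (r2 + d) - k r2.
Proof.
move=> r12 d0 w0 ne; apply/eqP => keq.
pose phi r := k (r + d) - k r.
have dphi r : r1 <= r <= r2 -> is_derive r 1 phi (k' (r + d) - k' r).
  move=> /andP[r1r rr2].
  have i1 : is_derive r 1 (fun r : R => r + d) 1.
    by apply: is_derive_eq; rewrite addr0.
  have w1 : 0 < c + (r + d) ^+ 2 by apply: w0; apply/andP; split; lra.
  have w2 : 0 < c + r ^+ 2 by apply: w0; apply/andP; split; lra.
  have := @is_derive1_comp _ k (fun r => r + d) r _ _ (dk w1) i1.
  by rewrite mulr1 => dkd; exact: (is_deriveB dkd (dk w2)).
have ctn (f : R -> R) (f' : R -> R) (a b : R) :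
    (forall r, a <= r <= b -> is_derive r 1 f (f' r)) -> {within `[a, b], continuous f}.
  move=> df; apply: derivable_within_continuous => r; rewrite in_itv /= => rab.
  by have [] := df r rab.
have [x xr dx] := Rolle r12
  (fun r rI => let: DeriveDef h _ := dphi r ltac:(by move: rI; rewrite in_itv /= => /andP[/ltW -> /ltW ->]) in h)
  (ctn phi _ _ _ dphi) keq.
move: xr; rewrite in_itv /= => /andP[r1x xr2].
have k'eq : k' x = k' (x + d).
  have [|_ e1] := dphi x _; first by rewrite !ltW.
  case: dx => _; rewrite e1 => e2; lra.
have xd : x < x + d by lra.
have dk'x r : x <= r <= x + d -> is_derive r 1 k' (k'' r).
  by move=> /andP[? ?]; apply: dk'; apply: w0; apply/andP; split; lra.
have [z zr dz] := Rolle xd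
  (fun r rI => let: DeriveDef h _ := dk'x r ltac:(by move: rI; rewrite in_itv /= => /andP[/ltW -> /ltW ->]) in h)
  (ctn k' _ _ _ dk'x) k'eq.
move: zr; rewrite in_itv /= => /andP[xz zxd].
have [|_ e1] := dk'x z _; first by rewrite !ltW.
have zi : r1 < z < r2 + d by apply/andP; split; lra.
case: dz => _; rewrite e1 /k'' => /eqP.
have w : 0 < c + z ^+ 2 by apply: w0; apply/andP; split; lra.
rewrite !mulf_eq0 subr_eq0 (negbTE (ne _ zi)) orbF (gt_eqF (powR_gt0 _ w)).
by rewrite orbF => /eqP s_eq0; case/andP: s01; rewrite s_eq0 ltxx.
Qed.

End mixed_increments.

Section almost_disjoint_slices.
Context d1 d2 (X : measurableType d1) (Y : measurableType d2) (R : realType).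
Variables (m1 : {sigma_finite_measure set X -> \bar R})
          (m2 : {sigma_finite_measure set Y -> \bar R}).
Local Open Scope ereal_scope.

(** With [f y = m1 (slice of E at y)], Tonelli's theorem gives
    [\int f^2 = \iint m2 (E_x :&: E_x')], which is 0 because the diagonal has null
    sections. Hence [f] vanishes almost everywhere, and [\int m2 (E_x) = \int f]. *)
Lemma almost_disjoint_slices (E : set (X * Y)) : measurable E ->
  (forall x : X, measurable [set x]) -> (forall x : X, m1 [set x] = 0) ->
  (forall x x' : X, x <> x' -> m2 (xsection E x `&` xsection E x') = 0) ->
  \int[m1]_x m2 (xsection E x) = 0.
Proof.
move=> mE mpt pt0 dE.
pose F (z : X * Y) : \bar R := (\1_E z)%:E.
have mF : measurable_fun setT F by exact/measurable_EFinP/measurable_indic.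
have F0 z : 0 <= F z by rewrite lee_fin.
have mFx x : measurable_fun setT (fun y => F (x, y)) by exact: measurableT_comp.
have mFy y : measurable_fun setT (fun x => F (x, y)) by exact: measurableT_comp.
pose f (y : Y) : \bar R := \int[m1]_x F (x, y).
have f0 y : 0 <= f y by exact: integral_ge0.
have mf : measurable_fun setT f by exact: measurable_fun_fubini_tonelli_G.
have Exf x : \int[m2]_y (F (x, y) * f y) = 0.
  transitivity (\int[m2]_y \int[m1]_x' (F (x, y) * F (x', y))).
    by apply: eq_integral => y _; rewrite ge0_integralZl.
  pose H (z : X * Y) : \bar R := F (x, z.2) * F z.
  have mH : measurable_fun setT H.
    by apply: emeasurable_funM => //; exact: (measurableT_comp (mFx x) measurable_snd).
  have H0 z : 0 <= H z by exact: mule_ge0.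
  rewrite -[LHS](@fubini_tonelli _ _ _ _ _ m1 m2 H mH H0).
  have : ae_eq m1 setT (fun x' => \int[m2]_y H (x', y)) (cst 0).
    exists [set x]; split; [exact: mpt|exact: pt0|move=> x' /= /not_implyP[_]].
    apply: contra_notP => xx'.
    rewrite [LHS](_ : _ = \int[m2]_y (\1_(xsection E x `&` xsection E x') y)%:E).
      rewrite integral_indic//; last by apply: measurableI; exact: measurable_xsection.
      by rewrite setIT; apply: dE => xx; apply: xx'; rewrite xx.
    apply: eq_integral => y _; rewrite /H /F /= -EFinM !indicE in_setI.
    by rewrite !mem_xsection -natrM mulnb.
  move=> /ae_eq_integral ->//; first exact: integral0.
  exact: measurable_fun_fubini_tonelli_F.
have ff0 : \int[m2]_y `|f y * f y| = 0.
  transitivity (\int[m2]_y \int[m1]_x (f y * F (x, y))).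
    apply: eq_integral => y _; rewrite gee0_abs ?mule_ge0//.
    by rewrite ge0_integralZl.
  pose H (z : X * Y) : \bar R := f z.2 * F z.
  have mH : measurable_fun setT H.
    by apply: emeasurable_funM => //; exact: (measurableT_comp mf measurable_snd).
  have H0 z : 0 <= H z by exact: mule_ge0.
  rewrite -[LHS](@fubini_tonelli _ _ _ _ _ m1 m2 H mH H0).
  apply: integral0_eq => x _ /=; rewrite -[RHS](Exf x).
  by apply: eq_integral => y _; rewrite muleC.
have fae : ae_eq m2 setT f (cst 0).
  have mff : measurable_fun setT (fun y => f y * f y) by exact: emeasurable_funM.
  have := (ae_eq_integral_abs m2 measurableT mff).1 ff0.
  apply: filterS => y /(_ Logic.I) /eqP; rewrite mule_eq0 orbb => /eqP fy _.
  exact: fy.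
rewrite (_ : (fun x => _) = fun x => \int[m2]_y F (x, y)); last first.
  apply/funext => x; rewrite -[X in m2 X]setIT -integral_indic//; last exact: measurable_xsection.
  by apply: eq_integral => y _; rewrite /F !indicE mem_xsection.
rewrite (fubini_tonelli F)// -/f.
by rewrite (ae_eq_integral (cst 0))// integral0.
Qed.

End almost_disjoint_slices.

Section quotient_level_sets.
Context (R : realType) (m : nat).
Local Notation n := m.+1.
Local Notation T := 'rV[R]_n.
Local Notation mu := (lebesgue_rV R n).

Lemma thin_null (S : set T) : measurable S ->
  (forall (y : 'rV[R]_m) (b b' : R),
    S (cons_rV (b, y)) -> S (cons_rV (b', y)) -> b = b') ->
  mu S = 0.
Proof.
move=> mS thin.
rewrite /= /cons_measure /pushforward.
have mS' : measurable (@cons_rV R m @^-1` S).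
  by rewrite -[X in measurable X]setTI; exact: measurable_cons_rV.
rewrite -[X in (_ \x _)%E X]setIT -integral_indic//.
rewrite fubini_tonelli2//; last first.
  by apply/measurable_EFinP; exact: measurable_indic.
apply: integral0_eq => y _; rewrite /fubini_G.
apply/eqP; rewrite eq_le integral_ge0 ?andbT; last by move=> *; rewrite lee_fin.
have [[b Sb]|nS] := pselect (exists b, S (cons_rV (b, y))); last first.
  rewrite integral0_eq// => b _; rewrite indicE memNset// => Sb.
  by apply: nS; exists b.
rewrite -(integral_set1 (fun=> 1%E) b) [leRHS]integral_mkcond.
rewrite le_eqVlt; apply/predU1P; left; apply: eq_integral => x _.
rewrite patchE /= indicE; case: (pselect (S (cons_rV (x, y)))) => [Sx|nSx].
  by rewrite (thin _ _ _ Sx Sb) !mem_set.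
by rewrite memNset// memNset// => xb; apply: nSx; rewrite xb.
Qed.

Lemma integral_cons_rV (f : T -> \bar R) : measurable_fun setT f ->
  (forall x, 0 <= f x)%E ->
  (\int[mu]_x f x = \int[lebesgue_measure \x lebesgue_rV R m]_p f (cons_rV p))%E.
Proof.
move=> mf f0.
have E := ge0_integral_pushforward _ (lebesgue_measure \x lebesgue_rV R m)%E
  measurableT mf (fun x _ => f0 x).
have := E (@cons_rV R m) (@measurable_cons_rV R m).
by rewrite preimage_setT => <-.
Qed.

(** Only slices that differ in the first coordinate of [x] are compared, so that the
    distances involved depend on a single variable. *)
Lemma almost_disjoint_rV (F : set (T * T)) : measurable F ->
  (forall (x : 'rV[R]_m) (a a' : R), a <> a' ->
    mu (xsection F (cons_rV (a, x)) `&` xsection F (cons_rV (a', x))) = 0) ->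
  (mu \x mu)%E F = 0.
Proof.
move=> mF dF.
have mG : measurable_fun setT (fun x => mu (xsection F x)).
  exact: measurable_fun_xsection.
rewrite /product_measure1 /=.
transitivity (\int[mu]_x mu (xsection F x))%E => //.
rewrite integral_cons_rV//.
rewrite fubini_tonelli2//; last first.
  exact: (measurableT_comp mG (@measurable_cons_rV R m)).
apply: integral0_eq => x _.
pose E' := (fun p : R * T => (cons_rV (p.1, x), p.2)) @^-1` F.
have mc : measurable_fun setT (fun p : R * T => (cons_rV (p.1, x), p.2)).
  apply: measurable_fun_pair => //.
  apply: (measurableT_comp (@measurable_cons_rV R m)).
  apply: measurable_fun_pair => //.
have mE : measurable E' by rewrite -[X in measurable X]setTI; exact: mc.
have := @almost_disjoint_slices _ _ _ _ _ (@lebesgue_measure R) mu E' mE.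
have sE a : xsection E' a = xsection F (cons_rV (a, x)).
  by apply/seteqP; split => y; rewrite /xsection /= !inE.
apply => //.
- by move=> a; exact: lebesgue_measure_set1.
- by move=> a a' aa'; rewrite !sE; exact: dF.
Qed.

Variable s : R.
Hypothesis s01 : (0 : R) < s < 1.

Let rr (z : T * T) : R := z.1 0 ord0 - z.2 0 ord0.
Let cc (z : T * T) : R := \sum_(i < m) (z.1 0 (lift ord0 i) - z.2 0 (lift ord0 i)) ^+ 2.

Let cc_ge0 z : 0 <= cc z.
Proof. by apply: sumr_ge0 => i _; exact: sqr_ge0. Qed.

Let enormE z : enorm (z.1 - z.2) `^ s = (cc z + rr z ^+ 2) `^ (s / 2).
Proof.
have S0 : 0 <= cc z + rr z ^+ 2 by rewrite addr_ge0// sqr_ge0.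
rewrite /enorm big_ord_recl !mxE.
under eq_bigr do rewrite !mxE.
rewrite [X in Num.sqrt X]addrC -[X in Num.sqrt X `^ s]/(cc z + rr z ^+ 2).
by rewrite -(powR12_sqrt S0) -powRrM mulrC.
Qed.

Let mcoord (i : 'I_n) : measurable_fun [set: T * T] (fun z => z.1 0 i - z.2 0 i).
Proof.
apply: measurable_funB.
  exact: (measurableT_comp (measurable_coord_rV i) measurable_fst).
exact: (measurableT_comp (measurable_coord_rV i) measurable_snd).
Qed.

Let mrr : measurable_fun [set: T * T] rr. Proof. exact: mcoord. Qed.
Let mcc : measurable_fun [set: T * T] cc.
Proof. by apply: measurable_sum => i; apply: measurable_funX; exact: mcoord. Qed.

(** [P] confines the pairs to a region where the profile of [mixed_increment_neq] has
    no inflection. If the slices at [a] and [a'] of a level set both contain the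
    points with first coordinates [b] and [b'] on one line, the four equations
    [u x - u y = t |x - y|^s] combine into two equal increments of the profile. So
    two slices meet each line in at most one point, and [almost_disjoint_rV] applies. *)
Let region_null (u : T -> R) (t : R) (P : set (R * R)) :
  measurable_fun setT u -> t != 0 ->
  measurable [set z : T * T | P (cc z, rr z)] ->
  (forall c r1 r2 : R, 0 <= c -> r1 < r2 -> 0 < c + r1 ^+ 2 -> P (c, r1) -> P (c, r2) ->
     (forall r, r1 <= r <= r2 -> 0 < c + r ^+ 2) /\
     (forall r, r1 < r < r2 -> c != (1 - s) * r ^+ 2)) ->
  (mu \x mu)%E ([set z | Dquot s u z.1 z.2 = t] `&` [set z | P (cc z, rr z)]) = 0.
Proof.
move=> mu_ t0 mP HP; set F := _ `&` _.
have mF : measurable F.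
  apply: measurableI => //; rewrite -[X in measurable X]setTI.
  exact: (measurable_Dquot s mu_ measurableT (measurable_set1 t)).
have FE x y : F (x, y) -> [/\ u x - u y = t * (cc (x, y) + rr (x, y) ^+ 2) `^ (s / 2),
    0 < cc (x, y) + rr (x, y) ^+ 2 & P (cc (x, y), rr (x, y))].
  move=> [/= Dt Pz].
  have ne : enorm (x - y) `^ s != 0.
    by apply/eqP => e0; move: Dt t0; rewrite /Dquot e0 invr0 mulr0 => <-; rewrite eqxx.
  have uE : u x - u y = t * enorm (x - y) `^ s by rewrite -Dt /Dquot divfK.
  rewrite -(enormE (x, y)); split => //.
  rewrite lt_def addr_ge0 ?sqr_ge0// andbT; apply: contra_neq ne => e0.
  by rewrite (enormE (x, y)) e0 powR0// mulf_neq0//; case/andP: s01 => /gt_eqF ->.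
apply: almost_disjoint_rV => // x a a' aa'.
wlog {aa'} aa' : a a' / a < a'.
  move=> wl; have [|h|//] := ltgtP a a'; first exact: wl.
  by rewrite setIC; exact: wl.
apply: thin_null.
  by apply: measurableI; exact: measurable_xsection.
move=> y b b'; rewrite /xsection /= !inE => -[Fab Fa'b] [Fab' Fa'b'].
apply: contrapT => bb'.
wlog {bb'} bb' : b b' Fab Fa'b Fab' Fa'b' / b' < b.
  move=> wl; have [h|h|//] := ltgtP b b'; first exact: (wl b' b).
  exact: (wl b b').
pose c := \sum_(i < m) (x 0 i - y 0 i) ^+ 2.
have ccE e f : cc (cons_rV (e, x), cons_rV (f, y)) = c.
  by apply: eq_bigr => i _ /=; rewrite !mxE !liftK.
have rrE e f : rr (cons_rV (e, x), cons_rV (f, y)) = e - f.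
  by rewrite /rr /= !mxE unlift_none.
have := FE _ _ Fab; rewrite ccE rrE => -[u1 w1 P1].
have := FE _ _ Fa'b; rewrite ccE rrE => -[u2 w2 P2].
have := FE _ _ Fab'; rewrite ccE rrE => -[u3 w3 P3].
have := FE _ _ Fa'b'; rewrite ccE rrE => -[u4 w4 P4].
have c0 : 0 <= c by apply: sumr_ge0 => i _; exact: sqr_ge0.
have lt1 : a - b < a' - b' by lra.
have [h1 h2] := HP c (a - b) (a' - b') c0 lt1 w1 P1 P4.
have lt2 : a - b < a - b' by lra.
have d0 : 0 < a' - a by lra.
have e1 : a - b + (a' - a) = a' - b by ring.
have e2 : a - b' + (a' - a) = a' - b' by ring.
have := @mixed_increment_neq _ s c s01 (a - b) (a - b') (a' - a) lt2 d0.
rewrite e1 e2 => /(_ h1 h2) /eqP; apply.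
apply: (mulfI t0); rewrite !mulrBr -u1 -u2 -u3 -u4; ring.
Qed.

(** The inflection curve [c = (1 - s) r^2] and the sign of [r] cut the space of pairs
    into three regions to which [region_null] applies. *)
Lemma Dquot_level_null (u : T -> R) (t : R) : measurable_fun setT u -> t != 0 ->
  (mu \x mu)%E [set z | Dquot s u z.1 z.2 = t] = 0.
Proof.
move=> mu_ t0; have [s0 s1] : 0 < s /\ s < 1 by case/andP: s01.
pose P1 : set (R * R) := [set p | 0 <= p.1 - (1 - s) * p.2 ^+ 2].
pose P2 : set (R * R) := [set p | 0 <= (1 - s) * p.2 ^+ 2 - p.1] `&` [set p | 0 < p.2].
pose P3 : set (R * R) := [set p | 0 <= (1 - s) * p.2 ^+ 2 - p.1] `&` [set p | 0 < - p.2].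
have mge (f : T * T -> R) : measurable_fun setT f -> measurable [set z | 0 <= f z].
  move=> mf; rewrite (_ : [set z | _] = setT `&` f @^-1` `[0, +oo[%classic).
    by apply: mf => //; exact: measurable_itv.
  by rewrite setTI; apply/seteqP; split => z /=; rewrite in_itv /= andbT.
have mgt (f : T * T -> R) : measurable_fun setT f -> measurable [set z | 0 < f z].
  move=> mf; rewrite (_ : [set z | _] = setT `&` f @^-1` `]0, +oo[%classic).
    by apply: mf => //; exact: measurable_itv.
  by rewrite setTI; apply/seteqP; split => z /=; rewrite in_itv /= andbT.
have m1 : measurable [set z | P1 (cc z, rr z)].
  apply: mge; apply: measurable_funB => //; apply: measurable_funM => //.
  exact: measurable_funX.
have m2 : measurable [set z | P2 (cc z, rr z)].
  apply: measurableI; last exact: mgt.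
  apply: mge; apply: measurable_funB => //; apply: measurable_funM => //.
  exact: measurable_funX.
have m3 : measurable [set z | P3 (cc z, rr z)].
  apply: measurableI; last by apply: mgt; exact: measurableT_comp.
  apply: mge; apply: measurable_funB => //; apply: measurable_funM => //.
  exact: measurable_funX.
set L := [set z | _].
have mL : measurable L.
  rewrite -[X in measurable X]setTI.
  exact: (measurable_Dquot s mu_ measurableT (measurable_set1 t)).
have z1 : (mu \x mu)%E (L `&` [set z | P1 (cc z, rr z)]) = 0.
  apply: region_null => // c r1 r2 c0 r12 w1; rewrite /P1 /= => p1 p2.
  have cp : 0 < c by nra.
  split => r rI; first by have := sqr_ge0 r; lra.
  rewrite gt_eqF//; case/andP: rI => ? ?.
  have [rp|rn] := leP 0 r.
    have : r ^+ 2 < r2 ^+ 2 by nra.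
    by nra.
  have : r ^+ 2 < r1 ^+ 2 by nra.
  by nra.
have z2 : (mu \x mu)%E (L `&` [set z | P2 (cc z, rr z)]) = 0.
  apply: region_null => // c r1 r2 c0 r12 w1; rewrite /P2 /= => -[p1 q1] [p2 q2].
  split => r /andP[? ?]; first by nra.
  rewrite lt_eqF//; have : r1 ^+ 2 < r ^+ 2 by nra.
  by nra.
have z3 : (mu \x mu)%E (L `&` [set z | P3 (cc z, rr z)]) = 0.
  apply: region_null => // c r1 r2 c0 r12 w1; rewrite /P3 /= => -[p1 q1] [p2 q2].
  split => r /andP[? ?]; first by nra.
  rewrite lt_eqF//; have : r2 ^+ 2 < r ^+ 2 by nra.
  by nra.
apply: measure_negligible => //.
have neg A : measurable A -> (mu \x mu)%E A = 0 -> (mu \x mu)%E.-negligible A.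
  by move=> mA A0; exists A; split.
apply: (@negligibleS _ _ _ _ (L `&` [set z | P1 (cc z, rr z)] `|`
    (L `&` [set z | P2 (cc z, rr z)] `|` L `&` [set z | P3 (cc z, rr z)]))); last first.
  by apply: negligibleU; [|apply: negligibleU]; apply: neg => //; exact: measurableI.
move=> z Lz; have [h|h] := leP 0 (cc z - (1 - s) * rr z ^+ 2); first by left.
right; have h' : 0 <= (1 - s) * rr z ^+ 2 - cc z by lra.
have [q|q|q] := ltgtP (rr z) 0.
- by right; split => //; split => //=; rewrite oppr_gt0.
- by left; split.
- by have := cc_ge0 z; move: h; rewrite q expr0n mulr0; lra.
Qed.

End quotient_level_sets.

(** * The quotient almost never meets a jump of [g] *)

Section jumps.
Context (R : realType).

(** A monotone function has one-sided limits, so it fails to be continuous only where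
    they differ, which is the notion whose countability is known. *)
Lemma nondecreasing_discontinuity (f : R -> R) (t : R) : nondecreasing_fun f ->
  ~ {for t, continuous f} -> discontinuity f t.
Proof.
move=> ndf nct.
have cl : cvg (f x @[x --> t^'-]).
  apply: nondecreasing_at_left_is_cvgr; first by apply: nearW => x y z _ _; exact: ndf.
  apply: nearW => x; exists (f t) => _ [y + <-]; rewrite /= in_itv /= => /andP[_ /ltW].
  exact: ndf.
have cr : cvg (f x @[x --> t^'+]).
  apply: nondecreasing_at_right_is_cvgr; first by apply: nearW => x y z _ _; exact: ndf.
  apply: nearW => x; exists (f t) => _ [y + <-]; rewrite /= in_itv /= => /andP[/ltW + _].
  exact: ndf.
split => //; apply/eqP => lr; apply: nct.
have h1 : lim (f x @[x --> t^'-]) <= f t.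
  by apply: limr_le => //; near=> x; apply: ndf; apply: ltW; near: x; exact: nbhs_left_lt.
have h2 : f t <= lim (f x @[x --> t^'+]).
  by apply: limr_ge => //; near=> x; apply: ndf; apply: ltW; near: x; exact: nbhs_right_gt.
have e : lim (f x @[x --> t^'+]) = f t.
  by apply/eqP; rewrite eq_le h2 andbT -lr.
apply/left_right_continuousP; split; first by rewrite -e -lr.
by rewrite -e.
Unshelve. all: by end_near. Qed.

Lemma countable_jumps (f : R -> R) : nondecreasing_fun f ->
  countable [set t | ~ {for t, continuous f}].
Proof.
move=> ndf.
pose D N := [set t | t \in (`]-(N%:R : R), N%:R[) /\ discontinuity f t].
have cD : countable (\bigcup_N D N).
  by apply: bigcup_countable => // N _; apply: discontinuity_countable => x y _ _; exact: ndf.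
apply: sub_countable cD; apply: subset_card_le => t /(nondecreasing_discontinuity ndf) dt.
exists (Num.bound t) => //; split => //; rewrite in_itv /= -ltr_norml.
have -> : Num.bound t = Num.bound `|t| by rewrite /Num.bound normr_id.
exact: archi_boundP.
Qed.

(** The quotient may vanish on a set of positive measure, so 0 must not be a jump:
    this is right continuity of [g] at 0, with [g 0 = 0]. *)
Lemma sg_continuous0 (g G : R -> R) : is_young g G -> {for 0, continuous (sg g)}.
Proof.
move=> Yg; apply/cvgrPdist_le => e e0 /=.
have := young_right_continuous Yg (lexx 0).
move=> /cvgrPdist_le /(_ e e0); rewrite (young_g0 Yg) => -[d /= d0 Hd].
near=> y; rewrite {1}/sg normr0 mul0r mulr0 sub0r normrN.
have [->|y0] := eqVneq y 0; first by rewrite /sg mul0r mulr0 normr0 ltW.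
rewrite /sg normrM normf_div normr_id divff ?normr_eq0// mulr1.
rewrite -[leLHS]normrN -sub0r; apply: Hd; last by rewrite normr_gt0.
rewrite /ball_ /= sub0r normrN normr_id; near: y; exists d => //= z.
by rewrite /ball_ /= sub0r normrN.
Unshelve. all: by end_near. Qed.

(** [sg g] has countably many jumps, all different from 0, and the quotient takes each
    of these values on a null set only. *)
Lemma ae_sg_continuous_Dquot (g G : R -> R) (n : nat) (s : R) (u : 'rV[R]_n -> R) :
  is_young g G -> (0 < n)%N -> (0 : R) < s < 1 -> measurable_fun setT u ->
  {ae (lebesgue_rV R n \x lebesgue_rV R n)%E, forall z,
    {for Dquot s u z.1 z.2, continuous (sg g)}}.
Proof.
case: n u => // m u Yg _ s01 mu_.
have /countable_injP[f injf] := countable_jumps (sg_nondecreasing Yg).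
set J := [set t | _] in injf.
pose B k : set ('rV[R]_m.+1 * 'rV[R]_m.+1) :=
  [set z | J (Dquot s u z.1 z.2) /\ f (Dquot s u z.1 z.2) = k].
apply: (@negligibleS _ _ _ _ (\bigcup_k B k)).
  by move=> z /= Jz; exists (f (Dquot s u z.1 z.2)).
apply: negligible_bigcup => k.
have [[t [Jt tk]]|nt] := pselect (exists t, J t /\ f t = k); last first.
  apply: (@negligibleS _ _ _ _ set0); last exact: negligible_set0.
  by move=> z [Jz fz]; apply: nt; exists (Dquot s u z.1 z.2).
have t0 : t != 0 by apply/eqP => t0; apply: Jt; rewrite t0; exact: sg_continuous0 Yg.
exists [set z | Dquot s u z.1 z.2 = t]; split.
- rewrite -[X in measurable X]setTI.
  exact: (measurable_Dquot s mu_ measurableT (measurable_set1 t)).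
- exact: Dquot_level_null.
- by move=> z [Jz fz]; apply: injf; rewrite ?inE// fz tk.
Qed.

End jumps.

(** * Energy, mass and the Poincare inequality *)

Section energies.
Context (R : realType) (n : nat) (Omega : set 'rV[R]_n) (s : R) (g G : R -> R).
Local Notation T := 'rV[R]_n.
Local Notation mu := (lebesgue_rV R n).

Definition kern (z : T * T) : R := (enorm (z.1 - z.2) ^+ n)^-1.
Definition Ds (u : T -> R) (z : T * T) : R := Dquot s u z.1 z.2.
Definition energy (u : T -> R) : \bar R := modular G (mu \x mu)%E setT kern (Ds u).
Definition mass (u : T -> R) : \bar R := modular G mu Omega (fun=> 1) u.

Lemma kern_ge0 z : 0 <= kern z.
Proof. by rewrite invr_ge0 exprn_ge0// enorm_ge0. Qed.

Lemma massE u : mass u = (\int[mu]_(x in Omega) (G `|u x|)%:E)%E.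
Proof. by apply: eq_integral => x _; rewrite mulr1. Qed.

Lemma frac_glapE u v : frac_glap s g u v = pairing g (mu \x mu)%E setT kern (Ds u) (Ds v).
Proof. by []. Qed.

Lemma DsD u v : Ds (fun x => u x + v x) = (fun z => Ds u z + Ds v z).
Proof. by apply/funext => z; rewrite /Ds /Dquot -mulrDl; congr (_ / _); ring. Qed.

Lemma DsZ c u : Ds (fun x => c * u x) = (fun z => c * Ds u z).
Proof. by apply/funext => z; rewrite /Ds /Dquot mulrA mulrBr. Qed.

Lemma Ds_abs u z : `|Ds (fun x => `|u x|) z| <= `|Ds u z|.
Proof.
by rewrite /Ds /Dquot !normrM ler_wpM2r// ler_dist_dist.
Qed.

Hypothesis (Yg : is_young g G) (mOmega : measurable Omega).
Variable K : R.
Hypothesis K1 : (1 : R) <= K.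
Hypothesis GK : forall t : R, 0 <= t -> G (2 * t) <= K * G t.

Lemma modular_supp (u : T -> R) : measurable_fun setT u ->
  {ae mu, forall x, ~ Omega x -> u x = 0} ->
  modular G mu setT (fun=> 1) u = mass u.
Proof.
move=> mu_ u0.
have mG : measurable_fun setT (fun x => (G `|u x| * 1)%:E).
  exact: (measurable_modular Yg).
have G0 (a : R) : (0 <= (G `|a| * 1)%:E)%E by rewrite lee_fin mulr1 (youngG_ge0 Yg).
rewrite /mass /modular [RHS]integral_mkcond; apply: ge0_ae_eq_integral => //.
- exact/(measurable_restrictT _ _).1/(measurable_funS measurableT).
- by move=> x _; rewrite patchE; case: ifP.
apply: filterS u0 => x ux _; rewrite patchE; case: ifPn => // /negP xO.
by rewrite ux ?normr0 ?(young_G0 Yg) ?mul0r// => /mem_set.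
Qed.

Lemma W0E (u : T -> R) : W0_sG s G Omega u <->
  [/\ measurable_fun setT u, (mass u < +oo)%E, (energy u < +oo)%E &
      {ae mu, forall x, ~ Omega x -> u x = 0}].
Proof.
have eqPsi : measurable_fun setT u -> {ae mu, forall x, ~ Omega x -> u x = 0} ->
    (\int[mu]_x (G `|u x|)%:E)%E = mass u.
  move=> mu_ u0; rewrite -modular_supp//.
  by apply: eq_integral => x _; rewrite mulr1.
split=> [[[m1 m2 m3] m4]|[m1 m2 m3 m4]].
  by split => //; rewrite -eqPsi.
by split => //; split => //; rewrite eqPsi.
Qed.

Lemma measurable_Ds (u : T -> R) : measurable_fun setT u -> measurable_fun setT (Ds u).
Proof. exact: measurable_Dquot. Qed.

Lemma measurable_kern : measurable_fun [set: T * T] kern.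
Proof. exact: measurable_kernel. Qed.

Lemma W0_add (u v : T -> R) : W0_sG s G Omega u -> W0_sG s G Omega v ->
  W0_sG s G Omega (fun x => u x + v x).
Proof.
move=> /W0E[u1 u2 u3 u4] /W0E[v1 v2 v3 v4]; apply/W0E; split.
- exact: measurable_funD.
- exact: (modularD_lty Yg mOmega (measurable_cst _) (fun=> ler01) K1 GK).
- rewrite /energy DsD.
  by apply: (modularD_lty Yg measurableT measurable_kern kern_ge0 K1 GK) => //;
    exact: measurable_Ds.
- by apply: filterS2 u4 v4 => x ux vx nx; rewrite ux// vx// addr0.
Qed.

Lemma W0_scale (c : R) (u : T -> R) : W0_sG s G Omega u -> W0_sG s G Omega (fun x => c * u x).
Proof.
move=> /W0E[u1 u2 u3 u4]; apply/W0E; split.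
- exact: measurable_funM.
- exact: (modularZ_lty Yg mOmega (measurable_cst _) (fun=> ler01) K1 GK).
- rewrite /energy DsZ.
  by apply: (modularZ_lty Yg measurableT measurable_kern kern_ge0 K1 GK) => //;
    exact: measurable_Ds.
- by apply: filterS u4 => x ux nx; rewrite ux// mulr0.
Qed.

Lemma mass_abs (u : T -> R) : mass (fun x => `|u x|) = mass u.
Proof. by rewrite !massE; apply: eq_integral => x _; rewrite normr_id. Qed.

Lemma energy_abs (u : T -> R) : measurable_fun setT u -> (energy (fun x => `|u x|%R) <= energy u)%E.
Proof.
move=> mu_; apply: (modular_mono Yg) => //.
- exact: measurable_kern.
- exact: kern_ge0.
- by apply: measurable_Ds; exact: (measurableT_comp (@normr_measurable R setT) mu_).
- exact: measurable_Ds.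
- by move=> z _; exact: Ds_abs.
Qed.

Lemma bounded_box : bounded_set Omega ->
  exists2 M : R, 0 < M & forall x, Omega x -> forall i, `|x 0 i| <= M.
Proof.
move=> [M0 [_ HM]]; exists (Num.max 0 M0 + 1).
  by rewrite ltr_pwDr// le_max lexx.
move=> x Ox i; apply: le_trans (HM (Num.max 0 M0 + 1) _ x Ox); last first.
  by rewrite ltr_pwDr// le_max lexx orbT.
rewrite [leRHS]/Num.norm /= mx_normrE.
by apply: (le_bigmax_cond _ (fun ij : 'I_1 * 'I_n => `|x ij.1 ij.2|) (j := (0, i))).
Qed.

(** For [x] in [Omega], restrict the inner integral to the [y] in a unit box [A] away
    from [Omega], where [u y = 0]: there [|x - y|] stays between two positive
    constants, so the integrand is at least a multiple of [G |u x|]. *)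
Lemma poincare (M : R) : (0 < n)%N -> (0 : R) < s < 1 -> 0 < M ->
  (forall x, Omega x -> forall i, `|x 0 i| <= M) ->
  exists2 c : R, 0 < c & forall u : T -> R, measurable_fun setT u ->
    {ae mu, forall x, ~ Omega x -> u x = 0} -> (c%:E * mass u <= energy u)%E.
Proof.
move=> n0 /andP[s0 s1] M0 OM.
(* a box of measure 1 whose points have all coordinates beyond the bound [M] *)
pose A : set T := [set y | forall i : 'I_n, `[M + 1, M + 2]%classic (y 0 i)].
have mA : measurable A.
  by apply: (@measurable_rV_box R n (fun=> `[M + 1, M + 2]%classic)).
have A1 : mu A = 1%E.
  have := @lebesgue_rV_box R n (fun=> `[M + 1, M + 2]%classic) 1.
  rewrite expr1n; apply => // i; rewrite lebesgue_measure_itv /= lte_fin ltrD2l.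
  by rewrite ltr1n -EFinB; congr (_%:E); ring.
have AO y : A y -> ~ Omega y.
  move=> Ay /OM /(_ (Ordinal n0)); have := Ay (Ordinal n0).
  by rewrite /= in_itv /= ler_norml => /andP[? _] /andP[_ ?]; lra.
(* coordinates in [-M, M] and in [M + 1, M + 2] differ by at most [2 M + 2] *)
pose L : R := n%:R * (2 * M + 2).
have n1 : (1 : R) <= n%:R by rewrite ler1n.
have L1 : 1 <= L by rewrite /L; nra.
have L0 : 0 < L by lra.
have dist x y : Omega x -> A y -> 0 < enorm (x - y) <= L.
  move=> Ox Ay; apply/andP; split.
    by apply: enorm_gt0; apply/eqP => xy; apply: (AO y) => //; rewrite -xy.
  apply: enorm_le_nmul => i; rewrite !mxE.
  have := OM x Ox i; have := Ay i; rewrite /= in_itv /= !ler_norml.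
  by move=> /andP[? ?] /andP[? ?]; apply/andP; split; lra.
have [m Lm] : exists m : nat, L <= 2 ^+ m.
  exists (Num.bound L); apply: le_trans (ltW (archi_boundP (ltW L0))) _.
  by rewrite -natrX ler_nat ltnW// ltn_expl.
pose c : R := (K ^+ m * L ^+ n)^-1.
have K0 : 0 < K by apply: lt_le_trans K1.
have c0 : 0 < c by rewrite invr_gt0 mulr_gt0// exprn_gt0.
exists c => // u mu_ u0.
pose F (z : T * T) : \bar R := (G `|Ds u z| * kern z)%:E.
have mF : measurable_fun setT F.
  by apply: (measurable_modular Yg) => //; [exact: measurable_kern|exact: measurable_Ds].
have F0 z : (0 <= F z)%E by apply: (modular_integrand_ge0 Yg); exact: kern_ge0.
have mFx x : measurable_fun setT (fun y => F (x, y)) by exact: measurableT_comp.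
have mPhi : measurable_fun setT (fun x => \int[mu]_y F (x, y))%E.
  exact: measurable_fun_fubini_tonelli_F.
have Phi0 x : (0 <= \int[mu]_y F (x, y))%E by apply: integral_ge0.
rewrite -[leRHS]/(\int[mu \x mu]_z F z)%E fubini_tonelli1//.
apply: (@le_trans _ _ (\int[mu]_(x in Omega) \int[mu]_y F (x, y))%E); last first.
  exact: ge0_subset_integral.
have mG : measurable_fun Omega (fun x => (G `|u x| * 1)%:E).
  by apply: (measurable_modular Yg).
have G0 x : (0 <= (G `|u x| * 1)%:E)%E by rewrite lee_fin mulr1 (youngG_ge0 Yg).
rewrite -ge0_integralZl//; last by rewrite lee_fin ltW.
apply: ge0_le_integral => //.
- by move=> x _; rewrite mule_ge0// lee_fin ltW.
- exact: measurable_funeM.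
- exact: (measurable_funS measurableT).
move=> x Ox.
apply: (@le_trans _ _ (\int[mu]_(y in A) F (x, y))%E); last exact: ge0_subset_integral.
rewrite -EFinM mulr1 -[leLHS]mule1 -A1 -integral_cst//.
apply: ae_ge0_le_integral => //.
- by move=> y _; rewrite lee_fin mulr_ge0 ?(ltW c0)// (youngG_ge0 Yg).
- exact: (measurable_funS measurableT).
apply: filterS u0 => y uy Ay; rewrite lee_fin.
have {uy} uy : u y = 0 by apply: uy; exact: AO.
have /andP[e0 eL] := dist x y Ox Ay.
have es : enorm (x - y) `^ s <= 2 ^+ m.
  apply: le_trans Lm; apply: (@le_trans _ _ (L `^ s)).
    by rewrite ge0_ler_powR// ?nnegrE ltW.
  rewrite -[leRHS]powRr1 ?(ltW L0)//; apply: ler_powR => //; exact: ltW.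
have es0 : 0 < enorm (x - y) `^ s by exact: powR_gt0.
rewrite /c invfM -mulrA mulrCA mulrC; apply: ler_pM.
- by rewrite mulr_ge0 ?invr_ge0 ?exprn_ge0 ?(youngG_ge0 Yg)// ltW.
- by rewrite invr_ge0 exprn_ge0// ltW.
- rewrite mulrC ler_pdivrMr ?exprn_gt0// mulrC.
  apply: le_trans (young_pow2 K1 GK m (normr_ge0 _)).
  apply: (young_mono Yg) => //; rewrite /Ds /Dquot uy subr0 normrM normrV ?unitfE ?gt_eqF//.
  by rewrite (gtr0_norm es0) mulrCA ler_peMr// ler_pdivlMr// mul1r.
- by rewrite /kern lef_pV2 ?posrE ?exprn_gt0// lerXn2r// nnegrE ltW.
Qed.

End energies.

(** * Approximation by step functions on cubes *)

Section step_approximation.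
Context (R : realType) (n : nat) (s : R) (g G : R -> R) (Yg : is_young g G).
Hypothesis s01 : (0 : R) < s < 1.
Local Notation T := 'rV[R]_n.
Local Notation mu := (lebesgue_rV R n).
Local Notation modulus Q u := (modular G mu Q (fun=> 1) u).

(** The mean over [y] in [Q] of [\int_Q G |u x - u y|] is at most [I / q], so some
    value [c = u y] exceeds it by at most the slack [eta]. Taking a value of [u] as
    the constant avoids means of [u] and Jensen's inequality. *)
Lemma cube_mean (Q : set T) (q I eta : R) (u : T -> R) :
  measurable Q -> mu Q = q%:E -> 0 < q -> 0 < eta -> measurable_fun setT u ->
  (\int[mu \x mu]_(z in Q `*` Q) (G `|u z.1 - u z.2|)%:E <= I%:E)%E ->
  exists c : R, (q%:E * modulus Q (fun x => u x - c)%R <= (I + eta)%:E)%E.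
Proof.
move=> mQ muQ q0 eta0 mu_ HI; apply: contrapT => /forallNP nex.
pose h (z : T * T) : \bar R := (G `|u z.1 - u z.2|)%:E.
have mh : measurable_fun setT h.
  apply/measurable_EFinP.
  apply: (measurableT_comp (measurable_youngN Yg)); apply: measurable_funB.
    exact: (measurableT_comp mu_ measurable_fst).
  exact: (measurableT_comp mu_ measurable_snd).
have h0 z : (0 <= h z)%E by rewrite lee_fin (youngG_ge0 Yg).
have mQQ : measurable (Q `*` Q) by exact: measurableX.
pose hQ := h \_ (Q `*` Q).
have mhQ : measurable_fun setT hQ.
  exact: ((measurable_restrictT h mQQ).1 (measurable_funS measurableT (@subsetT _ _) mh)).
have hQ0 z : (0 <= hQ z)%E by rewrite /hQ patchE; case: ifP.
pose f (y : T) : \bar R := (\int[mu]_x hQ (x, y))%E.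
have f0 y : (0 <= f y)%E by exact: integral_ge0.
have mf : measurable_fun setT f by exact: measurable_fun_fubini_tonelli_G.
have IE : (\int[mu]_y f y <= I%:E)%E.
  apply: le_trans HI; rewrite [leRHS]integral_mkcond.
  by rewrite [leRHS](fubini_tonelli2 hQ).
have fQ : (\int[mu]_(y in Q) ((I + eta) / q)%:E <= \int[mu]_(y in Q) f y)%E.
  have I0 : 0 <= I by rewrite -lee_fin; apply: le_trans HI; apply: integral_ge0 => z _; exact: h0.
  apply: ge0_le_integral => //.
  - by move=> y _; rewrite lee_fin divr_ge0 ?(ltW q0)// addr_ge0// ltW.
  - exact: (measurable_funS measurableT).
  move=> y Qy.
  have -> : f y = modulus Q (fun x => u x - u y).
    rewrite /f /modular [RHS]integral_mkcond; apply: eq_integral => x _.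
    rewrite /hQ !patchE /= mulr1; congr (if _ then _ else _).
    by apply/idP/idP; rewrite !inE /=; [case|split].
  have := nex (u y) => /negP; rewrite -ltNge => /ltW.
  by rewrite mulrC EFinM lee_pdivrMl.
have cstE : (\int[mu]_(y in Q) ((I + eta) / q)%:E)%E = (I + eta)%:E.
  transitivity (((I + eta) / q)%:E * mu Q)%E; first exact: integral_cst.
  by rewrite muQ -EFinM divfK ?gt_eqF.
rewrite cstE in fQ.
have := le_trans fQ (ge0_subset_integral mu mQ measurableT mf (fun x _ => f0 x) (@subsetT _ _)).
by move=> /le_trans /(_ IE); rewrite lee_fin gerDl leNgt eta0.
Qed.

(** [|u x - u y| = |x - y|^s |D_s u|] with [|x - y|^s <= 1]: convexity takes this
    factor out of [G], and [|x - y|^n <= d^n] brings in the kernel. *)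
Lemma cube_energy (Q : set T) (d : R) (u : T -> R) : measurable Q ->
  0 <= d -> d <= 1 -> (forall x y, Q x -> Q y -> enorm (x - y) <= d) ->
  measurable_fun setT u ->
  (\int[mu \x mu]_(z in Q `*` Q) (G `|u z.1 - u z.2|)%:E <=
   (d `^ s * d ^+ n)%:E * modular G (mu \x mu) (Q `*` Q) (@kern R n) (Ds s u))%E.
Proof.
move=> mQ d0 d1 Qd mu_; have [s0 s1] : 0 < s /\ s < 1 by case/andP: s01.
have mQQ : measurable (Q `*` Q) by exact: measurableX.
have mD : measurable_fun (Q `*` Q) (fun z => (G `|Ds s u z| * kern z)%:E).
  by apply: (measurable_modular Yg) => //; [exact: measurable_kern|exact: measurable_Ds].
have D0 (z : T * T) : (0 <= (G `|Ds s u z| * kern z)%:E)%E.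
  by apply: (modular_integrand_ge0 Yg); exact: kern_ge0.
have c0 : (0 <= (d `^ s * d ^+ n)%:E)%E by rewrite lee_fin mulr_ge0 ?powR_ge0 ?exprn_ge0.
rewrite -ge0_integralZl//; apply: ge0_le_integral => //.
- by move=> z _; rewrite lee_fin (youngG_ge0 Yg).
- apply/measurable_EFinP; apply: (@measurable_funS _ _ _ _ setT) => //.
  apply: (measurableT_comp (measurable_youngN Yg)); apply: measurable_funB.
    exact: (measurableT_comp mu_ measurable_fst).
  exact: (measurableT_comp mu_ measurable_snd).
- exact: measurable_funeM.
move=> [x y] /= [Qx Qy]; rewrite -EFinM lee_fin.
have [->|xy] := eqVneq x y.
  rewrite subrr normr0 (young_G0 Yg); have := D0 (y, y); rewrite lee_fin => ?.
  by apply: mulr_ge0.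
have e0 := enorm_gt0 xy; have ed := Qd _ _ Qx Qy.
set e := enorm (x - y) in e0 ed.
have es0 : 0 < e `^ s by exact: powR_gt0.
have es1 : e `^ s <= 1.
  have -> : 1 = 1 `^ s :> R by rewrite powR1.
  apply: ge0_ler_powR; rewrite ?nnegrE ?ler01 ?(ltW s0) ?(ltW e0)//.
  exact: le_trans d1.
have -> : u x - u y = e `^ s * Ds s u (x, y).
  by rewrite /Ds /Dquot -/e mulrC divfK// gt_eqF.
rewrite normrM (gtr0_norm es0).
apply: le_trans (young_scale Yg _ (normr_ge0 _)) _; first by rewrite (ltW es0).
rewrite -mulrA; apply: ler_pM => //; first exact: ltW.
- exact: youngG_ge0 Yg _ _.
- by apply: ge0_ler_powR => //; rewrite ?nnegrE ltW.
rewrite mulrCA ler_peMr ?(youngG_ge0 Yg)// /kern -/e ler_pdivlMr ?exprn_gt0// mul1r.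
by rewrite lerXn2r// nnegrE ltW.
Qed.

Variables (I : finType) (Q : I -> set T) (q d : R).
Hypotheses (mQ : forall i, measurable (Q i)) (muQ : forall i, mu (Q i) = q%:E).
Hypotheses (q0 : 0 < q) (d0 : 0 < d) (d1 : d <= 1).
Hypothesis tQ : trivIset setT Q.
Hypothesis Qd : forall i x y, Q i x -> Q i y -> enorm (x - y) <= d.

(** The blocks [Q i `*` Q i] are disjoint, so their energies add up to at most that of
    [u]. For grids of cubes, [d^n / q] stays bounded under refinement, and the error
    is of order [d^s]. *)
Lemma step_approximation (u : T -> R) (C : R) : measurable_fun setT u ->
  (energy s G u <= C%:E)%E ->
  exists c : I -> R, (\sum_(i : I) modulus (Q i) (fun x => u x - c i)%R <=
    (d `^ s * d ^+ n * (C + 1) / q)%:E)%E.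
Proof.
move=> mu_ HC.
pose th := d `^ s * d ^+ n.
have th0 : 0 < th by rewrite mulr_gt0 ?powR_gt0 ?exprn_gt0.
pose P i := modular G (mu \x mu)%E (Q i `*` Q i) (@kern R n) (Ds s u).
pose h (z : T * T) : \bar R := (G `|Ds s u z| * kern z)%:E.
have mh : measurable_fun setT h.
  by apply: (measurable_modular Yg) => //; [exact: measurable_kern|exact: measurable_Ds].
have h0 z : (0 <= h z)%E.
  by apply: (modular_integrand_ge0 Yg); exact: kern_ge0.
have P0 i : (0 <= P i)%E by apply: integral_ge0 => z _; exact: h0.
have mQQ i : measurable (Q i `*` Q i) by exact: measurableX.
have sumP : (\sum_(i : I) P i <= C%:E)%E.
  apply: le_trans HC; rewrite /P /modular.
  rewrite -(@ge0_integral_bigsetU _ _ _ (mu \x mu)%E I (fun i => Q i `*` Q i) h (index_enum I))//.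
  - apply: ge0_subset_integral => //.
    by apply: bigsetU_measurable.
  - exact: index_enum_uniq.
  - apply/trivIsetP => i j _ _ ij; apply/seteqP; split => // -[x y] [/= [ix _] [jx _]].
    move/trivIsetP : tQ => /(_ i j Logic.I Logic.I ij) Qij.
    by rewrite -[False]/(set0 x) -Qij.
  - exact: (measurable_funS measurableT).
have Pfin i : P i \is a fin_num.
  rewrite ge0_fin_numE//; apply: le_lt_trans (ltry C); apply: le_trans sumP.
  by rewrite (bigD1 i)//= leeDl// sume_ge0.
(* the slacks of all the cubes add up to at most [th], the [+ 1] in the bound *)
pose eta := th / (#|I|.+1)%:R.
have eta0 : 0 < eta by rewrite divr_gt0.
have ex i : exists c : R, (modulus (Q i) (fun x => u x - c)%R <= ((th * fine (P i) + eta) / q)%:E)%E.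
  have [|c Hc] := @cube_mean (Q i) q (th * fine (P i)) eta u (mQ i) (muQ i) q0 eta0 mu_ _.
    rewrite EFinM fineK//; apply: cube_energy => //; first exact: ltW.
    exact: Qd.
  by exists c; rewrite mulrC EFinM lee_pdivlMl//; exact: Hc.
have [c Hc] := choice ex; exists c.
apply: le_trans (lee_sum _ (fun i _ => Hc i)) _.
rewrite sumEFin lee_fin -mulr_suml ler_pM2r ?invr_gt0// big_split /= -mulr_sumr.
rewrite mulrDr mulr1 lerD//.
  rewrite ler_pM2l// -lee_fin -sumEFin.
  by under eq_bigr do rewrite fineK//.
rewrite sumr_const -mulr_natr /eta -mulrA ler_piMr ?(ltW th0)// mulrC ler_pdivrMr// mul1r.
by rewrite ler_nat; exact: leqnSn.
Qed.

End step_approximation.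

(** * Total boundedness along an ultrafilter *)

Lemma ultra_bounded_cvg (R : realType) (U : set_system nat) (c : nat -> R) (B : R) :
  UltraFilter U -> (forall k, `|c k| <= B) ->
  exists p : R, forall e : R, 0 < e -> U [set k | `|c k - p| < e].
Proof.
move=> UU cB.
have cpt := @segment_compact R (- B) B.
have [|p [_ clp]] := cpt (c @ U).
  by apply: (@filterE _ U _ (c @^-1` _)) => k; rewrite /= in_itv /= -ler_norml.
exists p => e e0.
have [//|UnA] := in_ultra_setVsetC [set k | `|c k - p| < e] UU.
have nb : nbhs p (ball p e) by exact: nbhsx_ballx.
have cn : U (c @^-1` (~` ball p e)).
  by apply: filterS UnA => k /= + pk; apply; rewrite distrC; exact: pk.
by have [x []] := clp _ _ cn nb.
Qed.

Lemma cube_grid (R : realType) (n : nat) (s M e : R) : (0 < n)%N ->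
  (0 : R) < s < 1 -> 0 < M -> 0 < e ->
  exists (I : finType) (Q : I -> set 'rV[R]_n) (q d : R),
    [/\ [/\ forall i, measurable (Q i), forall i, lebesgue_rV R n (Q i) = q%:E & trivIset setT Q],
        [/\ 0 < q, 0 < d & d <= 1],
        forall i x y, Q i x -> Q i y -> enorm (x - y) <= d,
        [set x : 'rV[R]_n | forall i, `|x 0 i| <= M] `<=` \bigcup_i Q i &
        d `^ s * d ^+ n / q <= e].
Proof.
move=> n0 /andP[s0 s1] M0 e0.
have nn0 : 0 < n%:R :> R by rewrite ltr0n.
(* the cubes are open on the right: the grid has to reach beyond [M] *)
pose M' := M + 1; have M'0 : 0 < M' by rewrite addr_gt0.
pose e' := e / n%:R ^+ n; have e'0 : 0 < e' by rewrite divr_gt0// exprn_gt0.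
pose r := Num.min 1 (e' `^ s^-1).
have r0 : 0 < r by rewrite lt_min ltr01 powR_gt0.
pose A := n%:R * (2 * M') / r.
have A0 : 0 < A by rewrite divr_gt0// mulr_gt0// mulr_gt0.
pose N := Num.bound A.
pose dl := 2 * M' / N.+1%:R.
have dl0 : 0 < dl by rewrite divr_gt0// mulr_gt0.
pose d := n%:R * dl.
have d0 : 0 < d by rewrite mulr_gt0.
have dr : d <= r.
  rewrite /d /dl mulrA ler_pdivrMr// [leRHS]mulrC -ler_pdivrMr//.
  apply: le_trans (ltW (archi_boundP (ltW A0))) _.
  by rewrite ler_nat.
have d1 : d <= 1 by apply: le_trans dr _; rewrite ge_min lexx.
pose J (k : nat) : set R := `[- M' + dl * k%:R, - M' + dl * k.+1%:R[%classic.
have JE k x : J k x -> Num.truncn ((x + M') / dl) = k.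
  rewrite /J /= in_itv /= => /andP[h1 h2]; apply: truncn_def; apply/andP; split.
    by rewrite ler_pdivlMr// mulrC; lra.
  by rewrite ltr_pdivrMr// mulrC; lra.
pose Q (f : {ffun 'I_n -> 'I_N.+1}) : set 'rV[R]_n := [set x | forall i, J (f i) (x 0 i)].
exists {ffun 'I_n -> 'I_N.+1}, Q, (dl ^+ n), d; split.
- split.
  + by move=> f; apply: (@measurable_rV_box R n (fun i => J (f i))) => i; exact: measurable_itv.
  + move=> f; apply: (@lebesgue_rV_box R n (fun i => J (f i))) => i; first exact: measurable_itv.
    rewrite lebesgue_measure_itv /= lte_fin ltrD2l ltr_pM2l// ltr_nat ltnSn.
    by rewrite -EFinB -natr1; congr (_%:E); ring.
  + apply/trivIsetP => f f' _ _ ff'; apply/seteqP; split => // x [fx f'x].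
    move/eqP : ff'; apply; apply/ffunP => i; apply: val_inj => /=.
    by rewrite -(JE _ _ (fx i)) -(JE _ _ (f'x i)).
- by split => //; rewrite exprn_gt0.
- move=> f x y fx fy; apply: enorm_le_nmul => i; rewrite !mxE.
  have := fx i; have := fy i; rewrite /J /= !in_itv /= => /andP[? ?] /andP[? ?].
  have : dl * (f i).+1%:R = dl * (f i)%:R + dl by rewrite -natr1; ring.
  by move=> ?; rewrite ler_norml; apply/andP; split; lra.
- move=> x xM.
  pose t i := (x 0 i + M') / dl.
  have t0 i : 0 <= t i.
    by rewrite divr_ge0 ?(ltW dl0)//; have := xM i; rewrite ler_norml /M' => /andP[? ?]; lra.
  have tN i : t i < N.+1%:R.
    rewrite ltr_pdivrMr// /dl mulrC divfK//.
    by have := xM i; rewrite ler_norml /M' => /andP[? ?]; lra.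
  have trN i : (Num.truncn (t i) < N.+1)%N.
    by rewrite -(ltr_nat R); apply: le_lt_trans (tN i); have /andP[] := truncn_itv (t0 i).
  exists [ffun i => inord (Num.truncn (t i))] => // i.
  rewrite /J /= in_itv /= ffunE inordK//.
  have /andP[] := truncn_itv (t0 i).
  rewrite ler_pdivlMr// ltr_pdivrMr// => h1 h2.
  by apply/andP; split; rewrite mulrC; lra.
- have -> : d `^ s * d ^+ n / dl ^+ n = n%:R ^+ n * d `^ s.
    rewrite /d exprMn mulrA mulfK ?gt_eqF ?exprn_gt0//; ring.
  rewrite mulrC -ler_pdivlMr ?exprn_gt0// -/e'.
  have -> : e' = (e' `^ s^-1) `^ s.
    by rewrite -powRrM mulVf ?gt_eqF// powRr1// ltW.
  apply: ge0_ler_powR; [exact: ltW|by rewrite nnegrE ltW|by rewrite nnegrE powR_ge0|].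
  by apply: le_trans dr _; rewrite ge_min lexx orbT.
Qed.

Section total_boundedness.
Context (R : realType) (n : nat) (Omega : set 'rV[R]_n) (s : R) (g G : R -> R).
Hypotheses (Yg : is_young g G) (mOmega : measurable Omega).
Hypothesis s01 : (0 : R) < s < 1.
Variable K : R.
Hypothesis K1 : (1 : R) <= K.
Hypothesis GK : forall t : R, 0 <= t -> G (2 * t) <= K * G t.
Local Notation T := 'rV[R]_n.
Local Notation mu := (lebesgue_rV R n).
Local Notation modulus Q u := (modular G mu Q (fun=> 1) u).
Variable M : R.
Hypotheses (n0 : (0 < n)%N) (M0 : 0 < M).
Hypothesis OM : forall x, Omega x -> forall i, `|x 0 i| <= M.

Variables (u_ : nat -> T -> R) (C : R).
Hypothesis mu_ : forall k, measurable_fun setT (u_ k).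
Hypothesis C0 : 0 <= C.
Hypothesis mass_le : forall k, (modulus setT (u_ k) <= C%:E)%E.
Hypothesis energy_le : forall k, (energy s G (u_ k) <= C%:E)%E.

Let K0 : 0 < K. Proof. exact: lt_le_trans ltr01 K1. Qed.

(** On a fine grid, every [u_ k] is close to a step function, uniformly in [k], whose
    finitely many coefficients are bounded through the mass. These converge along
    [U], so the step functions of two indices in a set of [U] are close to each other.
    One ultrafilter serves all [e], which spares nested subsequences. *)
Lemma modular_total_bounded (U : set_system nat) (e : R) : UltraFilter U -> 0 < e ->
  exists2 A, U A & forall k l, A k -> A l ->
    (modulus Omega (fun x => u_ k x - u_ l x)%R <= e%:E)%E.
Proof.
move=> UU e0.
(* the distances to the two step functions, with the constants of [modular_add],
   will cost [e / 2]; the distance between the step functions the other half *)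
pose e1 := e / (2 * (K + K ^+ 2)) / (C + 1).
have KK : 0 < 2 * (K + K ^+ 2) by rewrite mulr_gt0// addr_gt0// exprn_gt0.
have e10 : 0 < e1 by rewrite !divr_gt0// ltr_wpDl.
have [I [Q [q [d [[mQ muQ tQ] [q0 d0 d1] Qd cov dq]]]]] := cube_grid n0 s01 M0 e10.
have ex k : exists c : I -> R, (\sum_(i : I) modulus (Q i) (fun x => u_ k x - c i)%R <=
    (e1 * (C + 1))%:E)%E.
  have [c Hc] := step_approximation Yg s01 mQ muQ q0 d0 d1 tQ Qd (mu_ k) (energy_le k).
  exists c; apply: (le_trans Hc); rewrite lee_fin.
  by rewrite -mulrA [_ * q^-1]mulrC mulrA ler_wpM2r// addr_ge0.
have [c Hc] := choice ex.
set e2 := e1 * (C + 1) in Hc.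
have e20 : 0 < e2 by rewrite mulr_gt0// ltr_wpDl.
have mcst (b : R) : measurable_fun [set: T] (fun=> b) by exact: measurable_cst.
have k1 : forall x : T, (0 : R) <= 1 by move=> _; exact: ler01.
have m1 : measurable_fun [set: T] (fun=> (1 : R)) by exact: measurable_cst.
have addQ i (f h : T -> R) : measurable_fun setT f -> measurable_fun setT h ->
    (modulus (Q i) (fun x => f x + h x)%R <=
      K%:E * (modulus (Q i) f + modulus (Q i) h))%E.
  by move=> mf mh; exact: (modular_add Yg mu (mQ i) m1 k1 K1 GK mf mh).
have mi0 (a : R) : (0 <= (G `|a| * 1)%:E)%E.
  by rewrite lee_fin mulr1 (youngG_ge0 Yg).
have modcst i (b : R) : modulus (Q i) (fun=> b) = (G `|b| * q)%:E.
  rewrite /modular mulr1; transitivity ((G `|b|)%:E * mu (Q i))%E; first exact: integral_cst.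
  by rewrite muQ -EFinM.
have Hci k i : (modulus (Q i) (fun x => u_ k x - c k i)%R <= e2%:E)%E.
  apply: le_trans (Hc k); rewrite (bigD1 i)//= leeDl// sume_ge0// => j _.
  exact: (modular_ge0 Yg).
(* [G |c|] times the measure of a cube is the modular of [c] on it, controlled by
   the mass of [u_ k] and the distance from it to [c] *)
pose B := 1 + K * (e2 + C) / q / G 1.
have G1 : 0 < G 1 by exact: (youngG_gt0 Yg).
have cB i k : `|c k i| <= B.
  apply: le_trans (young_le_linear Yg (normr_ge0 _)) _.
  rewrite lerD2l ler_pM2r ?invr_gt0// ler_pdivlMr// -lee_fin -(modcst i).
  have -> : (fun=> c k i) = (fun x => (- (u_ k x - c k i)) + u_ k x).
    by apply/funext => x; ring.
  apply: le_trans (addQ i (fun x => - (u_ k x - c k i)) (u_ k) _ _) _ => //.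
    by apply: measurableT_comp => //; exact: measurable_funB.
  rewrite [leRHS]EFinM; apply: lee_pmul => //.
  - by rewrite lee_fin ltW.
  - by rewrite adde_ge0//; exact: (modular_ge0 Yg).
  rewrite EFinD; apply: leeD.
    apply: le_trans (Hci k i); apply: (modular_mono Yg) => //.
    + by apply: measurableT_comp => //; exact: measurable_funB.
    + exact: measurable_funB.
    + by move=> x _; rewrite normrN.
  apply: le_trans (mass_le k); apply: ge0_subset_integral => //.
  exact: (measurable_modular Yg).
have [p Hp] := choice (fun i => ultra_bounded_cvg UU (cB i)).
pose e3 := Num.min (1 / 2) (e / (K ^+ 2 * (4 * #|I|.+1%:R * q * G 1))).
have D0 : 0 < K ^+ 2 * (4 * #|I|.+1%:R * q * G 1) by rewrite !mulr_gt0// exprn_gt0.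
have e30 : 0 < e3 by rewrite lt_min !divr_gt0.
exists [set k | forall i, `|c k i - p i| < e3].
  by apply: filter_forall => i; exact: Hp.
move=> k l /= Ak Al.
have ccG i : G `|c k i - c l i| * q <= e / (2 * K ^+ 2 * #|I|.+1%:R).
  have h1 : `|c k i - c l i| <= 2 * e3.
    have -> : c k i - c l i = (c k i - p i) - (c l i - p i) by ring.
    apply: le_trans (ler_normB _ _) _.
    by rewrite mulr_natl mulr2n lerD// ltW.
  have h2 : 0 <= 2 * e3 <= 1.
    by rewrite mulr_ge0 ?(ltW e30)//= mulrC -ler_pdivlMr// ge_min lexx.
  have h3 : G (2 * e3) <= 2 * e3 * G 1.
    by have := young_scale Yg h2 ler01; rewrite mulr1.
  have h4 : G `|c k i - c l i| <= G (2 * e3) by apply: (young_mono Yg).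
  have h5 : e3 <= e / (K ^+ 2 * (4 * #|I|.+1%:R * q * G 1)).
    by rewrite ge_min lexx orbT.
  apply: (@le_trans _ _ (2 * e3 * G 1 * q)).
    by rewrite ler_pM2r//; exact: le_trans h3.
  rewrite ler_pdivlMr ?mulr_gt0 ?exprn_gt0//.
  move: h5; rewrite ler_pdivlMr// => h5.
  by apply: le_trans h5; rewrite le_eqVlt; apply/predU1P; left; ring.
pose w x := u_ k x - u_ l x.
have mw : measurable_fun setT w by exact: measurable_funB.
have mQw i : (modulus (Q i) w <=
    K%:E * (modulus (Q i) (fun x => u_ k x - c k i)%R +
    K%:E * ((G `|c k i - c l i| * q)%:E + modulus (Q i) (fun x => u_ l x - c l i)%R)))%E.
  have -> : w = (fun x => (u_ k x - c k i) + ((c k i - c l i) + - (u_ l x - c l i))).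
    by apply/funext => x; rewrite /w; ring.
  have mm j b : measurable_fun setT (fun x => u_ j x - b) by exact: measurable_funB.
  have mmN j b : measurable_fun setT (fun x => - (u_ j x - b)).
    by apply: measurableT_comp => //.
  apply: le_trans (addQ i (fun x => u_ k x - c k i)
    (fun x => (c k i - c l i) + - (u_ l x - c l i)) _ _) _ => //.
    exact: measurable_funD.
  rewrite lee_pmul2l ?lte_fin// leeD2l//.
  apply: le_trans (addQ i (fun=> c k i - c l i) (fun x => - (u_ l x - c l i)) _ _) _ => //.
  rewrite lee_pmul2l ?lte_fin// modcst leeD2l//.
  by apply: (modular_mono Yg) => // x _; rewrite normrN.
have Mfin j i : modulus (Q i) (fun x => u_ j x - c j i)%R \is a fin_num.
  rewrite ge0_fin_numE; last exact: (modular_ge0 Yg).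
  exact: le_lt_trans (Hci j i) (ltry _).
pose m j i := fine (modulus (Q i) (fun x => u_ j x - c j i)%R).
have summ j : \sum_i m j i <= e2.
  rewrite -lee_fin -sumEFin; apply: le_trans (Hc j).
  by under eq_bigr do rewrite fineK//.
apply: (@le_trans _ _ (\sum_(i : I) modulus (Q i) w)%E).
  rewrite /modular -ge0_integral_bigsetU//.
  - apply: ge0_subset_integral => //.
    + by apply: bigsetU_measurable.
    + by apply: (measurable_modular Yg) => //; apply: bigsetU_measurable.
    + move=> x /OM /cov [i _ Qix]; rewrite -bigcup_seq; exists i => //=.
      exact: mem_index_enum.
  - exact: index_enum_uniq.
  - exact: (sub_trivIset (@subsetT _ _)).
  - by apply: (measurable_modular Yg) => //; apply: bigsetU_measurable.
apply: le_trans (lee_sum _ (fun i _ => mQw i)) _.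
have -> : (\sum_i (K%:E * (modulus (Q i) (fun x => u_ k x - c k i)%R +
    K%:E * ((G `|c k i - c l i| * q)%:E + modulus (Q i) (fun x => u_ l x - c l i)%R))))%E
  = (\sum_i (K * (m k i + K * (G `|c k i - c l i| * q + m l i))))%:E.
  rewrite -sumEFin; apply: eq_bigr => i _.
  have aux (X Y : \bar R) (a b t : R) : X = a%:E -> Y = b%:E ->
      (K%:E * (X + K%:E * (t%:E + Y)))%E = (K * (a + K * (t + b)))%:E.
    by move=> -> ->.
  by apply: aux; rewrite fineK.
rewrite lee_fin -mulr_sumr big_split /= -mulr_sumr big_split /=.
have sG : \sum_i G `|c k i - c l i| * q <= e / (2 * K ^+ 2).
  apply: le_trans (ler_sum _ (fun i _ => ccG i)) _.
  rewrite sumr_const -[X in X <= _]mulr_natr invfM mulrA -[leLHS]mulrA.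
  have a0 : 0 <= e / (2 * K ^+ 2) by rewrite divr_ge0 ?ltW// mulr_gt0// exprn_gt0.
  apply: ler_piMr => //.
  by rewrite mulrC ler_pdivrMr// mul1r ler_nat; exact: leqnSn.
apply: (@le_trans _ _ (K * (e2 + K * (e / (2 * K ^+ 2) + e2)))).
  by rewrite ler_pM2l// lerD// ler_pM2l// lerD.
have e2E : (K + K ^+ 2) * e2 = e / 2.
  rewrite /e2 /e1; field; apply/andP; split.
    by rewrite gt_eqF// ltr_wpDl.
  by rewrite gt_eqF// addr_gt0// exprn_gt0.
have -> : K * (e2 + K * (e / (2 * K ^+ 2) + e2)) = (K + K ^+ 2) * e2 + e / 2.
  by field; rewrite gt_eqF.
by rewrite e2E -splitr.
Qed.

End total_boundedness.

(** * Modular compactness *)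

Lemma geometric_eseries_lty (R : realType) (A z : R) : 0 <= A -> 0 < z -> z < 1 ->
  (\sum_(0 <= j <oo) (A * z ^+ j)%:E < +oo)%E.
Proof.
move=> A0 z0 z1; apply: (@le_lt_trans _ _ (A * (1 - z)^-1)%:E); last exact: ltry.
apply: lime_le.
  by apply: is_cvg_nneseries => j _ _; rewrite lee_fin mulr_ge0// exprn_ge0// ltW.
apply: nearW => k; rewrite sumEFin lee_fin.
by apply: geometric_le_lim => //; rewrite ger0_norm// ltW.
Qed.

Section modular_limit.
Context (R : realType) (g G : R -> R) (Yg : is_young g G).
Context d (T : measurableType d) (nu : {measure set T -> \bar R}).
Local Notation modulus u := (modular G nu setT (fun=> 1) u).

(** By Markov's inequality, [|v_ j - v_ j.+1| >= 2^-j] only on a set of measure at most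
    [2^-j]; Borel and Cantelli's lemma then makes [v_ ^~ x] Cauchy for almost every [x]. *)
Lemma modular_cauchy_ae (v_ : nat -> T -> R) :
  (forall j, measurable_fun setT (v_ j)) ->
  (forall j, (modulus (fun x => v_ j x - v_ j.+1 x)%R <=
      ((2^-1) ^+ j * G ((2^-1) ^+ j))%:E)%E) ->
  exists v : T -> R, [/\ measurable_fun setT v &
    {ae nu, forall x, v_ ^~ x @ \oo --> v x}].
Proof.
move=> mv Hv.
pose a j : R := 2^-1 ^+ j.
have a0 j : 0 < a j by rewrite exprn_gt0.
pose E j : set T := [set x | a j <= `|v_ j x - v_ j.+1 x|].
have mw j : measurable_fun setT (fun x => `|v_ j x - v_ j.+1 x|).
  apply: (measurableT_comp (@normr_measurable R setT)); exact: measurable_funB.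
have mE j : measurable (E j).
  rewrite (_ : E j = setT `&` (fun x => `|v_ j x - v_ j.+1 x|) @^-1` `[a j, +oo[%classic).
    by apply: mw => //; exact: measurable_itv.
  by rewrite setTI; apply/seteqP; split => x /=; rewrite in_itv /= andbT.
have Ga j : 0 < G (a j) by exact: (youngG_gt0 Yg).
have nuE j : (nu (E j) <= (a j)%:E)%E.
  have : ((G (a j))%:E * nu (E j) <= (a j * G (a j))%:E)%E.
    apply: le_trans (Hv j); rewrite -integral_cst//.
    apply: (@le_trans _ _ (\int[nu]_(x in E j) (G `|v_ j x - v_ j.+1 x| * 1)%:E)%E).
      apply: ge0_le_integral => //.
      - by move=> x _; rewrite lee_fin ltW.
      - by apply: (measurable_modular Yg) => //; exact: measurable_funB.
      - by move=> x Ex; rewrite lee_fin mulr1; apply: (young_mono Yg); [exact: ltW|exact: Ex].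
    apply: ge0_subset_integral => //.
      by apply: (measurable_modular Yg) => //; exact: measurable_funB.
    by move=> x _; rewrite lee_fin mulr1 (youngG_ge0 Yg).
  by rewrite [in leRHS]mulrC EFinM lee_pmul2l ?lte_fin.
pose N := lim_sup_set E.
have N0 : nu N = 0%E.
  apply: lim_sup_set_cvg0 => //.
  apply: (@le_lt_trans _ _ (\sum_(0 <= j <oo) (1 * a j)%:E)%E).
    by apply: lee_nneseries => // j _; rewrite mul1r.
  by apply: geometric_eseries_lty => //; rewrite invf_lt1// ltr1n.
have mN : measurable N.
  by apply: bigcap_measurable => // k _; apply: bigcup_measurable.
have cvN x : ~ N x -> cvgn (v_ ^~ x).
  move=> Nx.
  have [n0 Hn0] : exists n0, forall j, (n0 <= j)%N -> `|v_ j x - v_ j.+1 x| < a j.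
    apply: contrapT => /forallNP nex; apply: Nx => k _; apply: contrapT => nk.
    apply: (nex k) => j kj; rewrite ltNge; apply/negP => Ej; apply: nk.
    by exists j.
  (* [2 a j - 2 a (j + m)] is the sum of the geometric progression *)
  have tele j m : (n0 <= j)%N -> `|v_ j x - v_ (j + m)%N x| <= 2 * a j - 2 * a (j + m)%N.
    move=> nj; elim: m => [|m IH]; first by rewrite addn0 !subrr normr0.
    have -> : v_ j x - v_ (j + m.+1)%N x =
        (v_ j x - v_ (j + m)%N x) + (v_ (j + m)%N x - v_ (j + m).+1 x).
      by rewrite addnS; ring.
    apply: le_trans (ler_normD _ _) _.
    apply: le_trans (lerD IH (ltW (Hn0 (j + m)%N _))) _.
      by rewrite (leq_trans nj)// leq_addr.
    have -> : a (j + m.+1)%N = a (j + m)%N / 2 by rewrite /a addnS exprSr.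
    by rewrite le_eqVlt; apply/predU1P; left; field.
  apply/cauchy_cvgP/cauchy_exP => e e0.
  have [j [nj aj]] : exists j, (n0 <= j)%N /\ 2 * a j < e.
    have : \forall j \near \oo, 2 * a j < e.
      have := @cvg_geometric R 2 2^-1; rewrite ger0_norm// invf_lt1// ltr1n => /(_ isT).
      by move=> /cvgr_lt; apply.
    move=> [j0 _ Hj0]; exists (maxn n0 j0); split; first exact: leq_maxl.
    by apply: Hj0; exact: leq_maxr.
  exists (v_ j x); exists j => // k /= jk.
  rewrite /ball /= -(subnKC jk); apply: le_lt_trans (tele j _ nj) _.
  by apply: le_lt_trans aj; rewrite gerBl// mulr_ge0// ltW.
(* cut off on the null set, the sequence converges everywhere and its limit is
   measurable *)
pose w_ j x := v_ j x * \1_(~` N) x.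
have mw_ j : measurable_fun setT (w_ j).
  by apply: measurable_funM => //; apply: measurable_indic; exact: measurableC.
have cw x : cvgn (w_ ^~ x).
  have [Nx|Nx] := pselect (N x).
    rewrite (_ : w_ ^~ x = fun=> 0); first exact: is_cvg_cst.
    by apply/funext => j; rewrite /w_ indicE memNset ?mulr0//; apply.
  apply: is_cvgM; last exact: is_cvg_cst.
  exact: cvN.
exists (fun x => limn (w_ ^~ x)); split.
  exact: (measurable_fun_cvg mw_ (fun x _ => cw x)).
exists N; split => // x; apply: contra_notP => Nx /=.
have -> : v_ ^~ x = w_ ^~ x.
  by apply/funext => j; rewrite /w_ indicE mem_set ?mulr1.
exact: cw.
Qed.

End modular_limit.

Section compactness.
Context (R : realType) (n : nat) (Omega : set 'rV[R]_n) (s : R) (g G : R -> R).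
Hypotheses (Yg : is_young g G) (mOmega : measurable Omega).
Hypothesis s01 : (0 : R) < s < 1.
Variable K : R.
Hypothesis K1 : (1 : R) <= K.
Hypothesis GK : forall t : R, 0 <= t -> G (2 * t) <= K * G t.
Local Notation T := 'rV[R]_n.
Local Notation mu := (lebesgue_rV R n).
Local Notation modulus Q u := (modular G mu Q (fun=> 1) u).
Variable M : R.
Hypotheses (n0 : (0 < n)%N) (M0 : 0 < M).
Hypothesis OM : forall x, Omega x -> forall i, `|x 0 i| <= M.

Variables (u_ : nat -> T -> R) (C : R).
Hypothesis mu_ : forall k, measurable_fun setT (u_ k).
Hypothesis C0 : 0 <= C.
Hypothesis mass_le : forall k, (modulus setT (u_ k) <= C%:E)%E.
Hypothesis energy_le : forall k, (energy s G (u_ k) <= C%:E)%E.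
Hypothesis u0 : forall k, {ae mu, forall x, ~ Omega x -> u_ k x = 0}.

(** Along an ultrafilter finer than [\oo], let [A j] be the set given by total
    boundedness for [2^-j G (2^-j)]. Taking [phi j] in the first [j.+1] of these sets
    gives a sequence as in [modular_cauchy_ae], and Fatou's lemma turns the Cauchy
    estimates into convergence to the limit. *)
Lemma modular_compactness : exists (phi : nat -> nat) (v : T -> R),
  [/\ forall j, (j <= phi j)%N, measurable_fun setT v,
     {ae mu, forall x, u_ (phi j) x @[j --> \oo] --> v x} &
     forall e : R, 0 < e -> \forall j \near \oo,
       (modulus Omega (fun x => u_ (phi j) x - v x)%R <= e%:E)%E].
Proof.
have [U [UU ooU]] := ultraFilterLemma eventually_filter.
pose a j : R := 2^-1 ^+ j.
pose e_ j : R := a j * G (a j).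
have a0 j : 0 < a j by rewrite exprn_gt0.
have e_gt0 j : 0 < e_ j by rewrite mulr_gt0//; exact: (youngG_gt0 Yg).
have exA j : exists A, U A /\ forall k l, A k -> A l ->
    (modulus Omega (fun x => u_ k x - u_ l x)%R <= (e_ j)%:E)%E.
  have [A UA HA] := modular_total_bounded Yg mOmega s01 K1 GK n0 M0 OM mu_ C0 mass_le energy_le UU (e_gt0 j).
  by exists A.
have [A HA] := choice exA.
have exphi j : exists k, (j <= k)%N /\ forall i, (i <= j)%N -> A i k.
  have UB : U ([set k | (j <= k)%N] `&` [set k | forall i : 'I_j.+1, A i k]).
    apply: filterI; first by apply: ooU; exists j.
    by apply: filter_forall => i; have [] := HA i.
  have [k [jk Ak]] := filter_ex UB.
  by exists k; split => // i ij; exact: (Ak (Ordinal (ij : (i < j.+1)%N))).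
have [phi Hphi] := choice exphi.
have dphi j l : (j <= l)%N ->
    (modulus Omega (fun x => u_ (phi j) x - u_ (phi l) x)%R <= (e_ j)%:E)%E.
  move=> jl; have [_ HAj] := HA j; apply: HAj.
    by have [_] := Hphi j; apply.
  by have [_] := Hphi l; apply.
have vj : forall j, (modulus setT (fun x => u_ (phi j) x - u_ (phi j.+1) x)%R <= (e_ j)%:E)%E.
  move=> j; rewrite (modular_supp Yg mOmega); first exact: dphi.
    exact: measurable_funB.
  by apply: filterS2 (u0 (phi j)) (u0 (phi j.+1)) => x h1 h2 nx; rewrite h1// h2// subrr.
have [v [mv cv]] := modular_cauchy_ae Yg (fun j => mu_ (phi j)) vj.
exists phi, v; split => //; first by move=> j; have [] := Hphi j.
move=> e e0.
have : \forall j \near \oo, e_ j <= e.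
  have : \forall j \near \oo, G 1 * a j < e.
    have := @cvg_geometric R (G 1) 2^-1.
    rewrite ger0_norm// invf_lt1// ltr1n => /(_ isT).
    by move=> /cvgr_lt; apply.
  apply: filterS => j /ltW; apply: le_trans; rewrite /e_ mulrC ler_wpM2r ?(ltW (a0 j))//.
  apply: (young_mono Yg); first exact: ltW.
  by rewrite exprn_ile1// invf_le1// ler1n.
apply: filterS => j eje; apply: (@le_trans _ _ (e_ j)%:E); last by rewrite lee_fin.
apply: (@modular_fatou R g G Yg _ T mu Omega (fun=> 1) mOmega _ _
  (fun i x => u_ (phi j) x - u_ (phi i) x)) => //.
- by move=> i; exact: measurable_funB.
- exact: measurable_funB.
- by apply: filterS cv => x cvx _; apply: cvgB => //; exact: cvg_cst.
- by exists j => // i /= ji; exact: dphi.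
Qed.
End compactness.

(** * Integrable kernels built from cubes *)

Section box_series.
Context (R : realType) (n : nat).
Local Notation T := 'rV[R]_n.
Local Notation mu := (lebesgue_rV R n).
Variables (c rho : nat -> R).
Hypotheses (c0 : forall k, 0 <= c k) (rho0 : forall k, 0 < rho k).

Definition coord_close (r : R) : set (T * T) := [set z : T * T | forall i, `|z.1 0 i - z.2 0 i| <= r].

Let term k (z : T * T) : \bar R := (c k / (2 * rho k) ^+ n * \1_(coord_close (rho k)) z)%:E.

(** A symmetric majorant for kernels that need only be bounded scale by scale. The
    [k]-th term is normalised by the volume of a cube of half-side [rho k], so that
    integrating either variable leaves [\sum c k]. *)
Definition box_series (z : T * T) : \bar R := (\sum_(0 <= k <oo) term k z)%E.

Let mset (r : R) : measurable (coord_close r).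
Proof.
have -> : coord_close r = \bigcap_(i in [set: 'I_n])
    ((fun z : T * T => z.1 0 i - z.2 0 i) @^-1` `[- r, r]%classic).
  apply/seteqP; split => [z zr i _|z zr i].
    by rewrite /= in_itv /= -ler_norml; exact: zr.
  by have := zr i Logic.I; rewrite /= in_itv /= -ler_norml.
apply: fin_bigcap_measurable => // i _; rewrite -[X in measurable X]setTI.
have mi : measurable_fun [set: T * T] (fun z => z.1 0 i - z.2 0 i).
  apply: measurable_funB.
    exact: (measurableT_comp (measurable_coord_rV i) measurable_fst).
  exact: (measurableT_comp (measurable_coord_rV i) measurable_snd).
by apply: mi => //; exact: measurable_itv.
Qed.

Let mterm k : measurable_fun setT (term k).
Proof.
by apply/measurable_EFinP; apply: measurable_funM => //; exact: measurable_indic.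
Qed.

Let term0 k z : (0 <= term k z)%E.
Proof. by rewrite lee_fin mulr_ge0// divr_ge0// exprn_ge0// mulr_ge0// ltW. Qed.

Lemma measurable_box_series : measurable_fun setT box_series.
Proof. exact: ge0_emeasurable_sum. Qed.

Lemma box_series_ge0 z : (0 <= box_series z)%E.
Proof. exact: nneseries_ge0. Qed.

Lemma box_series_ge k z (a : R) : coord_close (rho k) z ->
  a <= c k / (2 * rho k) ^+ n -> (a%:E <= box_series z)%E.
Proof.
move=> zk ak; apply: (@le_trans _ _ (term k z)).
  by rewrite lee_fin indicE mem_set// mulr1.
rewrite /box_series (nneseries_split 0 k.+1)//.
rewrite big_nat_recr//= -addeA addeCA leeDl// adde_ge0//.
  by rewrite sume_ge0.
exact: nneseries_ge0.
Qed.

Let box_measure (x : T) (r : R) : 0 < r ->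
  mu [set y : T | forall i, `|x 0 i - y 0 i| <= r] = ((2 * r) ^+ n)%:E.
Proof.
move=> r0.
have -> : [set y : T | forall i, `|x 0 i - y 0 i| <= r] =
    [set y : T | forall i, `[x 0 i - r, x 0 i + r]%classic (y 0 i)].
  apply/seteqP; split => y yr i; have := yr i; rewrite /= in_itv /= ler_norml;
    by move=> /andP[? ?]; apply/andP; split; lra.
apply: (lebesgue_rV_box (A := fun i => `[x 0 i - r, x 0 i + r]%classic)) => i //.
rewrite lebesgue_measure_itv /= lte_fin ltrD2l gt0_cp// -EFinB.
by congr (_%:E); ring.
Qed.

Lemma integral_box_series1 (x : T) :
  (\int[mu]_y box_series (x, y) = \sum_(0 <= k <oo) (c k)%:E)%E.
Proof.
rewrite integral_nneseries//; last by move=> k; exact: measurableT_comp.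
apply: eq_eseriesr => k _; rewrite /term.
have mx : measurable [set y : T | coord_close (rho k) (x, y)].
  have := measurable_xsection x (mset (rho k)).
  rewrite (_ : xsection _ _ = [set y : T | coord_close (rho k) (x, y)])//.
  by apply/seteqP; split => y; rewrite /xsection /= inE.
have rn : 0 < (2 * rho k) ^+ n by rewrite exprn_gt0// mulr_gt0.
under eq_integral do rewrite EFinM.
rewrite ge0_integralZl//; last 2 first.
- apply/measurable_EFinP.
  have mi : measurable_fun setT (\1_(coord_close (rho k)) : T * T -> R).
    exact: measurable_indic.
  exact: measurableT_comp.
- by rewrite lee_fin divr_ge0// ltW.
rewrite (_ : (fun y => _) = (fun y => (\1_[set y : T | coord_close (rho k) (x, y)] y)%:E)); last first.
  by apply/funext => y; rewrite !indicE; congr ((_ (nat_of_bool _))%:E).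
by rewrite integral_indic// setIT [X in (_ * X)%E]box_measure// -EFinM divfK// gt_eqF.
Qed.

Lemma box_series_sym (x y : T) : box_series (x, y) = box_series (y, x).
Proof.
apply: eq_eseriesr => k _; rewrite /term !indicE.
suff -> : ((x, y) \in coord_close (rho k)) = ((y, x) \in coord_close (rho k)) by [].
by apply/idP/idP; rewrite !inE => h i /=; rewrite distrC; exact: h.
Qed.

Lemma integral_box_series2 (y : T) :
  (\int[mu]_x box_series (x, y) = \sum_(0 <= k <oo) (c k)%:E)%E.
Proof.
rewrite -(integral_box_series1 y); apply: eq_integral => x _.
exact: box_series_sym.
Qed.

Hypothesis cfin : (\sum_(0 <= k <oo) (c k)%:E < +oo)%E.

(** The weight is at least 1 as soon as one of the two points is in [B]: this covers
    the support of [v x - v y] when [v] vanishes outside [B]. *)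
Lemma box_series_lty (B : set T) : measurable B -> (mu B < +oo)%E ->
  (\int[mu \x mu]_z ((\1_B z.1 + \1_B z.2)%:E * box_series z) < +oo)%E.
Proof.
move=> mB Bfin.
have mr := measurable_box_series; have r0 := box_series_ge0.
have mi : measurable_fun setT (\1_B : T -> R) by exact: measurable_indic.
have m1 : measurable_fun [set: T * T] (fun z => (\1_B z.1)%:E : \bar R).
  by apply/measurable_EFinP; exact: (measurableT_comp mi measurable_fst).
have m2 : measurable_fun [set: T * T] (fun z => (\1_B z.2)%:E : \bar R).
  by apply/measurable_EFinP; exact: (measurableT_comp mi measurable_snd).
have i0 (x : T) : (0 <= (\1_B x)%:E :> \bar R)%E by rewrite lee_fin.
under eq_integral do rewrite EFinD ge0_muleDl//.
rewrite ge0_integralD//; last 4 first.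
- by move=> z _; exact: mule_ge0.
- exact: emeasurable_funM.
- by move=> z _; exact: mule_ge0.
- exact: emeasurable_funM.
set S := (\sum_(0 <= k <oo) (c k)%:E)%E.
have Sfin : (S < +oo)%E by exact: cfin.
have S0 : (0 <= S)%E by apply: nneseries_ge0 => k _ _; rewrite lee_fin.
have SB : (\int[mu]_x ((\1_B x)%:E * S) = mu B * S)%E.
  under eq_integral do rewrite muleC.
  rewrite ge0_integralZl//; last by apply/measurable_EFinP; exact: measurable_indic.
  by rewrite integral_indic// setIT muleC.
have SBfin : (mu B * S < +oo)%E.
  by rewrite lte_mul_pinfty// ge0_fin_numE.
apply: lte_add_pinfty.
  rewrite fubini_tonelli1//; last by move=> z; exact: mule_ge0.
    rewrite (_ : fubini_F _ _ = fun x => ((\1_B x)%:E * S)%E) ?SB//.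
    apply/funext => x; rewrite /fubini_F /= ge0_integralZl//.
      by rewrite integral_box_series1.
    exact: measurableT_comp.
  exact: emeasurable_funM.
rewrite fubini_tonelli2//; last by move=> z; exact: mule_ge0.
  rewrite (_ : fubini_G _ _ = fun x => ((\1_B x)%:E * S)%E) ?SB//.
  apply/funext => x; rewrite /fubini_G /= ge0_integralZl//.
    by rewrite integral_box_series2.
  exact: measurableT_comp.
exact: emeasurable_funM.
Qed.

End box_series.

Lemma dyadic_scale (R : realType) (e : R) : 0 < e -> e <= 1 ->
  exists k : nat, 2^-1 ^+ k.+1 < e <= 2^-1 ^+ k.
Proof.
move=> e0 e1.
have ex : exists k : nat, 2^-1 ^+ k.+1 < e.
  have := @cvg_geometric R 1 2^-1; rewrite ger0_norm// invf_lt1// ltr1n => /(_ isT).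
  move=> /cvgr_lt /(_ e e0) [k _ Hk]; exists k.
  by have := Hk k.+1 (leqnSn k); rewrite /= mul1r.
exists (ex_minn ex); case: ex_minnP => k ke kmin; rewrite ke /=.
case: k ke kmin => [|k] ke kmin; first by rewrite expr0.
by rewrite leNgt; apply/negP => /kmin; rewrite ltnn.
Qed.

(** * A function of finite energy and positive mass *)

Lemma powR_le1 (R : realType) (a b : R) : 0 <= a -> a <= 1 -> 0 <= b -> a `^ b <= 1.
Proof.
move=> a0 a1 b0; apply: le_trans (_ : 1 `^ b <= 1); last by rewrite powR1.
by apply: ge0_ler_powR; rewrite ?nnegrE.
Qed.

Section test_function.
Context (R : realType) (n : nat) (Omega : set 'rV[R]_n) (s : R) (g G : R -> R).
Local Notation T := 'rV[R]_n.
Local Notation mu := (lebesgue_rV R n).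
Hypotheses (Yg : is_young g G) (oOmega : open Omega).
Hypothesis (n0 : (0 < n)%N) (s01 : (0 : R) < s < 1).

Let s0 : 0 < s. Proof. by case/andP: s01. Qed.
Let s1 : s < 1. Proof. by case/andP: s01. Qed.

Let half_powR k (a : R) : (2^-1 ^+ k) `^ a = (2^-1 `^ a) ^+ k.
Proof.
by rewrite -[in LHS]powR_mulrn// powRAC powR_mulrn// powR_ge0.
Qed.

(** Near the diagonal the Lipschitz bound gains a power [|x - y|^(1 - s)]; away from
    it the denominator of the quotient gains [|x - y|^(- s)]. On dyadic scales both
    gains are geometric, hence summable. *)
Lemma lipschitz_energy_le (C e D : R) : 0 <= C -> 0 < e ->
  `|D| <= C * e -> `|D| <= C ->
  exists k : nat,
    (e <= 2^-1 ^+ k /\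
     G `|D / e `^ s| / e ^+ n <=
       (4 ^+ n * G C * (2^-1 `^ (1 - s)) ^+ k) / (2 * 2^-1 ^+ k) ^+ n) \/
    (e <= 2 ^+ k.+1 /\
     G `|D / e `^ s| / e ^+ n <=
       (4 ^+ n * G C * (2^-1 `^ s) ^+ k) / (2 * 2 ^+ k.+1) ^+ n).
Proof.
move=> C0 e0 DCe DC.
have es0 : 0 < e `^ s by exact: powR_gt0.
have en0 : 0 < e ^+ n by rewrite exprn_gt0.
have GC : 0 <= G C by exact: (youngG_ge0 Yg).
have half0 : 0 < 2^-1 :> R by rewrite invr_gt0.
have [e1|/ltW e1] := leP e 1.
  have [k /andP[ke ek]] := dyadic_scale e0 e1; exists k; left; split => //.
  have p0 : 0 < 2^-1 ^+ k :> R by rewrite exprn_gt0.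
  have h1 : G `|D / e `^ s| <= e `^ (1 - s) * G C.
    apply: le_trans (young_scale Yg _ C0); last first.
      by rewrite powR_ge0 /= powR_le1 ?(ltW e0)// subr_ge0 ltW.
    apply: (young_mono Yg) => //; rewrite normrM normfV (gtr0_norm es0).
    rewrite ler_pdivrMr// mulrAC -powRD; last by rewrite subrK oner_eq0.
    by rewrite subrK powRr1 ?(ltW e0)// mulrC.
  have h2 : e `^ (1 - s) <= (2^-1 `^ (1 - s)) ^+ k.
    rewrite -half_powR; apply: ge0_ler_powR => //; rewrite ?nnegrE ?subr_ge0; exact: ltW.
  have h3 : (e ^+ n)^-1 <= 4 ^+ n / (2 * 2^-1 ^+ k) ^+ n.
    rewrite -expr_div_n -exprVn lerXn2r ?nnegrE ?invr_ge0 ?(ltW e0)//.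
    rewrite invf_ple ?posrE// ?divr_gt0 ?mulr_gt0// invf_div.
    apply: le_trans (ltW ke); rewrite exprS le_eqVlt; apply/predU1P; left.
    by field.
  apply: (@le_trans _ _ (((2^-1 `^ (1 - s)) ^+ k * G C) * (4 ^+ n / (2 * 2^-1 ^+ k) ^+ n))).
    apply: ler_pM => //.
    - exact: (youngG_ge0 Yg).
    - by rewrite invr_ge0 ltW.
    - by apply: le_trans h1 _; rewrite ler_wpM2r.
  by rewrite le_eqVlt; apply/predU1P; left; ring.
have e'0 : 0 < e^-1 by rewrite invr_gt0.
have e'1 : e^-1 <= 1 by rewrite invf_le1.
have [k /andP[ke ek]] := dyadic_scale e'0 e'1; exists k; right.
have p0 : 0 < 2 ^+ k :> R by rewrite exprn_gt0.
have ke' : 2 ^+ k <= e by rewrite -[e]invrK -lef_pV2 ?posrE ?invr_gt0// invrK -exprVn.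
split.
  rewrite -[leLHS]invrK -lef_pV2 ?posrE ?invr_gt0 ?exprn_gt0// invrK.
  by rewrite -exprVn ltW.
have h1 : G `|D / e `^ s| <= e^-1 `^ s * G C.
  apply: le_trans (young_scale Yg _ C0); last first.
    by rewrite powR_ge0 /=; apply: powR_le1 => //; exact: ltW.
  apply: (young_mono Yg) => //; rewrite normrM normfV (gtr0_norm es0) mulrC.
  have -> : e^-1 `^ s = (e `^ s)^-1 by rewrite -powR_inv1 ?(ltW e0)// powRAC powR_inv1// ltW.
  by rewrite ler_wpM2l// invr_ge0 ltW.
have h2 : e^-1 `^ s <= (2^-1 `^ s) ^+ k.
  have q0 : 0 < 2^-1 ^+ k :> R by rewrite exprn_gt0.
  by rewrite -half_powR; apply: ge0_ler_powR => //; rewrite ?nnegrE; exact: ltW.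
have h3 : (e ^+ n)^-1 <= 4 ^+ n / (2 * 2 ^+ k.+1) ^+ n.
  rewrite -expr_div_n -exprVn lerXn2r ?nnegrE ?invr_ge0 ?(ltW e0)//.
    rewrite invf_ple ?posrE// ?divr_gt0 ?mulr_gt0 ?exprn_gt0// invf_div.
  apply: le_trans ke'; rewrite exprS le_eqVlt; apply/predU1P; left.
  by field.
apply: (@le_trans _ _ (((2^-1 `^ s) ^+ k * G C) * (4 ^+ n / (2 * 2 ^+ k.+1) ^+ n))).
  apply: ler_pM => //.
  - exact: (youngG_ge0 Yg).
  - by rewrite invr_ge0 ltW.
  - by apply: le_trans h1 _; rewrite ler_wpM2r.
by rewrite le_eqVlt; apply/predU1P; left; ring.
Qed.

(** A tent [max 0 (r - |x - x0|_1)] supported in [Omega] is bounded and Lipschitz, so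
    [lipschitz_energy_le] dominates its energy density by two box series, one for
    short and one for long distances. *)
Lemma test_function : Omega !=set0 ->
  exists2 v : T -> R, W0_sG s G Omega v & (0 < mass Omega G v)%E.
Proof.
move=> [x0 Ox0].
have mOmega : measurable Omega by exact: open_measurable_rV.
have [r r0 Hr] : exists2 r : R, 0 < r & forall x : T, (forall i, `|x 0 i - x0 0 i| <= r) -> Omega x.
  have : nbhs x0 Omega by exact: open_nbhs_nbhs.
  rewrite -nbhs_ballE => -[e /= e0 eO]; exists (e / 2); first by rewrite divr_gt0.
  move=> x xr; apply: eO; split => // j i; rewrite (ord1 j) /ball /= distrC.
  by apply: le_lt_trans (xr i) _; rewrite ltr_pdivrMr// ltr_pMr// ltr1n.
pose l (x : T) : R := \sum_(i < n) `|x 0 i - x0 0 i|.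
pose v (x : T) : R := Num.max 0 (r - l x).
have n1 : (1 : R) <= n%:R by rewrite ler1n.
have nn0 : 0 < n%:R :> R by rewrite ltr0n.
have ml : measurable_fun setT l.
  apply: measurable_sum => i; apply: (measurableT_comp (@normr_measurable R setT)).
  by apply: measurable_funB => //; exact: measurable_coord_rV.
have mv : measurable_fun setT v.
  by apply: measurable_maxr => //; exact: measurable_funB.
have l0 x : 0 <= l x by exact: sumr_ge0.
have v0 x : 0 <= v x by rewrite le_max lexx.
have vr x : v x <= r by rewrite ge_max (ltW r0) gerBl l0.
pose B : set T := [set x | forall i, `[x0 0 i - r, x0 0 i + r]%classic (x 0 i)].
have BE x : B x <-> (forall i, `|x 0 i - x0 0 i| <= r).
  by split => h i; have := h i; rewrite /= in_itv /= ler_norml;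
    move=> /andP[? ?]; apply/andP; split; lra.
have mB : measurable B.
  apply: (@measurable_rV_box R n (fun i => `[x0 0 i - r, x0 0 i + r]%classic)) => i.
  exact: measurable_itv.
have muB : (mu B < +oo)%E.
  rewrite (@lebesgue_rV_box R n (fun i => `[x0 0 i - r, x0 0 i + r]%classic) (2 * r)) ?ltry// => i.
  rewrite lebesgue_measure_itv /= lte_fin ltrD2l gt0_cp// -EFinB.
  by congr (_%:E); ring.
have vB x : ~ B x -> v x = 0.
  move=> nB; apply/max_idPl; rewrite subr_le0 leNgt; apply/negP => lr.
  apply: nB; apply/BE => i; apply: le_trans (ltW lr).
  by rewrite /l (bigD1 i)//= lerDl sumr_ge0.
have BO : B `<=` Omega by move=> x /BE; exact: Hr.
have lip x y : `|v x - v y| <= n%:R * enorm (x - y).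
  apply: (@le_trans _ _ (\sum_(i < n) `|x 0 i - y 0 i|)); last first.
    apply: le_trans (ler_sum _ (fun i _ => _ : _ <= enorm (x - y))) _.
      by move=> i _; have := enorm_coord (x - y) i; rewrite !mxE.
    by rewrite sumr_const card_ord mulr_natl.
  have ll (a b : T) : l a <= l b + \sum_(i < n) `|a 0 i - b 0 i|.
    rewrite -big_split /=; apply: ler_sum => i _.
    have -> : a 0 i - x0 0 i = (b 0 i - x0 0 i) + (a 0 i - b 0 i) by ring.
    exact: ler_normD.
  have vle (a b : T) : v a <= v b + \sum_(i < n) `|a 0 i - b 0 i|.
    rewrite ge_max; apply/andP; split; first by rewrite addr_ge0// sumr_ge0.
    apply: (@le_trans _ _ (r - l b + \sum_(i < n) `|a 0 i - b 0 i|)).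
      have -> : \sum_(i < n) `|a 0 i - b 0 i| = \sum_(i < n) `|b 0 i - a 0 i|.
        by apply: eq_bigr => i _; rewrite distrC.
      by have := ll b a; lra.
    by rewrite lerD2r le_max lexx orbT.
  have h1 := vle x y; have h2 := vle y x.
  have e : \sum_(i < n) `|y 0 i - x 0 i| = \sum_(i < n) `|x 0 i - y 0 i|.
    by apply: eq_bigr => i _; rewrite distrC.
  by rewrite ler_norml; apply/andP; split; lra.
pose C := n%:R + r.
have C0 : 0 <= C by rewrite addr_ge0// ltW.
have K0 : 0 <= 4 ^+ n * G C by rewrite mulr_ge0// ?exprn_ge0// (youngG_ge0 Yg).
pose c1 k : R := 4 ^+ n * G C * (2^-1 `^ (1 - s)) ^+ k.
pose c2 k : R := 4 ^+ n * G C * (2^-1 `^ s) ^+ k.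
pose rho1 k : R := 2^-1 ^+ k.
pose rho2 k : R := 2 ^+ k.+1.
have c10 k : 0 <= c1 k by rewrite mulr_ge0// exprn_ge0// powR_ge0.
have c20 k : 0 <= c2 k by rewrite mulr_ge0// exprn_ge0// powR_ge0.
have r10 k : 0 < rho1 k by rewrite exprn_gt0// invr_gt0.
have r20 k : 0 < rho2 k by rewrite exprn_gt0.
have half1 (a : R) : 0 < a -> 0 < (2^-1 : R) `^ a < 1.
  move=> a0; rewrite powR_gt0 ?invr_gt0//=.
  apply: lt_le_trans (_ : 1 `^ a <= 1); last by rewrite powR1.
  by apply: gt0_ltr_powR; rewrite ?nnegrE ?invr_ge0// invf_lt1// ltr1n.
have c1fin : (\sum_(0 <= k <oo) (c1 k)%:E < +oo)%E.
  have /andP[? ?] := half1 (1 - s) ltac:(by rewrite subr_gt0).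
  exact: geometric_eseries_lty.
have c2fin : (\sum_(0 <= k <oo) (c2 k)%:E < +oo)%E.
  have /andP[? ?] := half1 s s0.
  exact: geometric_eseries_lty.
have energy_fin : (energy s G v < +oo)%E.
  pose I (z : T * T) : \bar R := (\1_B z.1 + \1_B z.2)%:E.
  have mi : measurable_fun setT (\1_B : T -> R) by exact: measurable_indic.
  have mI : measurable_fun setT I.
    apply/measurable_EFinP; apply: measurable_funD.
      exact: (measurableT_comp mi measurable_fst).
    exact: (measurableT_comp mi measurable_snd).
  have I0 z : (0 <= I z)%E by rewrite lee_fin addr_ge0.
  have m1 := @measurable_box_series R n c1 rho1 c10 r10.
  have m2 := @measurable_box_series R n c2 rho2 c20 r20.
  have p1 := @box_series_ge0 R n _ _ c10 r10.
  have p2 := @box_series_ge0 R n _ _ c20 r20.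
  apply: le_lt_trans (_ : (\int[mu \x mu]_z (I z * box_series c1 rho1 z) +
      \int[mu \x mu]_z (I z * box_series c2 rho2 z) < +oo)%E); last first.
    by apply: lte_add_pinfty; exact: box_series_lty.
  rewrite -ge0_integralD//; last 4 first.
  - by move=> z _; exact: mule_ge0.
  - exact: emeasurable_funM.
  - by move=> z _; exact: mule_ge0.
  - exact: emeasurable_funM.
  apply: ge0_le_integral => //.
  - by move=> z _; apply: (modular_integrand_ge0 Yg); exact: kern_ge0.
  - by apply: (measurable_modular Yg) => //; [exact: measurable_kern|exact: measurable_Ds].
  - by apply: emeasurable_funD; exact: emeasurable_funM.
  move=> [x y] _ /=.
  have pos : (0 <= I (x, y) * box_series c1 rho1 (x, y) +
      I (x, y) * box_series c2 rho2 (x, y))%E by rewrite adde_ge0// mule_ge0.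
  have [Bxy|nB] := pselect (B x \/ B y); last first.
    have [nx ny] : ~ B x /\ ~ B y by apply/not_orP.
    by rewrite /Ds /Dquot (vB _ nx) (vB _ ny) subrr mul0r normr0 (young_G0 Yg) mul0r.
  have I1 : (1 <= I (x, y))%E.
    rewrite lee_fin !indicE /=; case: Bxy => h.
      by rewrite (mem_set h) lerDl.
    by rewrite (mem_set h) lerDr.
  have [xy|xy] := eqVneq x y.
    have -> : Ds s v (x, y) = 0 by rewrite /Ds /Dquot /= xy subrr mul0r.
    by rewrite normr0 (young_G0 Yg) mul0r.
  have e0 := enorm_gt0 xy; set e := enorm (x - y) in e0.
  have [||k Hk] := @lipschitz_energy_le C e (v x - v y) C0 e0.
  - by apply: le_trans (lip x y) _; rewrite ler_wpM2r// ?(ltW e0)// lerDl ltW.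
  - apply: (@le_trans _ _ r); last by rewrite lerDr ltW.
    rewrite ler_norml; have := v0 x; have := v0 y; have := vr x; have := vr y.
    by move=> *; apply/andP; split; lra.
  have close (q : R) : e <= q -> @coord_close R n q (x, y).
    by move=> eq i /=; apply: le_trans eq; have := enorm_coord (x - y) i; rewrite !mxE.
  have mul1 (h : \bar R) : (0 <= h)%E -> (h <= I (x, y) * h)%E.
    by move=> h0; rewrite -[leLHS]mul1e lee_wpmul2r.
  case: Hk => -[ek Gk].
    apply: (@le_trans _ _ (box_series c1 rho1 (x, y))).
      by apply: (box_series_ge c10 r10 (k := k)) => //; exact: close.
    apply: le_trans (mul1 _ (p1 _)) _; rewrite leeDl// mule_ge0//.
  apply: (@le_trans _ _ (box_series c2 rho2 (x, y))).
    by apply: (box_series_ge c20 r20 (k := k)) => //; exact: close.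
  by apply: le_trans (mul1 _ (p2 _)) _; rewrite leeDr// mule_ge0.
have mGv : measurable_fun setT (fun x => (G `|v x|)%:E).
  by apply/measurable_EFinP; exact: (measurableT_comp (measurable_youngN Yg) mv).
have G0v x : (0 <= (G `|v x|)%:E)%E by rewrite lee_fin (youngG_ge0 Yg).
have mass_fin : (mass Omega G v < +oo)%E.
  rewrite massE; apply: le_lt_trans (_ : ((G r)%:E * mu B < +oo)%E); last first.
    by rewrite lte_mul_pinfty// lee_fin (youngG_ge0 Yg)// ltW.
  apply: (@le_trans _ _ (\int[mu]_x ((G r)%:E * (\1_B x)%:E))%E); last first.
    rewrite ge0_integralZl//; last by rewrite lee_fin (youngG_ge0 Yg)// ltW.
      by rewrite integral_indic// setIT.
    by apply/measurable_EFinP; exact: measurable_indic.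
  apply: le_trans (ge0_subset_integral mu mOmega measurableT mGv (fun x _ => G0v x) (@subsetT _ _)) _.
  apply: ge0_le_integral => //.
    by apply: measurable_funeM; apply/measurable_EFinP; exact: measurable_indic.
  move=> x _; rewrite -EFinM lee_fin indicE.
  have [Bx|nB] := pselect (B x).
    by rewrite mem_set// mulr1 ger0_norm//; exact: (young_mono Yg).
  by rewrite vB// normr0 (young_G0 Yg) mulr_ge0// (youngG_ge0 Yg)// ltW.
exists v.
  apply/(W0E s Yg mOmega); split => //.
  by apply: nearW => x nO; apply: vB => /BO.
pose r' := r / (2 * n%:R).
have r'0 : 0 < r' by rewrite divr_gt0// mulr_gt0.
pose A : set T := [set x | forall i, `[x0 0 i - r', x0 0 i + r']%classic (x 0 i)].
have mA : measurable A.
  apply: (@measurable_rV_box R n (fun i => `[x0 0 i - r', x0 0 i + r']%classic)) => i.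
  exact: measurable_itv.
have muA : mu A = ((2 * r') ^+ n)%:E.
  apply: (@lebesgue_rV_box R n (fun i => `[x0 0 i - r', x0 0 i + r']%classic)) => i //.
  rewrite lebesgue_measure_itv /= lte_fin ltrD2l gt0_cp// -EFinB.
  by congr (_%:E); ring.
have Av x : A x -> r / 2 <= v x.
  move=> Ax; rewrite le_max; apply/orP; right.
  suff : l x <= r / 2 by lra.
  have xr i : `|x 0 i - x0 0 i| <= r'.
    have := Ax i; rewrite /= in_itv /= ler_norml => /andP[? ?].
    by apply/andP; split; lra.
  apply: le_trans (ler_sum _ (fun i _ => xr i)) _.
  rewrite sumr_const card_ord -mulr_natr /r' le_eqVlt; apply/predU1P; left.
  by field; rewrite gt_eqF.
have r2 : 0 < r / 2 by rewrite divr_gt0.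
have AO : A `<=` Omega.
  move=> x /Av h; apply: BO; apply: contrapT => /vB v_0; move: h.
  by rewrite v_0 leNgt r2.
apply: (@lt_le_trans _ _ ((G (r / 2))%:E * mu A)%E).
  by rewrite muA -EFinM lte_fin mulr_gt0 ?(youngG_gt0 Yg)// exprn_gt0// mulr_gt0.
rewrite massE -integral_cst//.
apply: (@le_trans _ _ (\int[mu]_(x in A) (G `|v x|)%:E)%E).
  apply: ge0_le_integral => //.
  - by move=> x _; rewrite lee_fin (youngG_ge0 Yg)// ltW.
  - exact: (measurable_funS measurableT).
  - move=> x Ax; rewrite lee_fin ger0_norm//; apply: (young_mono Yg); first exact: ltW.
    exact: Av.
apply: ge0_subset_integral => //.
exact: (measurable_funS measurableT).
Qed.

End test_function.

(** * Constrained minimisation and the multiplier *)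

(** The point sought is the supremum of the [t] with [psi t <= mu]. The estimate for
    dilations by [1 + e] stands for continuity: [psi] cannot cross a gap around [mu]
    under an arbitrarily small dilation. *)
Lemma dilation_ivt (R : realType) (psi : R -> R) (K mu : R) : (1 : R) <= K -> 0 < mu ->
  0 < psi 1 ->
  (forall a b, 0 <= a -> a <= b -> psi a <= psi b) ->
  (forall a, 0 <= a -> a <= 1 -> psi a <= a * psi 1) ->
  (forall a, 1 <= a -> a * psi 1 <= psi a) ->
  (forall a e, 0 <= a -> 0 <= e <= 1 -> psi ((1 + e) * a) <= (1 + e * K) * psi a) ->
  exists2 t : R, 0 < t & psi t = mu.
Proof.
move=> K1 mu0 psi1 mono small big dil.
have K0 : 0 < K by exact: lt_le_trans K1.
pose S : set R := [set t | 0 <= t /\ psi t <= mu].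
have S1 : S (Num.min 1 (mu / psi 1)).
  have m0 : 0 <= Num.min 1 (mu / psi 1) by rewrite le_min ler01 divr_ge0 ?ltW.
  split => //; apply: (le_trans (small _ m0 _)); first by rewrite ge_min lexx.
  by rewrite -ler_pdivlMr// ge_min lexx orbT.
have ubS : ubound S (Num.max 1 (mu / psi 1)).
  move=> t [t0 tmu]; rewrite le_max; have [//|/ltW t1 /=] := leP t 1.
  by rewrite ler_pdivlMr//; apply: le_trans tmu; exact: big.
have supS : has_sup S by split; [exists (Num.min 1 (mu / psi 1))|exists (Num.max 1 (mu / psi 1))].
pose t := sup S.
have t0 : 0 < t.
  apply: lt_le_trans (_ : Num.min 1 (mu / psi 1) <= t); last exact: ub_le_sup supS.2 _ S1.
  by rewrite lt_min ltr01 divr_gt0.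
have psit0 : 0 <= psi t.
  have t10 : 0 <= Num.min t 1 by rewrite le_min (ltW t0) ler01.
  have := mono 0 t (lexx 0) (ltW t0).
  have := dil 0 1 (lexx 0) ltac:(by rewrite ler01 lexx).
  rewrite mulr0; nra.
exists t => //; apply/eqP; rewrite eq_le; apply/andP; split; rewrite leNgt; apply/negP => lt.
  pose e := Num.min 1 ((psi t - mu) / (K * mu + 1)).
  have Kmu : 0 < K * mu + 1 by rewrite addr_gt0// mulr_gt0.
  have e0 : 0 < e by rewrite lt_min ltr01 divr_gt0// subr_gt0.
  have e1 : e <= 1 by rewrite ge_min lexx.
  have eK : e * (K * mu + 1) <= psi t - mu by rewrite -ler_pdivlMr// ge_min lexx orbT.
  pose r := t / (1 + e).
  have e10 : 0 < 1 + e by rewrite addr_gt0.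
  have r0 : 0 <= r by rewrite divr_ge0 ?ltW.
  have rt : r < t by rewrite ltr_pdivrMr// mulrDr mulr1 ltrDl mulr_gt0.
  have [w [w0 wmu] rw] : exists2 w, S w & r < w.
    have tr : 0 < t - r by rewrite subr_gt0.
    by have [w Sw] := sup_adherent tr supS; rewrite opprB addrC subrK => ?; exists w.
  have := dil r e r0 ltac:(by rewrite ltW).
  have -> : (1 + e) * r = t by rewrite /r mulrC divfK// gt_eqF.
  have pr : psi r <= mu by apply: le_trans wmu; apply: mono => //; exact: ltW.
  have : (1 + e * K) * psi r <= (1 + e * K) * mu.
    by rewrite ler_wpM2l// addr_ge0// mulr_ge0// ltW.
  move=> h1 h2; have := le_trans h2 h1; rewrite leNgt => /negP; apply.
  by move: eK e0; lra.
pose e := Num.min 1 ((mu - psi t) / (K * psi t + 1)).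
have Kpsi : 0 < K * psi t + 1 by rewrite ltr_wpDl// mulr_ge0// ltW.
have e0 : 0 < e by rewrite lt_min ltr01 divr_gt0// subr_gt0.
have e1 : e <= 1 by rewrite ge_min lexx.
have eK : e * (K * psi t + 1) <= mu - psi t by rewrite -ler_pdivlMr// ge_min lexx orbT.
have : S ((1 + e) * t).
  split; first by rewrite mulr_ge0 ?ltW// addr_gt0.
  apply: le_trans (dil t e (ltW t0) ltac:(by rewrite ltW)) _.
  by move: eK e0; lra.
move=> /(ub_le_sup supS.2); rewrite -/t leNgt => /negP; apply.
by rewrite mulrDl mul1r ltrDl mulr_gt0.
Qed.

(** If [l1 w = 0], subtracting a small multiple of [u] from [w] makes [l1] negative, so
    [l2 w <= 0]. The same holds for [- w]: the kernel of [l1] is contained in that of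
    [l2]. *)
Lemma proportional_forms (R : realFieldType) (T : Type) (V : (T -> R) -> Prop)
    (l1 l2 : (T -> R) -> R) (u : T -> R) :
  (forall c v w, V v -> V w -> V (fun x => v x + c * w x)) ->
  (forall c v w, V v -> V w -> l1 (fun x => v x + c * w x) = l1 v + c * l1 w) ->
  (forall c v w, V v -> V w -> l2 (fun x => v x + c * w x) = l2 v + c * l2 w) ->
  V u -> 0 < l1 u -> (forall w, V w -> l1 w < 0 -> l2 w <= 0) ->
  forall v, V v -> l1 u * l2 v = l1 v * l2 u.
Proof.
move=> VD l1D l2D Vu u0 H.
have H0 w : V w -> l1 w = 0 -> l2 w <= 0.
  move=> Vw w0; rewrite leNgt; apply/negP => w2.
  pose e := l2 w / (`|l2 u| + 1) / 2.
  have D0 : 0 < `|l2 u| + 1 by rewrite ltr_wpDl.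
  have e0 : 0 < e by rewrite !divr_gt0.
  have := H _ (VD (- e) _ _ Vw Vu).
  rewrite l1D// l2D// w0 add0r mulNr oppr_lt0 mulr_gt0// => /(_ isT).
  rewrite mulNr subr_le0 leNgt => /negP; apply.
  apply: (@le_lt_trans _ _ (e * (`|l2 u| + 1))).
    by rewrite ler_pM2l// (le_trans (ler_norm _))// lerDl.
  by rewrite /e mulrAC divfK ?gt_eqF// ltr_pdivrMr// ltr_pMr// ltr1n.
move=> v Vv.
pose w : T -> R := fun x => v x + - (l1 v / l1 u) * u x.
have Vw : V w by exact: VD.
have w0 : l1 w = 0 by rewrite /w l1D// mulNr divfK ?subrr// gt_eqF.
have w2 : l2 w = 0.
  apply/eqP; rewrite eq_le H0//=.
  (* [w - 2 w] is [- w], built with the closure property of [V] *)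
  have := H0 _ (VD (- 2) _ _ Vw Vw); rewrite l1D// l2D// w0 mulr0 addr0 => /(_ erefl).
  by rewrite mulNr mulr_natl mulr2n opprD addrA subrr add0r oppr_le0.
move: w2; rewrite /w l2D// mulNr => /eqP; rewrite subr_eq0 => /eqP ->.
by field; rewrite gt_eqF.
Qed.

Lemma product_ae d (T : measurableType d) (R : realType)
    (mu : {sigma_finite_measure set T -> \bar R}) (P : T -> Prop) :
  {ae mu, forall x, P x} ->
  {ae (mu \x mu)%E, forall z, P z.1 /\ P z.2}.
Proof.
move=> [N [mN N0 PN]].
have nT : (mu \x mu)%E (N `*` setT) = 0%E.
  apply: (etrans (product_measure1E _ _ mN measurableT)).
  by rewrite [X in (X * _)%E]N0 mul0e.
have Tn : (mu \x mu)%E (setT `*` N) = 0%E.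
  apply: (etrans (product_measure1E _ _ measurableT mN)).
  by rewrite [X in (_ * X)%E]N0 mule0.
apply: (@negligibleS _ _ _ _ ((N `*` setT) `|` (setT `*` N))).
  move=> z /= /not_andP[h|h]; [left|right]; split => //; exact: PN.
apply: negligibleU.
  by exists (N `*` setT); split => //; exact: measurableX.
by exists (setT `*` N); split => //; exact: measurableX.
Qed.

Section eigenproblem.
Context (R : realType) (n : nat) (Omega : set 'rV[R]_n) (s : R) (g G : R -> R).
Local Notation T := 'rV[R]_n.
Local Notation mu := (lebesgue_rV R n).
Hypotheses (Yg : is_young g G) (oOmega : open Omega) (Omega0 : Omega !=set0).
Hypothesis (n0 : (0 < n)%N) (s01 : (0 : R) < s < 1).
Variables (p K M cP : R).
Hypothesis gGp : forall t : R, 0 < t -> t * g t / G t <= p.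
Hypothesis p0 : 0 < p.
Hypothesis K1 : (1 : R) <= K.
Hypothesis GK : forall t : R, 0 <= t -> G (2 * t) <= K * G t.
Hypothesis M0 : 0 < M.
Hypothesis OM : forall x, Omega x -> forall i, `|x 0 i| <= M.
Hypothesis cP0 : 0 < cP.
Hypothesis cPP : forall u : T -> R, measurable_fun setT u ->
    {ae mu, forall x, ~ Omega x -> u x = 0} ->
    (cP%:E * mass Omega G u <= energy s G u)%E.

Local Notation W u := (W0_sG s G Omega u).
Local Notation Psi u := (mass Omega G u).
Local Notation Phi u := (energy s G u).

Let mOmega : measurable Omega. Proof. exact: open_measurable_rV. Qed.
Let WE u := W0E s Yg mOmega u.
Let m1 : measurable_fun [set: T] (fun=> (1 : R)). Proof. exact: measurable_cst. Qed.
Let k1 : forall x : T, (0 : R) <= 1. Proof. by move=> _; exact: ler01. Qed.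
Let mk := @measurable_kern R n.
Let kk := @kern_ge0 R n.
Let K0 : 0 < K. Proof. exact: lt_le_trans ltr01 K1. Qed.

Let Wm u : W u -> measurable_fun setT u. Proof. by case/WE. Qed.
Let WPsi u : W u -> (Psi u < +oo)%E. Proof. by case/WE. Qed.
Let WPhi u : W u -> (Phi u < +oo)%E. Proof. by case/WE. Qed.
Let Wae u : W u -> {ae mu, forall x, ~ Omega x -> u x = 0}. Proof. by case/WE. Qed.
Let WD u v : W u -> W v -> W (fun x => u x + v x).
Proof. exact: (W0_add Yg mOmega K1 GK). Qed.
Let WZ c u : W u -> W (fun x => c * u x).
Proof. exact: (W0_scale Yg mOmega K1 GK). Qed.

Let Psi0 (u : T -> R) : (0 <= Psi u)%E.
Proof. exact: (modular_ge0 Yg mu Omega k1 u). Qed.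
Let Phi0 (u : T -> R) : (0 <= Phi u)%E.
Proof. exact: (modular_ge0 Yg (mu \x mu)%E setT kk (Ds s u)). Qed.
Let Psifin u : W u -> Psi u \is a fin_num.
Proof. by move=> /WPsi ?; rewrite ge0_fin_numE. Qed.
Let Phifin u : W u -> Phi u \is a fin_num.
Proof. by move=> /WPhi ?; rewrite ge0_fin_numE. Qed.

Lemma mass_attains (u : T -> R) (m : R) : W u -> (0 < Psi u)%E -> 0 < m ->
  exists2 t : R, 0 < t & Psi (fun x => t * u x) = m%:E.
Proof.
move=> Wu Pu m0.
have mu_ := Wm Wu.
have psiE t : Psi (fun x => t * u x) = (fine (Psi (fun x => t * u x)))%:E.
  by rewrite fineK//; apply: Psifin; exact: WZ.
have u1 : (fun x => 1 * u x) = u by apply/funext => x; rewrite mul1r.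
pose psi t := fine (Psi (fun x => t * u x)).
have [|||||t t0 tm] := @dilation_ivt R psi K m K1 m0.
- by rewrite -lte_fin /psi -psiE u1.
- move=> a b a0 ab; rewrite -lee_fin /psi -!psiE; apply: (modular_mono Yg) => //.
  + exact: measurable_funM.
  + exact: measurable_funM.
  + by move=> x _; rewrite !normrM ler_wpM2r// !ger0_norm// (le_trans a0).
- move=> a a0 a1; rewrite -lee_fin /psi EFinM -!psiE u1.
  by apply: (modular_scale Yg) => //; rewrite a0.
- move=> a a1; rewrite -lee_fin /psi EFinM -!psiE u1.
  exact: (modular_scale_ge Yg).
- move=> a e a0 e01; rewrite -lee_fin /psi EFinM -!psiE.
  have -> : (fun x => (1 + e) * a * u x) = (fun x => (1 + e) * (a * u x)).
    by apply/funext => x; rewrite mulrA.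
  by apply: (modular_dilate Yg) => //; exact: measurable_funM.
by exists t => //; rewrite psiE -/(psi t) tm.
Qed.

(** The direct method. The limit of a minimising sequence has energy at most the
    infimum and mass at most [m], by Fatou's lemma. No mass is lost: by
    [modular_add_small], the mass [m] of a term of the sequence is at most a factor
    close to 1 times that of [v], plus a multiple of the modular of the difference. *)
Lemma minimizer (m : R) : 0 < m ->
  exists u, [/\ W u, Psi u = m%:E & forall v, W v -> Psi v = m%:E -> (Phi u <= Phi v)%E].
Proof.
move=> m0.
pose A : set R := [set a | exists v, [/\ W v, Psi v = m%:E & Phi v = a%:E]].
have A0 : A !=set0.
  have [v Wv Pv] := test_function Yg oOmega n0 s01 Omega0.
  have [t t0 tm] := mass_attains Wv Pv m0.
  exists (fine (Phi (fun x => t * v x))), (fun x => t * v x).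
  by split => //; [exact: WZ|rewrite fineK//; apply: Phifin; exact: WZ].
have lA : has_lbound A.
  by exists 0 => a [v [_ _ va]]; rewrite -lee_fin -va.
pose c := inf A.
have c0 : 0 <= c.
  by apply: lb_le_inf => // a [v [_ _ va]]; rewrite -lee_fin -va.
have exu k : exists u, [/\ W u, Psi u = m%:E & (Phi u <= (c + k.+1%:R^-1)%:E)%E].
  have k0 : 0 < k.+1%:R^-1 :> R by rewrite invr_gt0.
  have [a [v [Wv Pv va]] ac] := inf_adherent k0 (conj A0 lA).
  by exists v; split => //; rewrite va lee_fin ltW.
have [u_ Hu] := choice exu.
have Wu k : W (u_ k) by have [] := Hu k.
have Pu k : Psi (u_ k) = m%:E by have [] := Hu k.
have Fu k : (Phi (u_ k) <= (c + k.+1%:R^-1)%:E)%E by have [] := Hu k.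
have mu_ k := Wm (Wu k).
have C0 : 0 <= m + c + 1 by rewrite !addr_ge0// ltW.
have PC k : (modular G mu setT (fun=> 1%R) (u_ k) <= (m + c + 1)%:E)%E.
  rewrite (modular_supp Yg mOmega (mu_ k) (Wae (Wu k))) Pu lee_fin -addrA lerDl.
  by rewrite addr_ge0.
have FC k : (Phi (u_ k) <= (m + c + 1)%:E)%E.
  apply: le_trans (Fu k) _; rewrite lee_fin -addrA ler_wpDl ?(ltW m0)// lerD2l.
  by rewrite invf_le1// ler1n.
have [phi [v [phij mv cv Pv]]] :=
  modular_compactness Yg mOmega s01 K1 GK n0 M0 OM mu_ C0 PC FC (fun k => Wae (Wu k)).
have v0 : {ae mu, forall x, ~ Omega x -> v x = 0}.
  have z : {ae mu, forall x, forall k, ~ Omega x -> u_ k x = 0}.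
    by apply: ae_foralln => k; exact: Wae.
  apply: filterS2 cv z => x cvx zx nx.
  apply: (cvg_unique _ cvx) => //.
  rewrite (_ : (fun j => _) = fun=> 0); first exact: cvg_cst.
  by apply/funext => j; rewrite zx.
have Phiv : (Phi v <= c%:E)%E.
  apply/lee_addgt0Pr => e e0; rewrite -EFinD.
  apply: (@modular_fatou R g G Yg _ _ (mu \x mu)%E setT (@kern R n) measurableT mk kk
    (fun j => Ds s (u_ (phi j)))).
  - by move=> j; exact: measurable_Ds.
  - exact: measurable_Ds.
  - apply: filterS (product_ae cv) => z [z1 z2] _.
    by rewrite /Ds /Dquot; apply: cvgMl; exact: cvgB.
  - have : \forall j \near \oo, j.+1%:R^-1 < e.
      by have /cvgr_lt := @cvg_harmonic R; apply.
    apply: filterS => j je; apply: le_trans (Fu _) _; rewrite lee_fin lerD2l.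
    apply: le_trans (ltW je); rewrite lef_pV2 ?posrE ?ltr0n// ler_nat ltnS.
    exact: phij.
have Psivm : (Psi v <= m%:E)%E.
  apply: (@modular_fatou R g G Yg _ _ mu Omega (fun=> 1) mOmega m1 k1
    (fun j => u_ (phi j))) => //.
  - by apply: filterS cv => x cx _.
  - by apply: nearW => j; rewrite -/(Psi (u_ (phi j))) Pu.
have Wv : W v.
  apply/WE; split => //.
    exact: le_lt_trans Psivm (ltry _).
  exact: le_lt_trans Phiv (ltry _).
have mPsiv : (m%:E <= Psi v)%E.
  pose a := fine (Psi v); have aE : Psi v = a%:E by rewrite fineK//; exact: Psifin.
  have a0 : 0 <= a by rewrite -lee_fin -aE.
  rewrite aE lee_fin; apply/ler_addgt0Pr => d d0.
  (* the dilation costs [e K a <= d] *)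
  pose e := Num.min 1 (d / (K * a + 1)).
  have Ka : 0 < K * a + 1 by rewrite ltr_wpDl// mulr_ge0// ltW.
  have e0 : 0 < e by rewrite lt_min ltr01 divr_gt0.
  have e1 : e <= 1 by rewrite ge_min lexx.
  have eKa : e * (K * a) <= d.
    apply: (@le_trans _ _ (e * (K * a + 1))); first by rewrite ler_wpM2l ?(ltW e0)// lerDl.
    by rewrite -ler_pdivlMr// ge_min lexx orbT.
  have [B B0 HB] := modular_add_small Yg mu mOmega m1 k1 K1 GK e0 e1.
  apply: (@le_trans _ _ ((1 + e * K) * a)); last first.
    by rewrite mulrDl mul1r lerD2l -mulrA.
  apply/ler_addgt0Pr => d' d'0.
  have [N _ HN] := Pv (d' / B) (divr_gt0 d'0 B0).
  have := HN N (leqnn N) => /= HN'.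
  rewrite -lee_fin -(Pu (phi N)).
  have -> : u_ (phi N) = (fun x => v x + (u_ (phi N) x - v x)).
    by apply/funext => x; ring.
  apply: le_trans (HB v (fun x => u_ (phi N) x - v x) mv _) _.
    exact: measurable_funB.
  apply: (@le_trans _ _ (((1 + e * K) * a)%:E + (d' : R)%:E)%E); last by rewrite -EFinD.
  apply: leeD; first by rewrite -/(Psi v) aE -EFinM.
  apply: (@le_trans _ _ (B%:E * (d' / B)%:E)%E).
    by rewrite lee_pmul2l// lte_fin.
  by rewrite -EFinM mulrC divfK// gt_eqF.
exists v; split => //; first by apply/eqP; rewrite eq_le Psivm.
move=> w Ww Pw; apply: (le_trans Phiv).
have -> : Phi w = (fine (Phi w))%:E by rewrite fineK//; exact: Phifin.
rewrite lee_fin; apply: ge_inf => //; exists w; split => //.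
by rewrite fineK//; exact: Phifin.
Qed.

Lemma nonneg_minimizer (m : R) : 0 < m ->
  exists u, [/\ W u, Psi u = m%:E, forall x, 0 <= u x &
     forall v, W v -> Psi v = m%:E -> (Phi u <= Phi v)%E].
Proof.
move=> m0; have [u [Wu Pu Hu]] := minimizer m0.
have Pa : (Phi (fun x => `|u x|%R) <= Phi u)%E by apply: (energy_abs s Yg); exact: Wm.
exists (fun x => `|u x|); split => //.
- apply/WE; split.
  + exact: (measurableT_comp (@normr_measurable R setT) (Wm Wu)).
  + by rewrite mass_abs; exact: WPsi.
  + exact: le_lt_trans Pa (WPhi Wu).
  + by apply: filterS (Wae Wu) => x ux nx; rewrite ux// normr0.
- by rewrite mass_abs.
- by move=> v Wv Pv; apply: (le_trans Pa); exact: Hu.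
Qed.

(** Otherwise some multiple [t w] with [t < 1] has mass [m], and by convexity
    [Phi (t w) <= t Phi w < Phi u]. Thus a minimum of a convex function under a convex
    constraint becomes a maximum of a convex function, at which any subgradient of the
    mass can be used. *)
Lemma minimizer_maximizes (m : R) (u w : T -> R) : 0 < m -> W u -> Psi u = m%:E ->
  (forall v, W v -> Psi v = m%:E -> (Phi u <= Phi v)%E) ->
  W w -> (Phi w <= Phi u)%E -> (Psi w <= m%:E)%E.
Proof.
move=> m0 Wu Pu Hu Ww Fw; rewrite leNgt; apply/negP => mw.
have Pw0 : (0 < Psi w)%E by apply: lt_trans mw; rewrite lte_fin.
have [t t0 tm] := mass_attains Ww Pw0 m0.
have t1 : t < 1.
  rewrite ltNge; apply/negP => t1.
  have := modular_scale_ge Yg mu mOmega m1 k1 t1 (Wm Ww).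
  rewrite -/(Psi (fun x => t * w x)) tm leNgt => /negP; apply.
  apply: (lt_le_trans mw); rewrite -[leLHS]mul1e lee_wpmul2r// lee_fin.
have Fu : ((cP * m)%:E <= Phi u)%E.
  by have := cPP (Wm Wu) (Wae Wu); rewrite Pu -EFinM.
have := Hu _ (WZ t Ww) tm; rewrite leNgt => /negP; apply.
have [mw_ f] := (Wm Ww, fineK (Phifin Wu)).
apply: (@le_lt_trans _ _ (t%:E * Phi u)%E).
  apply: (@le_trans _ _ (t%:E * Phi w)%E); last by rewrite lee_wpmul2l// lee_fin ltW.
  rewrite [X in (X <= _)%E]/energy DsZ; apply: (modular_scale Yg) => //; last exact: measurable_Ds.
  by rewrite (ltW t0) (ltW t1).
rewrite -f -EFinM lte_fin gtr_pMl// -lte_fin f.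
by apply: lt_le_trans Fu; rewrite lte_fin mulr_gt0.
Qed.

Local Notation L1 u w := (pairing g (mu \x mu)%E setT (@kern R n) (Ds s u) (Ds s w)).
Local Notation L2 u w := (pairing g mu Omega (fun=> 1) u w).

Let mDs (u : T -> R) : W u -> measurable_fun setT (Ds s u).
Proof. by move=> /Wm; exact: measurable_Ds. Qed.

Let L1fin (u w : T -> R) : W u -> W w -> L1 u w \is a fin_num.
Proof.
move=> Wu Ww; apply: (pairing_fin_num Yg measurableT mk kk K1 GK gGp (ltW p0)).
- exact: mDs.
- exact: mDs.
- exact: WPhi.
- exact: WPhi.
Qed.

Let L2fin (u w : T -> R) : W u -> W w -> L2 u w \is a fin_num.
Proof.
move=> Wu Ww; apply: (pairing_fin_num Yg mOmega m1 k1 K1 GK gGp (ltW p0)).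
- exact: Wm.
- exact: Wm.
- exact: WPsi.
- exact: WPsi.
Qed.

(** A small step along [w] decreases the energy, so by [minimizer_maximizes] it does
    not increase the mass, and the subgradient inequality of the mass bounds the first
    variation. Differentiability is used for the energy only. *)
Lemma energy_descent (m : R) (u w : T -> R) : 0 < m -> W u -> Psi u = m%:E ->
  (forall v, W v -> Psi v = m%:E -> (Phi u <= Phi v)%E) ->
  W w -> (L1 u w < 0)%E -> (L2 u w <= 0)%E.
Proof.
move=> m0 Wu Pu Hu Ww Lw.
have ac : {ae (mu \x mu)%E, forall z, setT z -> {for Ds s u z, continuous (sg g)}}.
  by apply: filterS (ae_sg_continuous_Dquot Yg n0 s01 (Wm Wu)) => z hz _.
have [e e0 he] := modular_decrease Yg measurableT mk kk K1 GK gGp (ltW p0)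
  (mDs Wu) (mDs Ww) (WPhi Wu) (WPhi Ww) ac Lw.
have We : W (fun x => u x + e * w x) by apply: WD => //; exact: WZ.
have Pe : (Psi (fun x => (u x + e * w x)%R) <= m%:E)%E.
  apply: (minimizer_maximizes m0 Wu Pu Hu We).
  by rewrite [X in (X <= _)%E]/energy DsD DsZ.
have := modular_subgradient Yg mOmega m1 k1 K1 GK gGp (ltW p0)
  (Wm Wu) (Wm We) (WPsi Wu) (WPsi We).
rewrite (_ : (fun x => _ - u x) = (fun x => 0 * u x + e * w x)); last first.
  by apply/funext => x; ring.
rewrite (pairing_linear Yg mOmega m1 k1 K1 GK gGp (ltW p0) e (Wm Wu)
  (Wm (WZ 0 Wu)) (Wm Ww) (WPsi Wu) (WPsi (WZ 0 Wu)) (WPsi Ww)).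
have -> : L2 u (fun x => 0 * u x) = 0%E.
  by rewrite /pairing; apply: integral0_eq => x _; rewrite mul0r mulr0 mul0r.
rewrite add0e -[L2 u w]fineK ?L2fin// -/(Psi u) Pu -EFinM -EFinD => h.
have := le_trans h Pe; rewrite !lee_fin gerDl.
by rewrite pmulr_rle0.
Qed.

(** [proportional_forms] gives the multiplier [L1 u / L2 u], where
    [L1 u >= Phi u >= cP m] and [L2 u <= p m]; the mass [m] cancels in the bound. *)
Lemma minimizer_eigenpair (m : R) (u : T -> R) : 0 < m -> W u -> Psi u = m%:E ->
  (forall v, W v -> Psi v = m%:E -> (Phi u <= Phi v)%E) ->
  exists2 lam : R, cP / p <= lam & is_eigenpair s g G Omega lam u.
Proof.
move=> m0 Wu Pu Hu.
have /andP[L1l _] := pairing_bounds Yg measurableT mk kk K1 GK gGp (ltW p0)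
  (mDs Wu) (WPhi Wu).
have /andP[L2l L2u] := pairing_bounds Yg mOmega m1 k1 K1 GK gGp (ltW p0)
  (Wm Wu) (WPsi Wu).
pose l1 w := fine (L1 u w); pose l2 w := fine (L2 u w).
have l1E w : W w -> L1 u w = (l1 w)%:E by move=> Ww; rewrite fineK// L1fin.
have l2E w : W w -> L2 u w = (l2 w)%:E by move=> Ww; rewrite fineK// L2fin.
have l1m : cP * m <= l1 u.
  rewrite -lee_fin -l1E//; apply: le_trans L1l.
  by have := cPP (Wm Wu) (Wae Wu); rewrite Pu -EFinM.
have l2m : m <= l2 u by rewrite -lee_fin -l2E// -Pu.
have l2p : l2 u <= p * m by rewrite -lee_fin -l2E// EFinM -Pu.
have l1u : 0 < l1 u by apply: lt_le_trans l1m; rewrite mulr_gt0.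
have l2u : 0 < l2 u by exact: lt_le_trans l2m.
exists (l1 u / l2 u).
  by rewrite ler_pdivlMr// mulrAC ler_pdivrMr// (le_trans _ (ler_wpM2r (ltW p0) l1m))//
    -mulrA ler_wpM2l ?(ltW cP0)// mulrC.
split => //.
  move=> u0; have : Psi u = 0%E.
    transitivity (\int[mu]_(x in Omega) (cst 0%E x : \bar R))%E; last exact: integral0.
    apply: ae_eq_integral => //.
      exact: (measurable_funTS (measurable_modular Yg m1 (Wm Wu))).
    by apply: filterS u0 => x ux _; rewrite ux normr0 (young_G0 Yg) mul0r.
  by rewrite Pu => -[] /eqP; rewrite gt_eqF.
move=> v Wv; rewrite frac_glapE.
have -> : (\int[mu]_(x in Omega) (sg g (u x) * v x)%:E = L2 u v)%E.
  by apply: eq_integral => x _; rewrite mulr1.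
rewrite l1E// l2E// -EFinM; congr EFin.
have l2u0 : l2 u != 0 by rewrite gt_eqF.
apply: (mulIf l2u0); rewrite mulrAC divfK//; apply: esym.
apply: (@proportional_forms R T (fun w => W w) l1 l2 u) => //.
- by move=> c a b Wa Wb; apply: WD => //; exact: WZ.
- move=> c a b Wa Wb; apply: EFin_inj.
  rewrite EFinD EFinM -!l1E//; last by apply: WD => //; exact: WZ.
  rewrite DsD DsZ.
  by apply: (pairing_linear Yg measurableT mk kk K1 GK gGp (ltW p0) c); do ?[exact: mDs|exact: WPhi].
- move=> c a b Wa Wb; apply: EFin_inj.
  rewrite EFinD EFinM -!l2E//; last by apply: WD => //; exact: WZ.
  by apply: (pairing_linear Yg mOmega m1 k1 K1 GK gGp (ltW p0) c); do ?[exact: Wm|exact: WPsi].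
- move=> w Ww; rewrite -lte_fin -lee_fin -l1E// -l2E//.
  exact: (energy_descent m0 Wu Pu Hu Ww).
Qed.

End eigenproblem.

Unset Implicit Arguments.

Theorem theorem4p2 (R : realType) (n : nat) (Omega : set 'rV[R]_n) (s : R)
    (g G : R -> R) (pminus pplus : R) :
  (0 < n)%N ->
  open Omega -> bounded_set Omega -> Omega !=set0 ->
  0 < s < 1 ->
  is_young g G ->
  1 < pminus ->
  (forall t : R, 0 < t -> pminus <= t * g t / G t <= pplus) ->
  exists (lambda1 : R -> R) (u1 : R -> 'rV[R]_n -> R),
    (forall mu : R, 0 < mu ->
      [/\ 0 < lambda1 mu,
          is_eigenpair s g G Omega (lambda1 mu) (u1 mu),
          (forall x : 'rV[R]_n, 0 <= u1 mu x) &
          (\int[lebesgue_rV R n]_(x in Omega) (G `|u1 mu x|)%:E = mu%:E)%E]) /\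
    (exists2 c : R, 0 < c & forall mu : R, 0 < mu -> c <= lambda1 mu).
Proof.
move=> n0 oOmega bOmega Omega0 s01 Yg pm1 Hp.
have gGp t : 0 < t -> t * g t / G t <= pplus by move=> /Hp /andP[].
have p0 : 0 < pplus.
  by have /andP[h1 h2] := Hp 1 ltr01; apply: lt_le_trans (le_trans h1 h2); exact: lt_trans pm1.
have [M M0 OM] := bounded_box bOmega.
have [K K1 GK] := young_delta2 Yg gGp.
have [cP cP0 cPP] := poincare Yg (open_measurable_rV oOmega) K1 GK n0 s01 M0 OM.
have c0 : 0 < cP / pplus by exact: divr_gt0.
have H (m : R) : exists lu : R * ('rV[R]_n -> R), 0 < m ->
    [/\ cP / pplus <= lu.1, is_eigenpair s g G Omega lu.1 lu.2,
        (forall x : 'rV[R]_n, 0 <= lu.2 x) &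
        (\int[lebesgue_rV R n]_(x in Omega) (G `|lu.2 x|)%:E = m%:E)%E].
  have [m0|m0] := ltP 0 m; last by exists (0, fun=> 0).
  have [u [Wu Pu u0 Hu]] :=
    nonneg_minimizer Yg oOmega Omega0 n0 s01 K1 GK M0 OM m0.
  have [lam lam0 el] :=
    minimizer_eigenpair Yg oOmega n0 s01 gGp p0 K1 GK cP0 cPP m0 Wu Pu Hu.
  by exists (lam, u) => _; split => //=; rewrite -massE.
have [lu Hlu] := choice H.
exists (fun m => (lu m).1), (fun m => (lu m).2); split.
  by move=> m /Hlu[lc el u0 Pu]; split => //; exact: lt_le_trans lc.
by exists (cP / pplus) => // m /Hlu[].
Qed.
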